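(* Let $m,m_0$ be nonnegative integers, let $G$ be a bipartite graph, let $k\ge 2$ be an integer, and let $f:V(G)\rightarrow \mathbb{Z}_k$ be a mapping compatible with $G$. If $G$ is $(2m+2m_0+4k-4)$-edge-connected, then $G$ has an $m$-tree-connected factor $H$ with $d_H(v)\equiv f(v)\pmod k$ for every vertex $v$, such that $G\setminus E(H)$ is $m_0$-tree-connected and for each vertex $v$, $$\left\lfloor \frac{d_G(v)}{2}\right\rfloor -(k-1) -m_0\le d_H(v) \le \left\lceil \frac{d_G(v)}{2}\right\rceil+(k-1)+m.$$ Furthermore, for an arbitrary given vertex $z$ and any integer $t$ with $t\equiv f(z)\pmod k$ and $\lfloor d_G(z)/2\rfloor -(k-1)-m_0\le t\le \lceil d_G(z)/2\rceil+(k-1)+m$, $H$ can be chosen so that additionally $d_H(z)=t$.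
   Context: Graphs may have loops and multiple edges. A factor is a spanning subgraph. A graph is $m$-tree-connected if it contains $m$ edge-disjoint spanning trees. For $A\subseteq V(G)$, $e_G(A)$ is the number of edges with both ends in $A$. A mapping $f:V(G)\to\mathbb{Z}_k$ is compatible with $G$ with respect to a partition $X,Y$ of $V(G)$ if either $\sum_{v\in X} f(v)-2x\equiv \sum_{v\in Y}f(v) \pmod k$ for some integer $0\le x\le e_G(X)$, or $\sum_{v\in X} f(v)\equiv \sum_{v\in Y}f(v)-2y \pmod k$ for some integer $0\le y\le e_G(Y)$; $f$ is compatible with $G$ if it is compatible with respect to every partition $X,Y$ of $V(G)$. *)

(* Defs.v *)
From mathcomp Require Import all_boot all_order all_algebra.

Set Implicit Arguments.
Unset Strict Implicit.
Unset Printing Implicit Defensive.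

Import GRing.Theory Num.Theory.
Local Open Scope ring_scope.

(** Finite undirected multigraphs, loops and parallel edges allowed.  The two
    ends of an edge are listed in an arbitrary order, and every notion below is
    symmetric in [src] and [tgt].  A factor (spanning subgraph) of [G] is given
    by its edge set [F : {set edge G}]; [G] itself is the factor [setT], and
    [G \ E(H)] is [~: H]. *)
Record mgraph := MGraph {
  vert : finType;
  edge : finType;
  src : edge -> vert;
  tgt : edge -> vert
}.

Section Multigraph.
Variable G : mgraph.
Implicit Types (F H : {set edge G}) (X Y : {set vert G}).

Definition joins (e : edge G) (u v : vert G) : bool :=
  ((src e == u) && (tgt e == v)) || ((src e == v) && (tgt e == u)).

(** A loop contributes 2. *)
Definition deg F (v : vert G) : nat :=
  (#|[set e in F | src e == v]| + #|[set e in F | tgt e == v]|)%N.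

Definition edges_in X : nat :=
  #|[set e : edge G | (src e \in X) && (tgt e \in X)]|.

Definition bipartite : Prop :=
  exists X : {set vert G}, forall e, (src e \in X) != (tgt e \in X).

Definition adj F : rel (vert G) :=
  [rel u v | [exists e in F, joins e u v]].

Definition connected F : Prop := forall u v, connect (adj F) u v.

(** The cycle has length [n.+1]: length 1 is a loop, and length 2 is a pair of
    parallel edges.  [ordS] is the cyclic successor. *)
Definition has_cycle F : Prop :=
  exists (n : nat) (c : 'I_n.+1 -> vert G) (e : 'I_n.+1 -> edge G),
    [/\ injective c, injective e &
        forall i, e i \in F /\ joins (e i) (c i) (c (ordS i))].

Definition spanning_tree F : Prop := connected F /\ ~ has_cycle F.

Definition tree_connected (m : nat) F : Prop :=
  exists T : 'I_m -> {set edge G},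
    [/\ forall i, T i \subset F,
        forall i, spanning_tree (T i) &
        forall i j, i != j -> [disjoint T i & T j]].

(** As usual, the one-vertex graph is not [l]-edge-connected for [l >= 2]. *)
Definition edge_connected (l : nat) : Prop :=
  (1 < #|vert G|)%N /\
  forall F : {set edge G}, (#|F| < l)%N -> connected (~: F).

(** Since [compatible] ranges over all [X], a part may be empty. *)
Definition compatible_wrt (k : nat) (f : vert G -> 'Z_k) X Y : Prop :=
  (exists2 x : nat, (x <= edges_in X)%N &
     \sum_(v in X) f v - (2 * x)%:R = \sum_(v in Y) f v) \/
  (exists2 y : nat, (y <= edges_in Y)%N &
     \sum_(v in X) f v = \sum_(v in Y) f v - (2 * y)%:R).

Definition compatible (k : nat) (f : vert G -> 'Z_k) : Prop :=
  forall X, compatible_wrt f X (~: X).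

Definition in_degree_range (m m0 k : nat) (v : vert G) (d : int) : Prop :=
  ((deg setT v)./2)%:Z - (k%:Z - 1) - m0%:Z <= d
  /\ d <= (uphalf (deg setT v))%:Z + (k%:Z - 1) + m%:Z.

Definition modulo_factor (m m0 k : nat) (f : vert G -> 'Z_k) H : Prop :=
  [/\ tree_connected m H,
      forall v, (deg H v)%:R = f v :> 'Z_k,
      tree_connected m0 (~: H) &
      forall v, in_degree_range m m0 k v (deg H v)%:Z].

End Multigraph.

(* Main.v *)
(** Orient every edge of [H] from the side [X] of the bipartition to the other
    side and every other edge backwards: then [2 d_H(v) - d_G(v)] is, up to the
    sign of the side of [v], out-degree minus in-degree.  So one seeks an
    orientation whose net out-degrees are prescribed modulo [2k].

    Start from a nearly balanced orientation in which every nonempty set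
    avoiding [z] has at least [m + m0 + 2k - 2] leaving arcs.  By Edmonds'
    theorem it contains [m + m0] disjoint in-branchings to [z]; the first [m] are
    put into [H] and the others outside.  The remaining arcs still have [2k - 2]
    leaving arcs at each such set, and only they may be reversed.  Vertices are
    eliminated by lifting pairs of consecutive arcs, small cuts are contracted,
    and what is left is oriented by an inductive theorem on orientations modulo
    [2k] extending a prescribed boundary.  Lifting at [z] down to in-degree
    [2k - 2] makes the residue [0] there force the value [0], which fixes the
    degree of [z]. *)
Require Import Defs.
From mathcomp Require Import all_boot all_order all_algebra zify ring.
Set Implicit Arguments.
Unset Strict Implicit.
Unset Printing Implicit Defensive.
Import Order.TTheory GRing.Theory Num.Theory.
Local Open Scope ring_scope.

(** * Distance to the multiples of [2k] *)

(** The obstacle is that degrees must be right modulo [k] and lie in a bounded interval, whereas an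
    orientation theorem modulo [2k] alone controls residues. Two facts bridge this. The extension
    theorem also keeps net out-degrees below [2k] in absolute value, so a residue leaves at most two
    values. And at a vertex other than [z] with at least [2k - 2] leaving arcs and net out-degree
    [nu] there is a dichotomy: if [nu >= k - 1], or if [nu >= 0] is at least the distance of the
    wanted residue to the multiples of [2k], then the [nu] arcs left after lifting already realise
    the residue inside the interval; otherwise the degree is at least [2k - 2] plus that distance,
    which is the cut condition of the extension theorem, and all candidate values lie in the
    interval. The boundary of the extension theorem acts like one outside vertex whose arcs are
    already oriented. The upper bound on its size is the cut condition reversed, so a tight set
    inherits it once the arcs leaving that set are fixed. *)

Section DistanceToMultiples.
Variable k : nat.

Definition dist2k (n : int) : int :=
  Num.min (n %% (2 * k)%:Z)%Z ((2 * k)%:Z - (n %% (2 * k)%:Z)%Z).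

Hypothesis hk : (2 <= k)%N.
Local Notation N := dist2k.
Local Notation c := ((2 * k)%:Z).

Lemma dist2k_le n : N n <= k%:Z. Proof. rewrite /N; lia. Qed.
Lemma dist2k_ge0 n : 0 <= N n. Proof. rewrite /N; lia. Qed.

Lemma dist2kP n : exists q m, [/\ n = q * c + m, - k%:Z < m, m <= k%:Z & N n = `|m|].
Proof.
have := divz_eq n c; rewrite /N.
have [h1 h2] : 0 <= (n %% c)%Z /\ (n %% c)%Z < c by lia.
set q := (n %/ c)%Z; set m := (n %% c)%Z in h1 h2 * => e.
case: (leP m k%:Z) => h; [exists q, m | exists (q + 1), (m - c)]; split; lia.
Qed.

Lemma dist2kE q m n : n = q * c + m -> `|m| <= k%:Z -> N n = `|m|.
Proof.
move=> e h; rewrite /N.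
have [h0|h0] := leP 0 m.
  have -> : (n %% c)%Z = m by rewrite e modzMDl modz_small //; lia.
  lia.
have -> : (n %% c)%Z = m + c.
  rewrite e (_ : q * c + m = (q - 1) * c + (m + c)); last by ring.
  by rewrite modzMDl modz_small //; lia.
lia.
Qed.

Lemma dist2kD q n : N (q * c + n) = N n.
Proof.
have [p [m [e h1 h2 ->]]] := dist2kP n.
apply: (@dist2kE (q + p)); last by lia.
by rewrite e; ring.
Qed.

Lemma dist2k_congr a b : (c %| a - b)%Z -> N a = N b.
Proof.
case/dvdzP=> q e; have -> : a = q * c + b by rewrite -e; ring.
exact: dist2kD.
Qed.

Lemma dist2kN n : N (- n) = N n.
Proof.
have [p [m [e h1 h2 ->]]] := dist2kP n.
by rewrite (@dist2kE (- p) (- m)); lia.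
Qed.

Lemma dist2k_dvd n : (c %| n)%Z = (N n == 0).
Proof.
have [p [m [e h1 h2 ->]]] := dist2kP n.
apply/idP/eqP=> [/dvdzP[q eq]|h]; last by apply/dvdzP; exists p; lia.
have {eq e} : (q - p) * c = m by rewrite mulrBl -eq e; ring.
move: (q - p) => d ed.
have [d0|[d0|d0]] : d = 0 \/ 1 <= d \/ d <= -1 by lia.
- by rewrite -ed d0 mul0r.
- nia.
- nia.
Qed.

Lemma dist2k_abs_le n : N n <= `|n|.
Proof.
have [p [m [e h1 h2 ->]]] := dist2kP n.
have [p0|[p0|p0]] : p = 0 \/ p <= -1 \/ 1 <= p by lia.
- by rewrite e p0; lia.
- nia.
- nia.
Qed.

Lemma dist2k_triangle a b : N (a + b) <= N a + N b.
Proof.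
have [p [m [e h1 h2 ->]]] := dist2kP a.
have [p' [m' [e' h1' h2' ->]]] := dist2kP b.
have -> : a + b = (p + p') * c + (m + m') by rewrite e e'; ring.
rewrite dist2kD; have := dist2k_abs_le (m + m'); lia.
Qed.

Lemma dist2k_lip a d : N (a + d) <= N a + `|d|.
Proof. have := dist2k_triangle a d; have := dist2k_abs_le d; lia. Qed.

Lemma dist2k_lip' a d : N a - `|d| <= N (a + d).
Proof. have := dist2k_lip (a + d) (- d); rewrite addrK; lia. Qed.

(** The modulus is even, so the distance keeps the parity of [n]. Defects of cut conditions are
    therefore even, and a condition that is not tight has 2 to spare. *)
Lemma dist2k_parity n : exists j, N n = n + j * 2.
Proof.
have [p [m [e h1 h2 ->]]] := dist2kP n.
have [h|h] := leP 0 m; [exists (- p * k%:Z) | exists (- p * k%:Z - m)]; lia.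
Qed.

Lemma dist2k_step n : N n != 0 -> N (n - 1) = N n - 1 \/ N (n + 1) = N n - 1.
Proof.
have [p [m [e h1 h2 ->]]] := dist2kP n => h.
have [h0|h0] := leP 0 m; [left | right].
  by rewrite (@dist2kE p (m - 1)); lia.
by rewrite (@dist2kE p (m + 1)); lia.
Qed.

Lemma dist2k_up n : N n < k%:Z -> N (n - 1) = N n + 1 \/ N (n + 1) = N n + 1.
Proof.
have [p [m [e h1 h2 ->]]] := dist2kP n => h.
have [h0|h0] := leP 0 m; [right | left].
  by rewrite (@dist2kE p (m + 1)); lia.
by rewrite (@dist2kE p (m - 1)); lia.
Qed.

Lemma dist2k_near n : `|n| < c -> N n = `|n| \/ N n = c - `|n|.
Proof.
move=> h; have [h1|h1] := leP `|n| k%:Z.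
  by left; apply: (@dist2kE 0); lia.
have [h0|h0] := leP 0 n; right.
  by rewrite (@dist2kE 1 (n - c)); lia.
by rewrite (@dist2kE (- 1) (n + c)); lia.
Qed.

End DistanceToMultiples.

(** * Arc lists and their reorientations *)

Section Arcs.
Variable V : finType.
Implicit Types (F T : seq (V * V)) (A B W : {set V}) (s : V -> int).

Definition cut F A : nat := count (fun e => (e.1 \in A) != (e.2 \in A)) F.
Definition dout F A : nat := count (fun e => (e.1 \in A) && (e.2 \notin A)) F.
Definition din F A : nat := count (fun e => (e.1 \notin A) && (e.2 \in A)) F.
Definition net F v : int := \sum_(e <- F) ((e.1 == v)%:Z - (e.2 == v)%:Z).

Definition reor F F' := all2 (fun e e' => (e' == e) || (e' == (e.2, e.1))) F F'.

(** Only the net out-degrees of a reorientation are retained, so that lifting and contraction become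
    operations on functions. *)
Definition ori F s := exists2 F', reor F F' & forall v, s v = net F' v.

(** Equality as undirected edge lists: a chosen edge can be moved to the front in either
    direction. *)
Definition same_edges F F2 := exists2 F3, perm_eq F F3 & reor F3 F2.

Lemma cutE F A : cut F A = (dout F A + din F A)%N.
Proof.
rewrite /cut /dout /din; elim: F => //= e F ->.
by case: (e.1 \in A); case: (e.2 \in A) => /=; lia.
Qed.

Lemma net_nil v : net [::] v = 0. Proof. by rewrite /net big_nil. Qed.
Lemma net_cons e F v : net (e :: F) v = (e.1 == v)%:Z - (e.2 == v)%:Z + net F v.
Proof. by rewrite /net big_cons. Qed.
Lemma net_cat F1 F2 v : net (F1 ++ F2) v = net F1 v + net F2 v.
Proof. by rewrite /net big_cat. Qed.
Lemma net_perm F1 F2 v : perm_eq F1 F2 -> net F1 v = net F2 v.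
Proof. by move=> h; rewrite /net (perm_big _ h). Qed.

Lemma sum_ind x A : \sum_(v in A) (x == v)%:Z = (x \in A)%:Z :> int.
Proof.
have [xA|xA] := boolP (x \in A).
  rewrite (bigD1 x) //= eqxx big1 ?addr0 // => v /andP[_ vx].
  by rewrite eq_sym (negbTE vx).
rewrite big1 // => v vA; case: eqP => // e; by rewrite e vA in xA.
Qed.

Lemma sum_net F A : \sum_(v in A) net F v = (dout F A)%:Z - (din F A)%:Z.
Proof.
elim: F => [|e F IH]; first by rewrite big1 // => v _; rewrite net_nil.
under eq_bigr do rewrite net_cons.
rewrite big_split sumrB !sum_ind /= IH.
by rewrite /dout /din /=; case: (e.1 \in A); case: (e.2 \in A) => /=; lia.
Qed.

Lemma reor_cut F F' A : reor F F' -> cut F' A = cut F A.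
Proof.
rewrite /cut; elim: F F' => [|e F IH] [|e' F'] //= /andP[h /IH ->].
by case/orP: h => /eqP -> //=; rewrite eq_sym.
Qed.

Lemma ori_cut F s A : ori F s ->
  `|\sum_(v in A) s v| <= (cut F A)%:Z /\
  exists j, \sum_(v in A) s v = (cut F A)%:Z + j * 2.
Proof.
case=> F' hF hs; under eq_bigr do rewrite hs.
rewrite sum_net -(reor_cut A hF) cutE; split; first by lia.
by exists (- (din F' A)%:Z); lia.
Qed.

Lemma ori_cut1 F s v : ori F s ->
  `|s v| <= (cut F [set v])%:Z /\ exists j, s v = (cut F [set v])%:Z + j * 2.
Proof. by move/(@ori_cut _ _ [set v]); rewrite big_set1. Qed.

Lemma ori_zero F s v : ori F s -> cut F [set v] = 0%N -> s v = 0.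
Proof. by move=> /(@ori_cut1 _ _ v)[h _] e; move: h; rewrite e normr_le0 => /eqP. Qed.

Lemma ori_sum F s W : ori F s ->
  all (fun e => (e.1 \in W) && (e.2 \in W)) F -> \sum_(v in W) s v = 0.
Proof.
move=> /(@ori_cut _ _ W)[h _] hW; have : cut F W = 0%N.
  rewrite /cut (eq_in_count (a2 := pred0)) ?count_pred0 //.
  by move=> e /(allP hW)/andP[-> ->].
lia.
Qed.

Lemma ori_ext F s s' : (forall v, s v = s' v) -> ori F s -> ori F s'.
Proof. by move=> h [F' hF hs]; exists F' => // v; rewrite -h. Qed.

Lemma reor_refl F : reor F F.
Proof. by elim: F => //= e F ->; rewrite eqxx. Qed.

Lemma ori_nil : ori [::] (fun => 0).
Proof. by exists [::] => // v; rewrite net_nil. Qed.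

Lemma reor_cat F1 F2 F1' F2' : reor F1 F1' -> reor F2 F2' -> reor (F1 ++ F2) (F1' ++ F2').
Proof. by elim: F1 F1' => [|e F1 IH] [|e' F1'] //= /andP[-> h1] h2; apply: IH. Qed.

Lemma reor_cat_inv F1 F2 F' : reor (F1 ++ F2) F' ->
  exists F1' F2', [/\ F' = F1' ++ F2', reor F1 F1' & reor F2 F2'].
Proof.
elim: F1 F' => [|e F1 IH] F' /= => [h|]; first by exists [::], F'.
case: F' => //= e' F' /andP[he /IH[F1' [F2' [-> h1 h2]]]].
by exists (e' :: F1'), F2'; split=> //=; rewrite he.
Qed.

Lemma ori_cat F1 F2 s1 s2 : ori F1 s1 -> ori F2 s2 ->
  ori (F1 ++ F2) (fun v => s1 v + s2 v).
Proof.
move=> [F1' h1 e1] [F2' h2 e2]; exists (F1' ++ F2'); first exact: reor_cat.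
by move=> v; rewrite net_cat e1 e2.
Qed.

Lemma ori_perm F F2 s : perm_eq F F2 -> ori F s -> ori F2 s.
Proof.
move: F F2; apply: catCA_perm_ind => s1 s2 s3 [F' hF hs].
have [F1 [F23 [e h1 h23]]] := reor_cat_inv hF.
have [F2 [F3 [e' h2 h3]]] := reor_cat_inv h23.
exists (F2 ++ F1 ++ F3); first by rewrite !reor_cat.
by move=> v; rewrite hs e e' !net_cat; ring.
Qed.

Lemma ori_reor F F2 s : reor F F2 -> ori F2 s -> ori F s.
Proof.
move=> h [F' hF hs]; exists F' => // {hs}.
elim: F F2 F' h hF => [|e F IH] [|e2 F2] [|e' F'] //= /andP[h1 h2] /andP[h3 h4].
rewrite (IH _ _ h2 h4) andbT.
case/orP: h1 h3 => /eqP-> //; rewrite orbC; case: e => a b /=.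
by case/orP=> /eqP->; rewrite eqxx ?orbT.
Qed.

Lemma ori_same F F2 s : same_edges F F2 -> ori F2 s -> ori F s.
Proof.
move=> [F3 hp hr] h; apply: ori_perm (ori_reor hr h).
by rewrite perm_sym.
Qed.

Lemma cut_same F F2 A : same_edges F F2 -> cut F2 A = cut F A.
Proof. by move=> [F3 hp hr]; rewrite (reor_cut _ hr); apply/esym/permP. Qed.

Lemma size_same F F2 : same_edges F F2 -> size F2 = size F.
Proof.
move=> [F3 /perm_size-> hr].
by elim: F3 F2 hr => [|e F3 IH] [|e2 F2] //= /andP[_ /IH->].
Qed.

Lemma all_same (P : pred (V * V)) F F2 : (forall a b, P (a, b) = P (b, a)) ->
  same_edges F F2 -> all P F2 = all P F.
Proof.
move=> hP [F3 /perm_all -> hr].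
elim: F3 F2 hr => [|[a b] F3 IH] [|e2 F2] //= /andP[h /IH->].
by case/orP: h => /eqP-> //=; rewrite hP.
Qed.

Lemma same_edges_cons e F F2 : same_edges F F2 -> same_edges (e :: F) (e :: F2).
Proof.
move=> [F3 hp hr]; exists (e :: F3); first by rewrite perm_cons.
by rewrite /= eqxx.
Qed.

Lemma pick_edge F A : (0 < cut F A)%N ->
  exists x y F', [/\ x \in A, y \notin A & same_edges F ((x, y) :: F')].
Proof.
rewrite -has_count => /hasP[[a b] /= hin hab].
have hp := perm_to_rem hin.
have [aA|aA] := boolP (a \in A).
  exists a, b, (rem (a, b) F); split=> //; first by move: hab; rewrite aA; case: (b \in A).
  by exists ((a, b) :: rem (a, b) F) => //; apply: reor_refl.
exists b, a, (rem (a, b) F); split=> //; first by move: hab; rewrite (negbTE aA); case: (b \in A).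
exists ((a, b) :: rem (a, b) F) => //=.
by rewrite eqxx orbT reor_refl.
Qed.

Lemma ori_cons x y F s : ori F s ->
  ori ((x, y) :: F) (fun v => s v + (x == v)%:Z - (y == v)%:Z).
Proof.
move=> [F' hF hs]; exists ((x, y) :: F'); first by rewrite /= eqxx.
by move=> v; rewrite net_cons hs /=; ring.
Qed.

(** The lifted edge opens up to a directed path through [x], which enters and leaves [x] once and so
    changes no net out-degree. *)
Lemma ori_lift u x w F s : ori ((u, w) :: F) s -> ori ((u, x) :: (x, w) :: F) s.
Proof.
move=> [[//|e F'] /= /andP[he hF] hs].
case/orP: he hs => /eqP-> hs.
  exists ((u, x) :: (x, w) :: F'); first by rewrite /= !eqxx.
  by move=> v; rewrite hs !net_cons /=; ring.
exists ((x, u) :: (w, x) :: F'); first by rewrite /= !eqxx !orbT.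
by move=> v; rewrite hs !net_cons /=; ring.
Qed.

Lemma ori_opp F s : ori F s -> ori F (fun v => - s v).
Proof.
move=> [F' hF hs]; exists (map (fun e => (e.2, e.1)) F').
  elim: F F' hF {hs} => [|[a b] F IH] [|[a' b'] F'] //= /andP[he /IH->].
  by rewrite andbT; case/orP: he => /eqP[-> ->] /=; rewrite eqxx ?orbT.
move=> v; rewrite hs; elim: F' {hF hs} => [|e F' IH] /=; first by rewrite !net_nil oppr0.
by rewrite !net_cons opprD IH /=; ring.
Qed.

Lemma ori_map (p : V -> V) F s :
  ori (map (fun e => (p e.1, p e.2)) F) s ->
  exists2 s', ori F s' & forall v, s v = \sum_(u | p u == v) s' u.
Proof.
move=> [G' hG hs].
have [F' hF e] : exists2 F', reor F F' & G' = map (fun e => (p e.1, p e.2)) F'.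
  elim: F G' hG {hs} => [|[a b] F IH] [|e' G'] //=; first by exists [::].
  case/andP=> h /IH[F' hF ->].
  by case/orP: h => /eqP->; [exists ((a, b) :: F') | exists ((b, a) :: F')];
     rewrite //= ?eqxx ?orbT.
exists (net F'); first by exists F'.
move=> v; rewrite hs {}e.
elim: F' {hF hs hG} => [|[a b] F' IH] /=.
  by rewrite net_nil big1 // => u _; rewrite net_nil.
rewrite net_cons IH; under [RHS]eq_bigr do rewrite net_cons.
have h x : \sum_(u | p u == v) (x == u)%:Z = (p x == v)%:Z :> int.
  rewrite -[RHS](congr1 (fun b : bool => b%:Z) (in_set (fun u => p u == v) x)) -sum_ind.
  by apply: eq_bigl => u; rewrite in_set.
by rewrite big_split sumrB /= !h.
Qed.

Lemma ori_star x (O : seq (V * V)) (t : int) :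
  all (fun e => (e.1 == x) && (e.2 != x)) O ->
  `|t| <= (size O)%:Z -> (exists j, t = (size O)%:Z + j * 2) ->
  exists2 s, ori O s & s x = t.
Proof.
elim: O t => [|[a b] O IH] t /=.
  by move=> _ h _; exists (fun => 0); [apply: ori_nil | lia].
case/andP=> /andP[/eqP-> hb] hO ht [j ej].
(* Greedy choice towards 0. At [t = 0] parity leaves at least one further edge to absorb the
   overshoot to -1. *)
have [h|h] := leP 0 t.
  have [||s hs es] := IH (t - 1) hO; [lia | by exists j; lia |].
  exists (fun v => s v + (x == v)%:Z - (b == v)%:Z); first exact: ori_cons.
  by rewrite es eqxx (negbTE hb); lia.
have [||s hs es] := IH (t + 1) hO; [lia | by exists (j + 1); lia |].
exists (fun v => s v + (b == v)%:Z - (x == v)%:Z).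
  by apply: ori_reor (ori_cons b x hs); rewrite /= eqxx orbT reor_refl.
by rewrite es eqxx (negbTE hb); lia.
Qed.

Lemma cut_parity F A : exists j, \sum_(x in A) (cut F [set x])%:Z = (cut F A)%:Z + j * 2.
Proof.
exists (\sum_(x in A) (din F [set x])%:Z - (din F A)%:Z).
have h : \sum_(x in A) ((dout F [set x])%:Z - (din F [set x])%:Z) =
         (dout F A)%:Z - (din F A)%:Z.
  by rewrite -sum_net; apply: eq_bigr => x _; rewrite -sum_net big_set1.
rewrite sumrB in h.
under eq_bigr do rewrite cutE PoszD.
rewrite big_split /= cutE; move: h; set a := \sum_(i in A) _; set b := \sum_(i in A) _; lia.
Qed.

Lemma cutC F W A : all (fun e => (e.1 \in W) && (e.2 \in W)) F -> cut F (W :\: A) = cut F A.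
Proof.
move=> hW; apply: eq_in_count => e /(allP hW)/andP[h1 h2].
by rewrite !inE h1 h2 !andbT; case: (_ \in A); case: (_ \in A).
Qed.

End Arcs.

(** * Sums of integer functions over vertex sets *)

Section Sums.
Variable V : finType.
Implicit Types (F : seq (V * V)) (A B W : {set V}) (g : V -> int).

Definition sm g A : int := \sum_(x in A) g x.
Definition upd g x (d : int) : V -> int := fun v => g v + d *+ (x == v).

Lemma sm_upd g x d A : sm (upd g x d) A = sm g A + d *+ (x \in A).
Proof.
rewrite /sm /upd big_split /=; congr (_ + _).
have [xA|xA] := boolP (x \in A).
  rewrite (bigD1 x) //= eqxx big1 ?addr0 // => v /andP[_ vx].
  by rewrite eq_sym (negbTE vx).
by rewrite big1 // => v vA; case: eqP => // e; rewrite e vA in xA.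
Qed.

Lemma sm_opp g A : sm (fun v => - g v) A = - sm g A.
Proof. by rewrite /sm sumrN. Qed.
Lemma sm_add g h A : sm (fun v => g v + h v) A = sm g A + sm h A.
Proof. by rewrite /sm big_split. Qed.
Lemma sm1 g x : sm g [set x] = g x. Proof. exact: big_set1. Qed.
Lemma smD1 g x A : x \in A -> sm g A = g x + sm g (A :\ x).
Proof. by move=> xA; rewrite /sm (big_setD1 x). Qed.
Lemma smC g A W : A \subset W -> sm g W = sm g A + sm g (W :\: A).
Proof.
move=> h; rewrite /sm (big_setID A) /=; congr (_ + _).
by apply: eq_bigl => v; rewrite (setIidPr h).
Qed.
Lemma eq_sm g h A : (forall x, x \in A -> g x = h x) -> sm g A = sm h A.
Proof. exact: eq_bigr. Qed.
Lemma sm_ge0 g A : (forall x, x \in A -> 0 <= g x) -> 0 <= sm g A.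
Proof. exact: sumr_ge0. Qed.

Lemma dvdz_sum (d : int) g A : (forall x, x \in A -> (d %| g x)%Z) -> (d %| sm g A)%Z.
Proof. by move=> h; apply: rpred_sum => x /h. Qed.

End Sums.

(** * Contraction of a vertex set *)

Section Contraction.
Variables (V : finType) (W A : {set V}) (a0 : V).
Hypotheses (a0A : a0 \in A) (AW : A \subset W).
Implicit Types (F : seq (V * V)) (B : {set V}) (g s : V -> int).

(** The contracted vertex is represented by the element [a0] of [A], so the vertex type never
    changes. Arcs inside [A] go to [inner], hence [quot] creates no loop at [a0]. *)
Definition proj (v : V) := if v \in A then a0 else v.
Definition quot_set := a0 |: (W :\: A).
Definition quot_fun g : V -> int := fun v => if v == a0 then sm g A else g v.
Definition pre B := [set v in W | proj v \in B].
Definition inner F := [seq e <- F | (e.1 \in A) && (e.2 \in A)].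
Definition outer F := [seq e <- F | ~~ ((e.1 \in A) && (e.2 \in A))].
Definition quot F := [seq (proj e.1, proj e.2) | e <- outer F].

Lemma card_quot : (#|quot_set| + #|A| = #|W| + 1)%N.
Proof.
rewrite cardsU1 !inE a0A /= add1n addSn addn1; congr _.+1.
by rewrite cardsD (setIidPr AW) subnK // subset_leq_card.
Qed.

Lemma proj_quot v : v \in W -> proj v \in quot_set.
Proof. by rewrite /proj !inE => vW; case: ifP => vA; rewrite ?eqxx // vA vW orbT. Qed.

Lemma pre_sub B : pre B \subset W. Proof. by apply/subsetP=> v; rewrite inE => /andP[]. Qed.

Lemma pre_neq B : B \subset quot_set -> B != quot_set -> pre B != W.
Proof.
move=> BW; apply: contra => /eqP e; rewrite eqEsubset BW /=; apply/subsetP=> v.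
rewrite !inE => h; have vW : v \in W by case/orP: h => [/eqP->|/andP[]//]; apply: (subsetP AW).
move: (vW); rewrite -{1}e inE => /andP[_]; rewrite /proj.
case/orP: h => [/eqP->|/andP[/negbTE-> _] //]; by rewrite a0A.
Qed.

Lemma in_pre B v : B \subset quot_set -> v \notin A -> (v \in pre B) = (v \in B).
Proof.
move=> BW vA; rewrite inE /proj (negbTE vA) andb_idl // => /(subsetP BW).
by rewrite !inE => /orP[/eqP e|/andP[]//]; rewrite e a0A in vA.
Qed.

Lemma in_preA B v : v \in A -> (v \in pre B) = (a0 \in B).
Proof. by move=> vA; rewrite inE /proj vA (subsetP AW). Qed.

Lemma sm_quot g B : B \subset quot_set -> sm (quot_fun g) B = sm g (pre B).
Proof.
move=> BW; have h v : v \in B -> v != a0 -> v \notin A.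
  by move/(subsetP BW); rewrite !inE => /orP[->//|/andP[]].
have [aB|aB] := boolP (a0 \in B).
  have AP : A \subset pre B by apply/subsetP=> v vA; rewrite in_preA.
  rewrite (smD1 _ aB) /quot_fun eqxx (smC _ AP); congr (_ + _).
  have -> : pre B :\: A = B :\ a0.
    apply/setP=> v; rewrite !in_setD in_set1.
    have [vA|vA] := boolP (v \in A); last first.
      by rewrite in_pre //=; case: eqP => // e; rewrite e a0A in vA.
    by rewrite /=; apply/esym/negP=> /andP[va /h/(_ va)]; rewrite vA.
  by apply: eq_sm => v; rewrite !inE => /andP[/negbTE-> _].
have -> : pre B = B.
  apply/setP=> v; have [vA|vA] := boolP (v \in A); last exact: in_pre.
  rewrite in_preA // (negbTE aB); apply/esym/negP=> vB.
  by have [e|/(h _ vB)] := eqVneq v a0; [rewrite -e vB in aB | rewrite vA].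
by apply: eq_sm => v vB; rewrite /quot_fun; case: eqP => // e; rewrite -e vB in aB.
Qed.

Lemma perm_inner F : perm_eq (inner F ++ outer F) F.
Proof. by rewrite /inner /outer; apply/permPl/perm_filterC. Qed.

Section Count.
Variable R : bool -> bool -> bool.
Hypothesis R0 : forall b, R b b = false.
(** [R] stands for either of the tests behind [cut] and [dout]; [R0] says that an arc collapsed to a
    point is not counted. *)
Definition cnt F B := count (fun e => R (e.1 \in B) (e.2 \in B)) F.

Lemma cnt_quot F B : B \subset quot_set -> all (fun e => (e.1 \in W) && (e.2 \in W)) F ->
  cnt (quot F) B = cnt F (pre B).
Proof.
move=> BW; elim: F => //= e F IH /andP[/andP[h1 h2] /IH {}IH]; rewrite /quot /= .
have [/andP[e1 e2]|hn] := boolP ((e.1 \in A) && (e.2 \in A)) => /=.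
  by rewrite -/(quot F) IH /cnt /= !in_preA // R0.
by rewrite -/(quot F) /cnt /= -!/(cnt _ _) IH !inE h1 h2.
Qed.
End Count.

Lemma cut_quot F B : B \subset quot_set -> all (fun e => (e.1 \in W) && (e.2 \in W)) F ->
  cut (quot F) B = cut F (pre B).
Proof. by apply: (@cnt_quot (fun a b => a != b)) => b; rewrite eqxx. Qed.

Lemma dout_quot F B : B \subset quot_set -> all (fun e => (e.1 \in W) && (e.2 \in W)) F ->
  dout (quot F) B = dout F (pre B).
Proof. by apply: (@cnt_quot (fun a b => a && ~~ b)) => -[]. Qed.

Lemma quot_in F : all (fun e => (e.1 \in W) && (e.2 \in W)) F ->
  all (fun e => (e.1 \in quot_set) && (e.2 \in quot_set)) (quot F).
Proof.
move=> h; rewrite /quot all_map; apply/allP=> e; rewrite mem_filter => /andP[_].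
by move/(allP h)=> /= /andP[h1 h2]; rewrite !proj_quot.
Qed.

(** No arc of [outer F] has both ends in [A], so inside [A] its cut sizes add up vertex by
    vertex. *)
Lemma cut_outer F B : B \subset A ->
  sm (fun x => (cut (outer F) [set x])%:Z) B = (cut (outer F) B)%:Z.
Proof.
move=> BA; elim: F => [|e F IH]; first by rewrite /sm /cut /= big1.
rewrite /outer /=; case: ifP => he //; rewrite -/(outer F).
have -> : sm (fun x => (cut (e :: outer F) [set x])%:Z) B =
   sm (fun x => (e.1 == x)%:Z + (e.2 == x)%:Z + (cut (outer F) [set x])%:Z) B.
  apply: eq_sm => x xB; rewrite /cut /= !inE PoszD; congr (_ + _).
  case: (e.1 =P x) => e1; case: (e.2 =P x) => e2 //=.
  by move: he; rewrite e1 e2 (subsetP BA).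
rewrite !sm_add IH {1 2}/sm !sum_ind /cut /= PoszD; congr (_ + _).
have h v : v \in B -> v \in A by apply: subsetP.
move: he; case h1: (e.1 \in B); case h2: (e.2 \in B) => //=.
by rewrite (h _ h1) (h _ h2).
Qed.

Lemma cut_inner_outer F B : (cut F B = cut (inner F) B + cut (outer F) B)%N.
Proof. by rewrite /cut -count_cat; apply/esym/permP/perm_inner. Qed.

Lemma cut_inner_top F : cut (inner F) A = 0%N.
Proof.
rewrite /cut (eq_in_count (a2 := pred0)) ?count_pred0 // => e.
by rewrite mem_filter => /andP[/andP[-> ->]].
Qed.

Lemma ori_quot F s : ori (quot F) s ->
  exists2 s', ori (outer F) s' & (sm s' A = s a0 /\ forall v, v \notin A -> s' v = s v).
Proof.
case/ori_map=> s' hs es; exists s' => //; split.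
  rewrite es /sm; apply: eq_bigl => v; rewrite /proj.
  by case: ifP => [_|vA]; rewrite ?eqxx //; apply/esym/eqP=> e; rewrite e a0A in vA.
move=> v vA; rewrite es (big_pred1 v) // => u; rewrite /proj /=.
case: ifP => [uA|//]; apply/idP/idP=> /eqP e; last by rewrite -e uA in vA.
by rewrite -e a0A in vA.
Qed.

Lemma ori_inner_outer F s1 s2 : ori (inner F) s1 -> ori (outer F) s2 ->
  ori F (fun v => s1 v + s2 v).
Proof. by move=> h1 h2; apply: ori_perm (perm_inner F) (ori_cat h1 h2). Qed.

End Contraction.

(** * Orientations modulo [2k] extending a boundary *)

Section BoundaryExtension.
Variables (V : finType) (k : nat).
Hypothesis hk : (2 <= k)%N.
Local Notation c := ((2 * k)%:Z).
Local Notation N := (dist2k k).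
Implicit Types (F : seq (V * V)) (A B W S : {set V}) (z b r s : V -> int).

Definition inside W F := all (fun e : V * V => [&& e.1 \in W, e.2 \in W & e.1 != e.2]) F.

(** At [x], [z x] half-edges of the boundary are already oriented and contribute
    [b x] to the net out-degree, which must become [r x] modulo [2k].  The vertices
    of [S] are Steiner vertices: sets of them are exempt from the cut condition. *)
Record inst W S F z b r : Prop := Inst {
  i_F : inside W F;
  i_b : forall x, x \in W -> `|b x| <= z x;
  i_bp : forall x, x \in W -> (2 %| b x - z x)%Z;
  i_rp : forall x, x \in W -> (2 %| r x - (cut F [set x])%:Z - z x)%Z;
  i_S : S \proper W;
  i_Sr : forall x, x \in S -> (c %| r x)%Z;
  i_cut : forall A, A \subset W -> A != W -> ~~ (A \subset S) ->
    c - 2 + N (sm r A) <= (cut F A)%:Z + sm z A;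
  i_top : sm z W <= c - 2 + N (sm r W);
  i_sum : (c %| sm r W - sm b W)%Z }.

(** The bound below [2k] leaves at most two values for each net out-degree; it is what later turns
    residues into degree bounds. *)
Definition extendable W F b r := exists s, ori F s /\
  forall x, x \in W -> (c %| s x + b x - r x)%Z /\ `|s x + b x| < c.

(** By parity this is the first value above tightness. Singletons are left out because contracting
    them gains nothing, so every move must check them separately. *)
Definition slack W S F z r := forall A, A \subset W -> A != W -> ~~ (A \subset S) ->
  (1 < #|A|)%N -> c + N (sm r A) <= (cut F A)%:Z + sm z A.

Definition smaller W' F' z' W F z :=
  (#|W'| < #|W|)%N || ((#|W'| == #|W|) &&
  ((size F' < size F)%N || ((size F' == size F) && (sm z' W' < sm z W)))).

Definition extendable_below W F z := forall W' S' F' z' b' r',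
  inst W' S' F' z' b' r' -> smaller W' F' z' W F z -> extendable W' F' b' r'.

Lemma dist2k_par n : (2 %| N n - n)%Z.
Proof. have [j ->] := dist2k_parity hk n; lia. Qed.

Lemma dvd_eq (d x y : int) : (d %| x)%Z -> y = x -> (d %| y)%Z.
Proof. by move=> h ->. Qed.
Lemma dvd_eqN (d x y : int) : (d %| x)%Z -> y = - x -> (d %| y)%Z.
Proof. by move=> h ->; rewrite rpredN. Qed.

Lemma inside_in W F : inside W F -> all (fun e => (e.1 \in W) && (e.2 \in W)) F.
Proof. by apply: sub_all => e /and3P[-> ->]. Qed.

Lemma inst_opp W S F z b r : inst W S F z b r ->
  inst W S F z (fun v => - b v) (fun v => - r v).
Proof.
case=> h1 h2 h3 h4 h5 h6 h7 h8 h9; split=> //.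
- by move=> x /h2; rewrite normrN.
- by move=> x /h3; lia.
- by move=> x /h4; lia.
- by move=> x /h6; rewrite rpredN.
- by move=> A a1 a2 a3; rewrite sm_opp dist2kN //; apply: h7.
- by rewrite sm_opp dist2kN.
- by apply: dvd_eqN h9 _; rewrite !sm_opp; ring.
Qed.

Lemma extendable_opp W F b r : extendable W F (fun v => - b v) (fun v => - r v) -> extendable W F b r.
Proof.
case=> s [hs h]; exists (fun v => - s v); split; first exact: ori_opp.
move=> x /h[h1 h2]; split; last by lia.
by apply: dvd_eqN h1 _; ring.
Qed.

Lemma slack_opp W S F z r : slack W S F z r -> slack W S F z (fun v => - r v).
Proof. by move=> h A a1 a2 a3 a4; rewrite sm_opp dist2kN //; apply: h. Qed.

Lemma inst_same W S F F2 z b r : same_edges F F2 -> inst W S F z b r -> inst W S F2 z b r.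
Proof.
move=> e [h1 h2 h3 h4 h5 h6 h7 h8 h9]; split=> //.
- rewrite /inside (all_same _ e) // => x y /=.
  by rewrite eq_sym; case: (x \in W); rewrite /= ?andbF.
- by move=> x; rewrite (cut_same _ e); apply: h4.
- by move=> A; rewrite (cut_same _ e); apply: h7.
Qed.

Lemma extendable_same W F F2 b r : same_edges F F2 -> extendable W F2 b r -> extendable W F b r.
Proof. by move=> e [s [hs h]]; exists s; split=> //; apply: ori_same e hs. Qed.

Lemma slack_same W S F F2 z r : same_edges F F2 -> slack W S F z r -> slack W S F2 z r.
Proof. by move=> e h A; rewrite (cut_same _ e); apply: h. Qed.

Lemma extendable_below_same W F F2 z : same_edges F F2 -> extendable_below W F z -> extendable_below W F2 z.
Proof. by move=> e; rewrite /extendable_below /smaller (size_same e). Qed.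

Lemma cut_par W S F z b r A : inst W S F z b r -> A \subset W ->
  (2 %| N (sm r A) - (cut F A)%:Z - sm z A)%Z.
Proof.
move=> I AW; have := dist2k_par (sm r A); have [j] := cut_parity F A.
have : (2 %| sm (fun x => r x - (cut F [set x])%:Z - z x) A)%Z.
  by apply: dvdz_sum => x xA; apply: (i_rp I); apply: (subsetP AW).
rewrite /sm !sumrB; set a := \sum_(i in A) _; set d := \sum_(i in A) _.
set e := \sum_(i in A) _; lia.
Qed.

Lemma slackP W S F z b r : inst W S F z b r ->
  slack W S F z r \/ exists A, [/\ A \subset W, A != W, ~~ (A \subset S), (1 < #|A|)%N
    & (cut F A)%:Z + sm z A <= c - 2 + N (sm r A)].
Proof.
move=> I; case: (boolP [exists A : {set V}, [&& A \subset W, A != W, ~~ (A \subset S),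
  (1 < #|A|)%N & (cut F A)%:Z + sm z A <= c - 2 + N (sm r A)]]).
  by case/existsP=> A /and5P[*]; right; exists A.
rewrite negb_exists => /forallP h; left=> A a1 a2 a3 a4.
move: (h A); rewrite a1 a2 a3 a4 /=.
by have := cut_par I a1; have := i_cut I a1 a2 a3; lia.
Qed.

(** The quotient is oriented first; the arcs leaving [A] then become boundary half-edges of an
    instance on [A]. Tightness of [A] is exactly the bound [i_top] of that inner instance. *)
Lemma step_contract W S F z b r A : inst W S F z b r -> extendable_below W F z ->
  A \subset W -> A != W -> ~~ (A \subset S) -> (1 < #|A|)%N ->
  (cut F A)%:Z + sm z A <= c - 2 + N (sm r A) -> extendable W F b r.
Proof.
move=> I IH AW AnW AS A1 tight.
(* The representative is taken outside [S]: the contracted vertex is then no Steiner vertex, and a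
   set through it pulls back to one that obeys the cut condition. *)
have [a0 a0A a0S] := subsetPn AS.
have FW := inside_in (i_F I).
pose W' := quot_set W A a0; pose Q := quot_fun A a0.
have SQ g B : B \subset W' -> sm (Q g) B = sm g (pre W A a0 B) by exact: sm_quot.
have CQ B : B \subset W' -> cut (quot A a0 F) B = cut F (pre W A a0 B).
  by move=> h; apply: cut_quot.
have preW : pre W A a0 W' = W.
  apply/eqP; rewrite eqEsubset pre_sub /=.
  by apply/subsetP=> v vW; rewrite inE vW proj_quot.
have I' : inst W' (S :\: A) (quot A a0 F) (Q z) (Q b) (Q r).
  have hsub x : x \in W' -> [set x] \subset W' by rewrite sub1set.
  have xA x : x \in W' -> x != a0 -> x \in W.
    by rewrite !inE => /orP[->//|/andP[]].
  split.
  - rewrite /inside; apply/allP=> e he.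
    have := allP (quot_in A a0 FW) e he; rewrite /= andbA => ->/=.
    case/mapP: he => e'; rewrite mem_filter => /andP[h1 h2] -> /=.
    have /and3P[_ _ h3] := allP (i_F I) e' h2; move: h1; rewrite /proj.
    case: ifP => e1; case: ifP => e2 //= _; apply/eqP=> e0.
      by rewrite -e0 a0A in e2.
    by rewrite e0 a0A in e1.
  - move=> x xW; rewrite /Q /quot_fun; case: eqP => [_|/eqP hx].
      by apply: le_trans (ler_norm_sum _ _ _) (ler_sum _ _) => v vA; apply: (i_b I); apply: (subsetP AW).
    by apply: (i_b I); apply: xA.
  - move=> x xW; rewrite /Q /quot_fun; case: eqP => [_|/eqP hx]; last by apply: (i_bp I); apply: xA.
    by rewrite /sm -sumrB; apply: dvdz_sum => v vA; apply: (i_bp I); apply: (subsetP AW).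
  - move=> x xW; rewrite CQ ?hsub // -(sm1 (Q r)) -(sm1 (Q z)) !SQ ?hsub //.
    by have := cut_par I (pre_sub W A a0 [set x]); have := dist2k_par (sm r (pre W A a0 [set x])); clear; lia.
  - apply/properP; split; last by exists a0; rewrite !inE ?eqxx ?a0A.
    apply/subsetP=> x; rewrite !inE => /andP[-> /(subsetP (proper_sub (i_S I)))->].
    by rewrite orbT.
  - move=> x; rewrite !inE => /andP[xnA xS]; rewrite /Q /quot_fun.
    by case: eqP => [e|_]; [rewrite e a0A in xnA | apply: (i_Sr I)].
  - move=> B BW Bn BS; rewrite !SQ // CQ //.
    apply: (i_cut I); rewrite ?pre_sub ?(pre_neq a0A) //.
    have [v vB vS] := subsetPn BS.
    have [/(subsetP BW)] := (vB, tt); rewrite !inE => /orP[/eqP e _|/andP[vA vW] _].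
      by apply/subsetPn; exists a0 => //; rewrite in_preA // -e.
    apply/subsetPn; exists v; first by rewrite (in_pre a0A).
    by move: vS; rewrite !inE vA.
  - by rewrite !SQ // preW; exact: (i_top I).
  - by rewrite !SQ // preW; exact: (i_sum I).
have [s' [os' hs']] : extendable W' (quot A a0 F) (Q b) (Q r).
  apply: IH I' _; rewrite /smaller; have := card_quot a0A AW; rewrite -/W'; lia.
have [s2 os2 [sA s2n]] := ori_quot a0A os'.
pose z1 := fun x => z x + (cut (outer A F) [set x])%:Z.
pose b1 := fun x => b x + s2 x.
have a0W' : a0 \in W' by rewrite !inE eqxx.
have I1 : inst A (S :&: A) (inner A F) z1 b1 r.
  have inW x : x \in A -> x \in W by apply: (subsetP AW).
  have c1 B : B \subset A -> (cut (inner A F) B)%:Z + sm z1 B = (cut F B)%:Z + sm z B.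
    by move=> BA; rewrite sm_add cut_outer // (cut_inner_outer A F B); clear; lia.
  split.
  - apply/allP=> e; rewrite mem_filter => /andP[/andP[-> ->]] /(allP (i_F I)).
    by case/and3P.
  - by move=> x xA; have := ori_cut1 x os2; have := i_b I (inW x xA); rewrite /z1 /b1; clear; lia.
  - move=> x xA; have := i_bp I (inW x xA); have [_ [j ej]] := ori_cut1 x os2.
    by rewrite /z1 /b1 ej; clear; lia.
  - move=> x xA; have := i_rp I (inW x xA); have := c1 [set x]; rewrite sub1set => /(_ xA).
    by rewrite !sm1; clear; lia.
  - apply/properP; split; first exact: subsetIr.
    by exists a0; rewrite // inE negb_and a0S.
  - by move=> x; rewrite inE => /andP[/(i_Sr I)].
  - move=> B BA Bn BS; rewrite c1 //; apply: (i_cut I).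
    + exact: subset_trans BA AW.
    + apply: contra AnW => /eqP e; rewrite eqEsubset AW /= -e; exact: BA.
    + by apply: contra BS => h; rewrite subsetI h.
  - rewrite (_ : sm z1 A = (cut F A)%:Z + sm z A) // -c1 // cut_inner_top; lia.
  - have [h _] := hs' _ a0W'; rewrite sm_add -/(sm s2 A) sA.
    by apply: dvd_eqN h _; rewrite /Q /quot_fun eqxx; ring.
have [s1 [os1 hs1]] : extendable A (inner A F) b1 r.
  apply: IH I1 _; rewrite /smaller.
  have : (#|A| < #|W|)%N by apply: proper_card; rewrite properEneq AnW.
  by lia.
exists (fun v => s1 v + s2 v); split; first exact: ori_inner_outer os1 os2.
move=> x xW; have [xA|xA] := boolP (x \in A).
  have [h1 h2] := hs1 _ xA; split; first by apply: dvd_eq h1 _; rewrite /b1; ring.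
  by move: h2; rewrite /b1 [b x + _]addrC addrA.
have x0 : x != a0 by apply: contra xA => /eqP->.
have := hs' x; rewrite !inE xA xW orbT => /(_ isT); rewrite /Q /quot_fun (negbTE x0) -s2n //.
have -> : s1 x = 0.
  apply: ori_zero os1 _.
  rewrite /cut (eq_in_count (a2 := pred0)) ?count_pred0 // => e.
  rewrite mem_filter !inE => /andP[/andP[e1 e2] _].
  have h y : y \in A -> (y == x) = false by move=> yA; apply/eqP=> e0; rewrite -e0 yA in xA.
  by rewrite !h.
by rewrite add0r.
Qed.

End BoundaryExtension.

(** * Fixing one edge or dropping one half-edge *)

Section FixingEdges.
Variables (V : finType) (k : nat).
Hypothesis hk : (2 <= k)%N.
Local Notation c := ((2 * k)%:Z).
Local Notation N := (dist2k k).
Local Notation inst := (@inst V k).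
Local Notation extendable := (@extendable V k).
Local Notation slack := (@slack V k).
Local Notation extendable_below := (@extendable_below V k).
Implicit Types (F : seq (V * V)) (A B W S : {set V}) (z b r s : V -> int).

Lemma cut_cons x y F A : cut ((x, y) :: F) A = (((x \in A) != (y \in A)) + cut F A)%N.
Proof. by []. Qed.

(** Fix the edge [xy] as [x -> y]; at each end the half-edge is recorded or
    dropped by shifting the data by [dz] and [dr]. *)
Lemma fix_edge W S x y F z b r (dzx drx dzy dry : int) :
  inst W S ((x, y) :: F) z b r -> slack W S ((x, y) :: F) z r ->
  extendable_below W ((x, y) :: F) z ->
  `|b x + 1 + drx| <= z x + dzx -> (2 %| dzx - 1 - drx)%Z ->
  `|b y - 1 + dry| <= z y + dzy -> (2 %| dzy - 1 - dry)%Z ->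
  (x \in S -> drx = 0) -> (y \in S -> dry = 0) ->
  `|drx| <= dzx + 1 -> `|dry| <= dzy + 1 -> `|drx + dry| <= dzx + dzy + 2 ->
  (x \notin S -> c - 2 + N (r x + drx) <= (cut F [set x])%:Z + z x + dzx) ->
  (y \notin S -> c - 2 + N (r y + dry) <= (cut F [set y])%:Z + z y + dzy) ->
  sm z W + dzx + dzy <= c - 2 + N (sm r W + drx + dry) ->
  (forall n, (c %| n - (r x + drx))%Z -> `|n| < c -> `|n - drx| < c) ->
  (forall n, (c %| n - (r y + dry))%Z -> `|n| < c -> `|n - dry| < c) ->
  extendable W ((x, y) :: F) b r.
Proof.
move=> I sl IH bx px by_ py Sx Sy l1 l2 l3 cx cy top nx ny.
have /andP[/and3P[/= xW yW xy] FW] := i_F I.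
have yx : (y == x) = false by rewrite eq_sym; apply/negbTE.
have xy' := negbTE xy.
pose z' := upd (upd z x dzx) y dzy; pose b' := upd (upd b x (1 + drx)) y (dry - 1).
pose r' := upd (upd r x drx) y dry.
have I' : inst W S F z' b' r'.
  split=> //.
  - move=> v vW; have := i_b I vW; rewrite /b' /z' /upd.
    have [<-|_] := eqVneq x v.
      by rewrite yx !mulr1n !mulr0n; move: bx; clear; lia.
    have [<-|_] := eqVneq y v; rewrite !mulr0n ?mulr1n; last by clear; lia.
    by move: by_; clear; lia.
  - move=> v vW; have := i_bp I vW; rewrite /b' /z' /upd.
    have [<-|_] := eqVneq x v.
      by rewrite yx !mulr1n !mulr0n; move: px; clear; lia.
    have [<-|_] := eqVneq y v; rewrite !mulr0n ?mulr1n; last by clear; lia.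
    by move: py; clear; lia.
  - move=> v vW; have := i_rp I vW; rewrite /r' /z' /upd cut_cons !inE.
    have [<-|_] := eqVneq x v.
      by rewrite yx !mulr1n !mulr0n /=; move: px; clear; lia.
    have [<-|_] := eqVneq y v; rewrite !mulr0n ?mulr1n /=; last by clear; lia.
    by move: py; clear; lia.
  - exact: (i_S I).
  - move=> v vS; have := i_Sr I vS; rewrite /r' /upd.
    have [e|_] := eqVneq x v.
      by rewrite -e yx Sx ?addr0 // e.
    by have [e|_] := eqVneq y v; [rewrite -e Sy ?e ?mul0rn ?addr0 // | rewrite !addr0].
  - move=> A AW AnW AS; rewrite !sm_upd -!addrA.
    (* The two units of slack of a larger set pay for the lost edge and the changed residue;
       singletons are settled by [cx] and [cy]. *)
    have [A1|A1] := ltnP 1 #|A|.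
      have := sl A AW AnW AS A1; rewrite cut_cons.
      have := dist2k_lip hk (sm r A) (drx *+ (x \in A) + dry *+ (y \in A)).
      move: (N (sm r A + _)) (N (sm r A)) (sm z A) (cut F A) => n1 n0 zA cA.
      move: l1 l2 l3; clear.
      by case: (x \in A); case: (y \in A); rewrite ?mulr1n ?mulr0n /=; lia.
    have [v vA] : exists v, A = [set v].
      by apply/cards1P; rewrite eqn_leq A1 card_gt0; apply: contra AS => /eqP->; rewrite sub0set.
    have := i_cut I AW AnW AS; rewrite vA !sm1 !inE cut_cons !inE.
    move: AS; rewrite vA sub1set => vS.
    have [e|_] := eqVneq x v.
      by rewrite -e yx in vS *; move: (cx vS); rewrite !mulr1n !mulr0n !addr0 => h _; move: h; rewrite !addrA.
    have [e|_] := eqVneq y v; rewrite !mulr0n !add0r.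
      by rewrite -e in vS *; move: (cy vS); rewrite ?mulr1n => h _; move: h; rewrite !addrA.
    by rewrite /= ?add0n ?addr0 ?addrA; apply.
  - by rewrite !sm_upd xW yW !mulr1n.
  - by apply: dvd_eq (i_sum I) _; rewrite !sm_upd xW yW !mulr1n; ring.
have [s [os hs]] : extendable W F b' r'.
  by apply: IH I' _; rewrite /smaller eqxx /= ltnS leqnn orbT.
exists (fun v => s v + (x == v)%:Z - (y == v)%:Z); split; first exact: ori_cons.
move=> v vW; have [] := hs v vW; rewrite /b' /r' /upd.
have [<-|_] := eqVneq x v.
  rewrite yx !mulr1n !mulr0n !addr0 => h1 h2; split; first by apply: dvd_eq h1 _; clear; lia.
  by have := nx _ h1 h2; congr (`|_| < _); clear; lia.
have [<-|_] := eqVneq y v; rewrite !mulr0n !addr0 ?mulr1n => h1 h2.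
  split; first by apply: dvd_eq h1 _; clear; lia.
  by have := ny _ h1 h2; congr (`|_| < _); clear; lia.
by split; [apply: dvd_eq h1 _ | apply: le_lt_trans h2]; clear; lia.
Qed.

(** Dropping an outward boundary half-edge at [x] preserves the cut condition at
    [x] when it moves [r x] towards [0]. *)
Lemma drop_half W x F z b r :
  inst W set0 F z b r -> slack W set0 F z r -> extendable_below W F z -> x \in W ->
  N (r x) != 0 -> N (r x - 1) = N (r x) - 1 -> - z x < b x -> (1 < #|W|)%N ->
  extendable W F b r.
Proof.
move=> I sl IH xW r0 fav bz W1.
pose z' := upd z x (- 1); pose b' := upd b x (- 1); pose r' := upd r x (- 1).
have I' : inst W set0 F z' b' r'.
  split=> //; first exact: i_F I.
  - move=> v vW; have := i_b I vW; have := i_bp I vW; rewrite /b' /z' /upd.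
    by have [<-|_] := eqVneq x v; rewrite ?mulr1n ?mulr0n; move: bz; clear; lia.
  - move=> v vW; have := i_bp I vW; rewrite /b' /z' /upd.
    by have [<-|_] := eqVneq x v; rewrite ?mulr1n ?mulr0n; clear; lia.
  - move=> v vW; have := i_rp I vW; rewrite /r' /z' /upd.
    by have [<-|_] := eqVneq x v; rewrite ?mulr1n ?mulr0n; clear; lia.
  - exact: (i_S I).
  - by move=> v; rewrite inE.
  - move=> A AW AnW AS; rewrite !sm_upd.
    have [A1|A1] := ltnP 1 #|A|.
      have := sl A AW AnW AS A1; have := dist2k_lip hk (sm r A) (- 1 *+ (x \in A)).
      move: (N (sm r A + _)) (N (sm r A)) (sm z A) (cut F A) => n1 n0 zA cA; clear.
      by case: (x \in A); rewrite ?mulr1n ?mulr0n; lia.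
    have [v vA] : exists v, A = [set v].
      by apply/cards1P; rewrite eqn_leq A1 card_gt0; apply: contra AS => /eqP->; rewrite sub0set.
    have := i_cut I AW AnW AS; rewrite vA !sm1 !inE.
    have [<-|_] := eqVneq x v; first by rewrite !mulr1n fav; clear; lia.
    by rewrite !mulr0n !addr0.
  - rewrite !sm_upd xW !mulr1n; have := i_top I; have := dist2k_lip' hk (sm r W) (- 1).
    by clear; lia.
  - by apply: dvd_eq (i_sum I) _; rewrite !sm_upd xW !mulr1n; ring.
have [s [os hs]] : extendable W F b' r'.
  by apply: IH I' _; rewrite /smaller !eqxx sm_upd xW mulr1n /=; clear; lia.
exists s; split=> // v vW; have [] := hs v vW; rewrite /b' /r' /upd.
have [<-|_] := eqVneq x v; last by rewrite !addr0.
rewrite !mulr1n => h1 h2; split; first by apply: dvd_eq h1 _; ring.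
(* The bound could fail only at the value [2k], which would make [r x] a multiple of [2k]. *)
have hn : ~~ (c %| r x)%Z by rewrite dist2k_dvd.
have [e|e] := eqVneq (s x + (b x - 1)) (c - 1); last by move: h2 e; clear; lia.
case/negP: hn; move: h1; rewrite e => h1.
by apply: dvd_eq (rpredB (dvdzz c) h1) _; ring.
Qed.

End FixingEdges.

(** * Removing Steiner vertices *)

Section Steiner.
Variables (V : finType) (k : nat).
Hypothesis hk : (2 <= k)%N.
Local Notation c := ((2 * k)%:Z).
Local Notation N := (dist2k k).
Local Notation inst := (@inst V k).
Local Notation extendable := (@extendable V k).
Local Notation slack := (@slack V k).
Local Notation extendable_below := (@extendable_below V k).
Implicit Types (F : seq (V * V)) (A B W S : {set V}) (z b r s : V -> int).

Lemma inst_z0 W S F z b r x : inst W S F z b r -> x \in W -> 0 <= z x.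
Proof. by move=> I /(i_b I); lia. Qed.

Lemma inst_cut1 W S F z b r x y : inst W S F z b r -> x \in W -> y \in W -> x != y ->
  x \notin S -> c - 2 + N (r x) <= (cut F [set x])%:Z + z x.
Proof.
move=> I xW yW xy xS; have := @i_cut _ _ _ _ _ _ _ _ I [set x].
rewrite !sm1; apply; rewrite ?sub1set //.
by apply/eqP=> e; move: yW; rewrite -e inE eq_sym (negbTE xy).
Qed.

(** An inward half-edge at [x] followed by an edge directed [x -> y] merges into an inward half-edge
    at [y]: it moves off the Steiner vertex while [sm z W] stays the same. *)
Lemma steiner_pos1 W S F z b r x :
  inst W S F z b r -> slack W S F z r -> extendable_below W F z -> x \in S -> 0 < z x ->
  b x < z x -> extendable W F b r.
Proof.
move=> I sl IH xS zx bz.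
have SW := i_S I; have xW := subsetP (proper_sub SW) _ xS.
have [w wW wS] : exists2 w, w \in W & w \notin S by case/properP: SW.
have wx : w != x by apply/eqP=> e; rewrite e xS in wS.
have cr := i_Sr I xS.
(* The cut condition for [W :\ x] is compared with [i_top]. Since [r x] vanishes modulo [2k], the
   same distance occurs in both, so [x] has at least as many edges as half-edges. *)
have cx : z x <= (cut F [set x])%:Z.
  have := @i_cut _ _ _ _ _ _ _ _ I (W :\ x); rewrite subD1set.
  have hn : W :\ x != W by apply/eqP=> e; move: xW; rewrite -e !inE eqxx.
  have hS : ~~ (W :\ x \subset S) by apply/subsetPn; exists w; rewrite ?inE ?wx.
  move=> /(_ isT hn hS); rewrite (cutC _ (inside_in (i_F I))).
  have := i_top I; rewrite (smD1 z xW).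
  have -> : N (sm r W) = N (sm r (W :\ x)).
    by apply: dist2k_congr => //; apply: dvd_eq cr _; rewrite (smD1 r xW); ring.
  by clear; lia.
have [y [F' [ynx sF]]] : exists y F', y \notin [set x] /\ same_edges F ((x, y) :: F').
  have [|a [y [F' [/set1P-> ynx sF]]]] := @pick_edge _ F [set x].
    by move: cx zx; clear; lia.
  by exists y, F'.
apply: (extendable_same sF); move: (inst_same sF I) (slack_same sF sl) (extendable_below_same sF IH) => {}I {}sl {}IH.
rewrite inE in ynx; have /andP[/and3P[/= _ yW _] _] := i_F I.
have ib := i_b I xW; have ip := i_bp I xW; have iby := i_b I yW.
apply: (@fix_edge V k hk W S x y F' z b r (-1) 0 1 0) => //; try by move: ib iby ip bz; clear; lia.
- by rewrite xS.
- move=> yS; have := inst_cut1 I yW xW ynx yS; rewrite cut_cons !inE eqxx.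
  by rewrite [x == y]eq_sym (negbTE ynx) addr0 /=; clear; lia.
- by rewrite !addr0 addrNK; exact: (i_top I).
Qed.

Lemma steiner_pos W S F z b r x :
  inst W S F z b r -> slack W S F z r -> extendable_below W F z -> x \in S -> 0 < z x -> extendable W F b r.
Proof.
move=> I sl IH xS zx; have [h|h] := ltP (b x) (z x); first exact: (steiner_pos1 I sl IH xS).
apply: (extendable_opp hk); refine (steiner_pos1 (inst_opp hk I) (slack_opp hk sl) IH xS zx _).
by move: h zx; clear; lia.
Qed.

(** Lifting costs a set at most two edges, which slack covers. A singleton other than [x] loses
    nothing because [y != w], and [[set x]] is exempt. *)
Lemma steiner_lift W S F z b r x y w :
  inst W S ((x, y) :: (x, w) :: F) z b r -> slack W S ((x, y) :: (x, w) :: F) z r ->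
  extendable_below W ((x, y) :: (x, w) :: F) z -> x \in S -> y != w ->
  extendable W ((x, y) :: (x, w) :: F) b r.
Proof.
move=> I sl IH xS yw.
have /and3P[/and3P[/= xW yW xy] /and3P[/= _ wW xw] FW] := i_F I.
suff [s [os hs]] : extendable W ((y, w) :: F) b r.
  exists s; split=> //; apply: ori_reor (ori_lift x os).
  by rewrite /= !eqxx orbT reor_refl.
apply: (IH W S _ z b r); last by rewrite /smaller eqxx /= ltnS leqnn orbT.
have cE A : exists j : bool, (cut ((x, y) :: (x, w) :: F) A = cut ((y, w) :: F) A + 2 * j)%N /\
    (j -> ((x \in A) != (y \in A)) /\ (y \in A) = (w \in A)).
  exists (((x \in A) != (y \in A)) && ((x \in A) != (w \in A))); rewrite !cut_cons.
  by case: (x \in A); case: (y \in A); case: (w \in A); split=> //; clear; lia.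
split; try by case: I.
- by rewrite /inside /= yW wW yw.
- move=> v vW; have := i_rp I vW; have [j [-> _]] := cE [set v]; rewrite PoszD; case: j; clear; lia.
- move=> A AW AnW AS; have [j [ej hj]] := cE A.
  have [A1|A1] := ltnP 1 #|A|.
    by have := sl A AW AnW AS A1; rewrite ej; clear; lia.
  have [v vA] : exists v, A = [set v].
    by apply/cards1P; rewrite eqn_leq A1 card_gt0; apply: contra AS => /eqP->; rewrite sub0set.
  have := i_cut I AW AnW AS; rewrite ej; case: j ej hj => [ej|_ _]; last by clear; lia.
  have xv : x != v by apply/eqP=> e; move: AS; rewrite vA sub1set -e xS.
  move=> /(_ isT)[]; rewrite vA !inE (negbTE xv); have [<-|//] := eqVneq y v.
  by rewrite [w == y]eq_sym (negbTE yw).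
Qed.

(** Parity makes the number of [xy] edges even, so they can be balanced and contribute nothing at
    either end. After deletion, a set containing [y] inherits the cut condition of the same set with
    [x] added. *)
Lemma steiner_drop W S F z b r x y :
  inst W S F z b r -> extendable_below W F z -> x \in S -> z x = 0 -> y \in W -> y != x ->
  all (fun e => ((e.1 == x) ==> (e.2 == y)) && ((e.2 == x) ==> (e.1 == y))) F ->
  extendable W F b r.
Proof.
move=> I IH xS zx yW yx hF.
have SW := i_S I; have xW := subsetP (proper_sub SW) _ xS.
have cr := i_Sr I xS.
have bx : b x = 0 by have := i_b I xW; rewrite zx; lia.
have yx' : (x == y) = false by rewrite eq_sym (negbTE yx).
pose P := fun e : V * V => (e.1 != x) && (e.2 != x).
pose F1 := filter P F; pose F2 := filter (predC P) F.
have pF : perm_eq (F1 ++ F2) F by apply/permPl/perm_filterC.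
have cF A : cut F A = (cut F1 A + cut F2 A)%N.
  by rewrite /cut -count_cat; apply/esym/permP.
have F2P e : e \in F2 -> (e == (x, y)) || (e == (y, x)).
  rewrite mem_filter => /andP[h1 h2]; have := allP hF _ h2.
  case: e h1 {h2} => a d; rewrite /P /= negb_and !negbK !xpair_eqE.
  case/orP=> /eqP->; rewrite !eqxx /=; first by case/andP=> /eqP-> _; rewrite !eqxx.
  by case/andP=> _ /eqP->; rewrite !eqxx orbT.
have c1 A : x \in A -> y \notin A -> cut F2 A = size F2.
  move=> xA yA; rewrite /cut -count_predT; apply: eq_in_count => e /F2P.
  by case/orP=> /eqP->; rewrite /= xA (negbTE yA).
have c1' A : x \notin A -> y \in A -> cut F2 A = size F2.
  move=> xA yA; rewrite /cut -count_predT; apply: eq_in_count => e /F2P.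
  by case/orP=> /eqP->; rewrite /= yA (negbTE xA).
have c2 A : (x \in A) = (y \in A) -> cut F2 A = 0%N.
  move=> xA; rewrite /cut -[RHS](count_pred0 F2); apply: eq_in_count => e /F2P.
  by case/orP=> /eqP->; rewrite /= xA eqxx.
have c3 A : x \notin A -> cut F1 (x |: A) = cut F1 A.
  move=> xA; apply: eq_in_count => e; rewrite mem_filter => /andP[/andP[e1 e2] _].
  by rewrite !inE (negbTE e1) (negbTE e2).
have c4 : cut F1 [set x] = 0%N.
  rewrite /cut -[RHS](count_pred0 F1); apply: eq_in_count => e.
  by rewrite mem_filter !inE => /andP[/andP[/negbTE-> /negbTE->]].
have [j ej] : exists j, size F2 = (2 * j)%N.
  have := i_rp I xW; rewrite zx cF c4 add0n c1 ?inE // => h.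
  have : (2 %| r x)%Z by case/dvdzP: cr => q ->; clear; lia.
  by move=> h'; exists (size F2)./2; move: h h'; clear; lia.
have [w wW wS] : exists2 w, w \in W & w \notin S by case/properP: SW.
have wx : w != x by apply/eqP=> e; rewrite e xS in wS.
have NW : N (sm r W) = N (sm r (W :\ x)).
  by apply: dist2k_congr => //; apply: dvd_eq cr _; rewrite (smD1 r xW); ring.
have I' : inst (W :\ x) (S :\ x) F1 z b r.
  have sub v : v \in W :\ x -> v \in W by rewrite !inE => /andP[].
  split.
  - apply/allP=> e; rewrite mem_filter => /andP[/andP[e1 e2]] /(allP (i_F I)).
    by rewrite !inE e1 e2.
  - by move=> v /sub; apply: (i_b I).
  - by move=> v /sub; apply: (i_bp I).
  - move=> v vW; have := i_rp I (sub v vW); rewrite cF.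
    have vx : v != x by move: vW; rewrite !inE => /andP[].
    have xv : (x == v) = false by rewrite eq_sym (negbTE vx).
    have [e|yv] := eqVneq y v.
      by rewrite c1' ?inE ?xv ?e ?eqxx // ej; clear; lia.
    by rewrite c2 ?inE ?xv ?(negbTE yv) ?addn0.
  - apply/properP; split; first exact: setSD (proper_sub SW).
    by exists w; rewrite !inE wx ?(negbTE wS).
  - by move=> v; rewrite !inE => /andP[_ /(i_Sr I)].
  - move=> A AW AnW AS.
    have xA : x \notin A by apply/negP=> /(subsetP AW); rewrite !inE eqxx.
    have AW' : A \subset W by apply: subset_trans AW (subsetDl _ _).
    have AS' : ~~ (A \subset S).
      by apply: contra AS => /subsetP h; apply/subsetP=> v vA; rewrite !inE h // andbT; apply/eqP=> e; rewrite -e vA in xA.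
    have [yA|yA] := boolP (y \in A); last first.
      have := @i_cut _ _ _ _ _ _ _ _ I A AW'; rewrite cF c2 ?(negbTE xA) ?(negbTE yA) // addn0; apply=> //.
      by apply/eqP=> e; rewrite e xW in xA.
    have := @i_cut _ _ _ _ _ _ _ _ I (x |: A); rewrite cF c2 ?inE ?eqxx ?yA ?orbT // addn0 c3 //.
    have sx g : sm g (x |: A) = g x + sm g A.
      by rewrite (smD1 _ (setU11 x A)) setU1K.
    rewrite !sx zx add0r.
    have -> : N (r x + sm r A) = N (sm r A).
      by apply: dist2k_congr => //; apply: dvd_eq cr _; ring.
    apply.
    + by rewrite subUset sub1set xW.
    + by apply: contra AnW => /eqP <-; rewrite setU1K.
    + by apply: contra AS' => h; apply: subset_trans h; apply: subsetUr.
  - by have := i_top I; rewrite NW (smD1 z xW) zx add0r.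
  - apply: dvd_eq (rpredB (i_sum I) cr) _; rewrite (smD1 r xW) (smD1 b xW) bx; ring.
have [s [os hs]] : extendable (W :\ x) F1 b r.
  by apply: IH I' _; rewrite /smaller (cardsD1 x W) xW ltnS leqnn.
have [s2 os2 es2] : exists2 s2, ori F2 s2 & s2 x = 0.
  have rO : reor F2 [seq (x, y) | _ <- F2].
    elim: (F2) F2P => //= e l IHl h; rewrite IHl ?andbT; last by move=> e' h'; apply: h; rewrite inE h' orbT.
    by case/orP: (h e (mem_head _ _)) => /eqP->; rewrite eqxx ?orbT.
  have [||| s2 os2 es2] := @ori_star _ x [seq (x, y) | _ <- F2] 0.
  - by apply/allP=> e /mapP[? _ ->] /=; rewrite eqxx yx.
  - by [].
  - by rewrite size_map ej; exists (- j%:Z); clear; lia.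
  - by exists s2 => //; apply: ori_reor rO os2.
have s20 v : s2 v = 0.
  have [-> //|vx] := eqVneq v x.
  have [->|vy] := eqVneq v y.
    have : \sum_(i in [set x; y]) s2 i = 0.
      apply: ori_sum os2 _; apply/allP=> e /F2P.
      by case/orP=> /eqP->; rewrite /= !inE !eqxx ?orbT.
    by rewrite big_setU1 ?inE ?yx' //= big_set1 es2 add0r.
  apply: (ori_zero os2); rewrite c2 ?inE //.
  by rewrite ![_ == v]eq_sym (negbTE vx) (negbTE vy).
exists s; split.
  apply: ori_perm pF _; apply: ori_ext (ori_cat os os2) => v /=.
  by rewrite s20 addr0.
move=> v vW; have [->|vx] := eqVneq v x; last by apply: hs; rewrite !inE vx.
rewrite (ori_zero os c4).
by rewrite bx !add0r rpredN; split=> //; move: hk; clear; lia.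
Qed.

End Steiner.

(** * Moves that shrink an instance with slack *)

Section Moves.
Variables (V : finType) (k : nat).
Hypothesis hk : (2 <= k)%N.
Local Notation c := ((2 * k)%:Z).
Local Notation N := (dist2k k).
Local Notation inst := (@inst V k).
Local Notation extendable := (@extendable V k).
Local Notation slack := (@slack V k).
Local Notation extendable_below := (@extendable_below V k).
Implicit Types (F : seq (V * V)) (A B W S : {set V}) (z b r s : V -> int).

(** Half-edges are pushed away while there are any; then edges to distinct neighbours are lifted,
    and a vertex with at most one neighbour is deleted. *)
Lemma step_steiner W S F z b r x :
  inst W S F z b r -> slack W S F z r -> extendable_below W F z -> x \in S -> extendable W F b r.
Proof.
move=> I sl IH xS; have SW := i_S I; have xW := subsetP (proper_sub SW) _ xS.
have [zx|zx] := ltP 0 (z x); first exact: (steiner_pos hk I sl IH xS zx).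
have {}zx : z x = 0 by have := inst_z0 hk I xW; lia.
(* All edges of an isolated vertex lead, vacuously, to any chosen [w]. *)
have [c0|] := posnP (cut F [set x]).
  have [w wW wS] : exists2 w, w \in W & w \notin S by case/properP: SW.
  have wx : w != x by apply/eqP=> e; rewrite e xS in wS.
  apply: (steiner_drop hk I IH xS zx wW wx); apply/allP=> e he.
  have /and3P[_ _ ne] := allP (i_F I) e he.
  have : ~~ has (fun e => (e.1 \in [set x]) != (e.2 \in [set x])) F.
    by rewrite has_count -/(cut F [set x]) c0.
  move/hasPn/(_ e he); rewrite !inE negbK; case: (e.1 =P x) => [h1|_] h2.
    by move: ne; rewrite h1 eq_sym -(eqP h2).
  by rewrite -(eqP h2).
case/pick_edge=> a [y [F' [/set1P-> ynx sF]]]; rewrite inE in ynx.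
have xny : (x == y) = false by rewrite eq_sym (negbTE ynx).
apply: (extendable_same sF); move: (inst_same sF I) (slack_same sF sl) (extendable_below_same sF IH) => {}I {}sl {}IH.
have /andP[/and3P[/= _ yW _] _] := i_F I.
case: (boolP (has (fun e => ((e.1 == x) && (e.2 != y)) || ((e.2 == x) && (e.1 != y))) F')).
  case/hasP=> e he h.
  have [w [wy [F2 _ sF2]]] : exists w, w != y /\ exists2 F2, true & same_edges F' ((x, w) :: F2).
    have hp := perm_to_rem he; case: e h hp {he} => p q /= h hp.
    case/orP: h hp => /andP[/eqP-> h] hp.
      by exists q; split=> //; exists (rem (x, q) F') => //; eexists; [exact: hp | exact: reor_refl].
    exists p; split=> //; exists (rem (p, x) F') => //; eexists; first exact: hp.
    by rewrite /= eqxx orbT reor_refl.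
  have {}sF2 : same_edges ((x, y) :: F') ((x, y) :: (x, w) :: F2) by apply: same_edges_cons.
  apply: (extendable_same sF2).
  apply: (steiner_lift (inst_same sF2 I) (slack_same sF2 sl) (extendable_below_same sF2 IH) xS).
  by rewrite eq_sym.
rewrite -all_predC => hn; apply: (steiner_drop hk I IH xS zx yW ynx).
rewrite /= !eqxx xny /= (negbTE ynx) /=; apply: sub_all hn => e /=.
by case: (e.1 == x); case: (e.2 == x); case: (e.1 == y); case: (e.2 == y).
Qed.

Section NoSteiner.
Variables (W : {set V}) (F : seq (V * V)) (z b r : V -> int).
Hypotheses (I : inst W set0 F z b r) (sl : slack W set0 F z r) (IH : extendable_below W F z).
Hypotheses (W1 : (1 < #|W|)%N) (nz : forall x, x \in W -> N (r x) != 0).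

(** Adding the cut conditions of [A] and of its complement and subtracting [i_top] leaves [2k - 2]
    below twice the cut, by the triangle inequality. *)
Lemma cut_pos A : A \subset W -> A != W -> A != set0 -> (0 < cut F A)%N.
Proof.
move=> AW AnW A0; have := @i_cut _ _ _ _ _ _ _ _ I A AW AnW; rewrite subset0 => /(_ A0).
have := @i_cut _ _ _ _ _ _ _ _ I (W :\: A) (subsetDl _ _).
have h1 : W :\: A != W.
  apply: contra A0 => /eqP e; rewrite -(setIidPl AW) -{1}e; apply/eqP/setP=> v.
  by rewrite !inE; case: (v \in A).
have h2 : W :\: A != set0.
  by rewrite setD_eq0; apply: contra AnW => h; rewrite eqEsubset AW.
move=> /(_ h1); rewrite subset0 => /(_ h2).
rewrite (cutC _ (inside_in (i_F I))).
have := i_top I; rewrite (smC z AW) (smC r AW).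
have := dist2k_triangle hk (sm r A) (sm r (W :\: A)).
by move: (dist2k_ge0 hk (sm r A)) hk; clear; lia.
Qed.

Lemma neighbour x : x \in W -> exists y F', [/\ y \in W, x != y & same_edges F ((x, y) :: F')].
Proof.
move=> xW; have : (0 < cut F [set x])%N.
  apply: cut_pos; rewrite ?sub1set //; last by apply/set0Pn; exists x; rewrite inE.
  by apply/eqP=> e; move: W1; rewrite -e cards1.
case/pick_edge=> a [y [F' [/set1P-> ynx sF]]]; exists y, F'; split=> //.
  by have /andP[/and3P[/= _ yW _] _] := i_F (inst_same sF I).
by move: ynx; rewrite inE eq_sym.
Qed.

Lemma cut1 x : x \in W -> c - 2 + N (r x) <= (cut F [set x])%:Z + z x.
Proof.
move=> xW; have [y [F' [yW xy _]]] := neighbour xW.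
by apply: inst_cut1 I xW yW xy _; rewrite inE.
Qed.

Lemma cut_edge x y F' : same_edges F ((x, y) :: F') -> x != y ->
  cut F [set x] = (cut F' [set x]).+1 /\ cut F [set y] = (cut F' [set y]).+1.
Proof.
move=> sF xy; rewrite -!(cut_same _ sF) !cut_cons !inE !eqxx.
by rewrite [y == x]eq_sym (negbTE xy).
Qed.

(** The only dangerous value is [2k - 1], and it would force [r x] to vanish modulo [2k];
    [near_plus] is the mirror image. *)
Lemma near_minus x n : x \in W -> (c %| n - (r x - 1))%Z -> `|n| < c -> `|n + 1| < c.
Proof.
move=> xW h1 h2; have [e|e] := eqVneq n (c - 1); last by move: h2 e; clear; lia.
case/negP: (nz xW); rewrite -dist2k_dvd //.
by apply: dvd_eq (rpredB (dvdzz c) h1) _; rewrite e; ring.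
Qed.

Lemma near_plus x n : x \in W -> (c %| n - (r x + 1))%Z -> `|n| < c -> `|n - 1| < c.
Proof.
move=> xW h1 h2; have [e|e] := eqVneq n (1 - c); last by move: h2 e; clear; lia.
case/negP: (nz xW); rewrite -dist2k_dvd //.
by apply: dvd_eqN (rpredD (dvdzz c) h1) _; rewrite e; ring.
Qed.

(** The boundary has room for two more half-edges, so an edge is cut into an outward half at [x] and
    an inward half at [y]; residues are untouched. *)
Lemma step_slack : sm z W <= c - 4 + N (sm r W) -> extendable W F b r.
Proof.
move=> top; have [x xW] : exists x, x \in W by apply/set0Pn; rewrite -card_gt0; lia.
have [y [F' [yW xy sF]]] := neighbour xW.
have [ex ey] := cut_edge sF xy.
have cx := cut1 xW; have cy := cut1 yW; rewrite ex in cx; rewrite ey in cy.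
have bx := i_b I xW; have by_ := i_b I yW.
apply: (extendable_same sF).
apply: (@fix_edge V k hk W set0 x y F' z b r 1 0 1 0
  (inst_same sF I) (slack_same sF sl) (extendable_below_same sF IH)) => //;
  rewrite ?addr0 ?subr0 //; try by move: cx cy bx by_ top; clear; lia.
Qed.

(** An edge leaving [x] is dropped at [x] and recorded at [y]. The rise in the distance of [sm r W]
    pays for the new half-edge in [i_top]. *)
Lemma step_out x : sm z W = c - 2 + N (sm r W) -> N (sm r W - 1) = N (sm r W) + 1 ->
  x \in W -> N (r x - 1) = N (r x) - 1 \/ c + N (r x) <= (cut F [set x])%:Z + z x ->
  extendable W F b r.
Proof.
move=> top up xW hx.
have [y [F' [yW xy sF]]] := neighbour xW.
have [ex ey] := cut_edge sF xy.
have cx := cut1 xW; have cy := cut1 yW; rewrite ex in cx hx; rewrite ey in cy.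
have bx := i_b I xW; have by_ := i_b I yW.
apply: (extendable_same sF).
apply: (@fix_edge V k hk W set0 x y F' z b r 0 (-1) 1 0
  (inst_same sF I) (slack_same sF sl) (extendable_below_same sF IH)) => //;
  rewrite ?addr0 ?subr0 ?addrK ?addrNK ?inE //.
- by move: by_; clear; lia.
- move=> _; have := dist2k_lip hk (r x) (- 1); case: hx => [-> _|h h'].
    by move: cx; clear; lia.
  by move: h h'; clear; lia.
- by move=> _; move: cy; clear; lia.
- by rewrite up top; clear; lia.
- by move=> n h1 h2; rewrite opprK; apply: near_minus h1 h2.
- by move=> n _; rewrite subr0.
Qed.

(** The edge is dropped at both ends: each loses one edge and one unit of distance, while the
    boundary and the total residue stay the same. *)
Lemma step_transfer x y F' : same_edges F ((x, y) :: F') ->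
  N (r x - 1) = N (r x) - 1 -> N (r y + 1) = N (r y) - 1 -> extendable W F b r.
Proof.
move=> sF hx hy.
have /andP[/and3P[/= xW yW xy] _] := i_F (inst_same sF I).
have [ex ey] := cut_edge sF xy.
have cx := cut1 xW; have cy := cut1 yW; rewrite ex in cx; rewrite ey in cy.
have bx := i_b I xW; have by_ := i_b I yW.
apply: (extendable_same sF).
apply: (@fix_edge V k hk W set0 x y F' z b r 0 (-1) 0 1
  (inst_same sF I) (slack_same sF sl) (extendable_below_same sF IH)) => //;
  rewrite ?addr0 ?subr0 ?addrK ?addrNK ?inE //.
- by rewrite hx => _; move: cx; clear; lia.
- by rewrite hy => _; move: cy; clear; lia.
- exact: (i_top I).
- by move=> n h1 h2; rewrite opprK; apply: near_minus h1 h2.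
- by move=> n h1 h2; apply: near_plus h1 h2.
Qed.

Lemma step_drop_plus x : x \in W -> N (r x + 1) = N (r x) - 1 -> b x < z x -> extendable W F b r.
Proof.
move=> xW h bz; apply: (extendable_opp hk).
refine (drop_half hk (inst_opp hk I) (slack_opp hk sl) IH xW _ _ _ W1).
- by rewrite dist2kN // nz.
- by rewrite dist2kN // -opprD dist2kN.
- by rewrite ltrN2.
Qed.

End NoSteiner.
End Moves.

Lemma all_or_ex (T : finType) (A : {set T}) (P : pred T) :
  (forall x, x \in A -> P x) \/ exists2 x, x \in A & ~~ P x.
Proof.
have [h|] := boolP [forall (x | x \in A), P x]; [left=> x xA | rewrite negb_forall_in].
  exact: (forall_inP h).
by case/exists_inP=> x; right; exists x.
Qed.

Lemma dvdz_lt2 (d a : int) : (d %| a)%Z -> `|a| < 2 * d -> [\/ a = 0, a = d | a = - d].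
Proof.
case/dvdzP=> q -> h.
have [e|[e|[e|[e|e]]]] : q = 0 \/ q = 1 \/ q = -1 \/ 2 <= q \/ q <= -2 by lia.
- by constructor 1; rewrite e mul0r.
- by constructor 2; rewrite e mul1r.
- by constructor 3; rewrite e mulN1r.
- nia.
- nia.
Qed.

(** * The extension theorem *)

Section ExtensionTheorem.
Variables (V : finType) (k : nat).
Hypothesis hk : (2 <= k)%N.
Local Notation c := ((2 * k)%:Z).
Local Notation N := (dist2k k).
Local Notation inst := (@inst V k).
Local Notation extendable := (@extendable V k).
Local Notation slack := (@slack V k).
Local Notation extendable_below := (@extendable_below V k).
Implicit Types (F : seq (V * V)) (A B W S : {set V}) (z b r s : V -> int).

(** If no simpler move applies, every boundary half-edge is outward and [sm r W] is
    [-1] modulo [2k]; the last move records enough half-edges at a single vertex to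
    carry its residue past [k]. *)
Lemma step_up W F z b r : inst W set0 F z b r -> slack W set0 F z r -> extendable_below W F z ->
  (1 < #|W|)%N -> (forall x, x \in W -> N (r x) != 0) ->
  sm z W = c - 2 + N (sm r W) -> N (sm r W - 1) = N (sm r W) + 1 -> extendable W F b r.
Proof.
move=> I sl IH W1 nz top up.
(* When [step_out] applies nowhere, lowering [r x] never brings it nearer to 0, and every singleton
   is tight. *)
have [h1|[x xW]] := all_or_ex W (fun x => (N (r x - 1) != N (r x) - 1)
    && ((cut F [set x])%:Z + z x < c + N (r x))); last first.
  rewrite negb_and negbK -leNgt => /orP h.
  apply: (step_out hk I sl IH W1 nz top up xW).
  by case: h => [/eqP|] h; [left | right].
have fp x : x \in W -> N (r x + 1) = N (r x) - 1.
  by move=> xW; case: (dist2k_step hk (nz x xW)) => // e; have /andP[] := h1 x xW; rewrite e eqxx.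
have [h2|[x xW]] := all_or_ex W (fun x => z x <= b x); last first.
  by rewrite -ltNge; apply: (step_drop_plus hk I sl IH W1 nz xW (fp x xW)).
have bz x : x \in W -> b x = z x by move=> xW; have := h2 x xW; have := i_b I xW; lia.
have bW : sm b W = sm z W by apply: eq_sm.
have [x xW] : exists x, x \in W by apply/set0Pn; rewrite -card_gt0; lia.
have [u0|u0] := eqVneq (N (sm r W)) 0.
  apply: (extendable_opp hk).
  have nz' v : v \in W -> N (- r v) != 0 by rewrite dist2kN //; apply: nz.
  refine (step_out hk (inst_opp hk I) (slack_opp hk sl) IH W1 nz' _ _ xW _).
  - by rewrite sm_opp dist2kN.
  - rewrite sm_opp -opprD !dist2kN //; rewrite u0 (dist2k_congr hk (b := 1)).
      by rewrite (@dist2kE k hk 0 1) //; move: hk; clear; lia.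
    by rewrite addrK dist2k_dvd // u0.
  - by left; rewrite -opprD !dist2kN // fp.
(* All half-edges point outwards, so [i_sum] and [top] make [sm r W] congruent to its own distance
   minus 2; comparing distances leaves only 1. *)
have u1 : N (sm r W) = 1 /\ (c %| sm r W + 1)%Z.
  have := i_sum I; rewrite bW top => h.
  have e : N (sm r W) = `|N (sm r W) - 2|.
    rewrite {1}(dist2k_congr hk (b := N (sm r W) - 2)).
      by apply: (@dist2kE k hk 0); have := dist2k_le hk (sm r W); have := dist2k_ge0 hk (sm r W); move: hk; clear; lia.
    by apply: dvd_eq (rpredD h (dvdzz c)) _; ring.
  have e1 : N (sm r W) = 1 by move: e u0; clear; lia.
  by split=> //; move: h; rewrite e1 => h; apply: dvd_eq (rpredD h (dvdzz c)) _; ring.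
case: u1 => u1 rW.
have [y [F' [yW xy sF]]] := neighbour hk I W1 xW.
have [ex ey] := cut_edge sF xy.
have cx := cut1 hk I W1 xW; have cy := cut1 hk I W1 yW.
have /andP[nfx tx] := h1 x xW.
rewrite ex in cx tx; rewrite ey in cy.
(* The edge is dropped at both ends and [j] new inward half-edges appear at [x]. This lowers [r x]
   from residue [- N (r x)] by [j + 1] to residue [k - 1], and [sm r W] from residue -1 to
   [- (j + 1)], so [i_top] stays an equality. *)
pose j := k%:Z - N (r x).
have [j0 jk] : 0 <= j /\ j <= k%:Z - 1.
  by have := nz x xW; have := dist2k_le hk (r x); have := dist2k_ge0 hk (r x); rewrite /j; clear; lia.
have rx : (c %| k%:Z - 1 - (r x - (j + 1)))%Z.
  have [p [m [e m1 m2 em]]] := dist2kP hk (r x); move: nfx; rewrite em => nfx.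
  have m0 : m < 0.
    rewrite ltNge; apply/negP=> m0; case/negP: nfx; apply/eqP.
    rewrite (@dist2kE k hk p (m - 1)); [|by rewrite e; ring|]; have := nz x xW; rewrite em; move: m0 m2; clear; lia.
  by apply/dvdzP; exists (1 - p); rewrite /j em e; move: m0 hk; clear; lia.
have parx := cut_par hk I (A := [set x]); rewrite sub1set in parx.
have {}parx := parx xW; rewrite ex !sm1 in parx.
have bx := bz x xW; have zx := inst_z0 hk I xW; have by_ := i_b I yW.
apply: (extendable_same sF).
apply: (@fix_edge V k hk W set0 x y F' z b r j (- (j + 1)) 0 1
  (inst_same sF I) (slack_same sF sl) (extendable_below_same sF IH)) => //;
  rewrite ?inE //; try by move: bx zx by_ j0; clear; lia.
- move=> _; rewrite -(dist2k_congr hk rx) (@dist2kE k hk 0 (k%:Z - 1)); try by move: hk; clear; lia.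
  by move: cx; rewrite /j; move: hk; clear; lia.
- by move=> _; rewrite fp //; move: cy; clear; lia.
- have -> : N (sm r W - (j + 1) + 1) = j + 1.
    rewrite (dist2k_congr hk (b := - (j + 1))); first by rewrite dist2kN // (@dist2kE k hk 0 (j + 1)); move: j0 jk; clear; lia.
    by apply: dvd_eq rW _; ring.
  by rewrite top u1; clear; lia.
(* The possible values are [k - 1] and [- k - 1]; adding [j + 1], which is at most [k], keeps both
   below [2k] in absolute value. *)
- move=> n h1' h2'.
  have h3 : (c %| n - (k%:Z - 1))%Z by apply: dvd_eq (rpredB h1' rx) _; ring.
  have h4 : `|n - (k%:Z - 1)| < 2 * c by move: h2' hk; clear; lia.
  by case: (dvdz_lt2 h3 h4) => e; move: e h2' j0 jk; clear; lia.
- by move=> n h1' h2'; apply: (near_plus hk nz yW h1' h2').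
Qed.

Lemma step_half W F z b r : inst W set0 F z b r -> slack W set0 F z r -> extendable_below W F z ->
  (1 < #|W|)%N -> (forall x, x \in W -> N (r x) != 0) ->
  sm z W = c - 2 + k%:Z -> N (sm r W) = k%:Z -> extendable W F b r.
Proof.
move=> I sl IH W1 nz top rk.
have [h1|[x xW]] := all_or_ex W (fun x => (N (r x - 1) == N (r x) - 1) ==> (b x <= - z x)); last first.
  rewrite negb_imply -ltNge => /andP[/eqP h1 h2].
  exact: (drop_half hk I sl IH xW (nz x xW) h1 h2 W1).
have [h2|[x xW]] := all_or_ex W (fun x => (N (r x + 1) == N (r x) - 1) ==> (z x <= b x)); last first.
  rewrite negb_imply -ltNge => /andP[/eqP h2 h3].
  exact: (step_drop_plus hk I sl IH W1 nz xW h2 h3).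
pose A := [set x in W | N (r x - 1) == N (r x) - 1].
have AW : A \subset W by apply/subsetP=> x; rewrite inE => /andP[].
have pl x : x \in W -> x \notin A -> N (r x + 1) = N (r x) - 1.
  move=> xW; rewrite inE xW /= => h; case: (dist2k_step hk (nz x xW)) => // e.
  by rewrite e eqxx in h.
have sum := i_sum I.
have far n : (c %| sm r W - n)%Z -> `|n| = c - 2 + k%:Z -> False.
  move=> h e.
  have : N n = k%:Z by rewrite -rk; apply/esym/dist2k_congr.
  have -> : N n = N `|n|.
    by case: (ger0P n) => _; rewrite ?dist2kN.
  by rewrite e (@dist2kE k hk 1 (k%:Z - 2)); move: hk; clear; lia.
have [A0|A0] := eqVneq A set0.
  suff e : sm b W = sm z W by case: (far _ sum); rewrite e top; move: hk; clear; lia.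
  apply: eq_sm => x xW; have := h2 x xW; rewrite pl ?A0 ?inE // eqxx /=.
  by have := i_b I xW; clear; lia.
have [AW'|AW'] := eqVneq A W.
  suff e : sm b W = - sm z W by case: (far _ sum); rewrite e top; move: hk; clear; lia.
  rewrite -sm_opp; apply: eq_sm => x xW; have := h1 x xW.
  move: (xW); rewrite -{1}AW' inE => /andP[_ ->] /=.
  by have := i_b I xW; clear; lia.
have /pick_edge[x [y [F' [xA yA sF]]]] := cut_pos hk I AW AW' A0.
have /andP[/and3P[/= xW yW xy] _] := i_F (inst_same sF I).
apply: (step_transfer hk I sl IH W1 nz sF _ (pl y yW yA)).
by move: xA; rewrite inE => /andP[_ /eqP].
Qed.

(** No edge is left, so only the bound on [b x] is at issue: a value of [2k] or more would, by
    [i_top], have distance at most [N (r x) - 2], yet it is congruent to [r x]. *)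
Lemma inst_single W S F z b r : inst W S F z b r -> (#|W| <= 1)%N -> extendable W F b r.
Proof.
move=> I W1.
have [x xW xS] : exists2 x, x \in W & x \notin S by case/properP: (i_S I).
have eW : W = [set x].
  by apply/eqP; rewrite eq_sym eqEcard sub1set xW cards1.
have F0 : F = [::].
  case: F I => // e F /i_F/andP[]; rewrite eW !inE => /and3P[/eqP-> /eqP->].
  by rewrite eqxx.
exists (fun => 0); split; first by rewrite F0; apply: ori_nil.
move=> v; rewrite eW inE => /eqP->; rewrite add0r.
have h := i_sum I; have top := i_top I; rewrite eW !sm1 in h top.
split; first by apply: dvd_eqN h _; ring.
rewrite ltNge; apply/negP=> hc; have hb := i_b I xW.
have e : N (b x) = N (r x) by apply/esym/dist2k_congr.
have hN := dist2k_le hk (r x).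
have : N (b x) = `|b x| - c.
  have -> : N (b x) = N `|b x| by case: (ger0P (b x)) => _; rewrite ?dist2kN.
  by rewrite (@dist2kE k hk 1 (`|b x| - c)); move: hb hc top hN hk; clear; lia.
by rewrite e; move: top hb; clear; lia.
Qed.

Lemma orientation_mod_extension W S F z b r : inst W S F z b r -> extendable W F b r.
Proof.
move: {2}#|W| (erefl #|W|) => n; elim/ltn_ind: n W S F z b r => n IHn W S F z b r.
move: {2}(size F) (erefl (size F)) => p; elim/ltn_ind: p W S F z b r => p IHq W S F z b r.
move: {2}`|sm z W|%N (erefl `|sm z W|%N) => q; elim/ltn_ind: q W S F z b r => q IHr W S F z b r.
move=> eq ep en I.
have IH : extendable_below W F z.
  move=> W' S' F' z' b' r' I'; rewrite /smaller => /orP[h|/andP[/eqP e /orP[h|/andP[/eqP e' h]]]].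
  - by apply: (IHn #|W'|) (I'); rewrite -?en.
  - by apply: (IHq (size F')) (I'); rewrite -?ep // e.
  - have z0 : 0 <= sm z' W' by apply: sm_ge0 => v; apply: (inst_z0 hk I').
    by apply: (IHr `|sm z' W'|%N) (I'); rewrite ?e ?e' // -eq; move: h z0; clear; lia.
have [W1|W1] := leqP #|W| 1; first exact: inst_single I W1.
case: (slackP hk I) => [sl|[A [a1 a2 a3 a4 a5]]]; last exact: (step_contract hk I IH a1 a2 a3 a4 a5).
have [x xS|S0] := pickP (mem S); first exact: (step_steiner hk I sl IH xS).
have {S0} S0 : S = set0 by apply/setP=> v; rewrite inE; exact: S0.
subst S.
(* A vertex of residue 0 may be declared a Steiner vertex, since this only weakens the cut
   condition. *)
have [nz|[x xW]] := all_or_ex W (fun x => N (r x) != 0); last first.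
  rewrite negbK -dist2k_dvd // => cr.
  have n0 (A : {set V}) : ~~ (A \subset [set x]) -> ~~ (A \subset set0).
    by apply: contra; rewrite subset0 => /eqP->; rewrite sub0set.
  apply: (@step_steiner V k hk W [set x] F z b r x) => //; last by rewrite inE.
  - split; try by case: I.
    + by rewrite properEcard sub1set xW cards1.
    + by move=> v /set1P->.
    + by move=> A a1 a2 /n0; apply: (i_cut I).
  - by move=> A a1 a2 /n0; apply: sl.
have par : (2 %| N (sm r W) - sm z W)%Z.
  have := cut_par hk I (subxx W); suff -> : cut F W = 0%N by rewrite subr0.
  rewrite /cut -[RHS](count_pred0 F); apply: eq_in_count => e.
  by move/(allP (i_F I))=> /and3P[-> ->].
have [top|top] := leP (sm z W) (c - 4 + N (sm r W)).
  exact: (step_slack hk I sl IH W1 top).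
have {par} top : sm z W = c - 2 + N (sm r W) by have := i_top I; move: par top; clear; lia.
have [u|u] := eqVneq (N (sm r W)) k%:Z.
  by apply: (step_half I sl IH W1 nz _ u); rewrite top u.
have {}u : N (sm r W) < k%:Z by rewrite lt_neqAle u dist2k_le.
case: (dist2k_up hk u) => up; first exact: (step_up I sl IH W1 nz top up).
apply: (extendable_opp hk); refine (step_up (inst_opp hk I) (slack_opp hk sl) IH W1 _ _ _).
- by move=> v vW; rewrite dist2kN // nz.
- by rewrite sm_opp dist2kN.
- by rewrite sm_opp -opprD !dist2kN.
Qed.

End ExtensionTheorem.

Ltac lia_count := repeat match goal with |- context [@count ?X ?p ?t] => generalize (@count X p t); intro end; lia.

(** * Lifting arcs *)

Section Rooted.
Variable V : finType.
Implicit Types (F T : seq (V * V)) (A B P Q U : {set V}) (s : V -> int).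

Definition within U T := all (fun e : V * V => (e.1 \in U) && (e.2 \in U)) T.
Definition noloop T := [seq e <- T | e.1 != e.2].
Definition rooted (l : nat) U (z : V) T :=
  forall A, A \subset U :\ z -> A != set0 -> (l <= dout T A)%N.

Lemma count_ex (p : pred (V * V)) T : (0 < count p T)%N -> exists2 e : V * V, e \in T & p e.
Proof. by rewrite -has_count => /hasP. Qed.

Lemma dout_cons x y T A : dout ((x, y) :: T) A = ((x \in A) && (y \notin A) + dout T A)%N.
Proof. by []. Qed.
Lemma din_cons x y T A : din ((x, y) :: T) A = ((x \notin A) && (y \in A) + din T A)%N.
Proof. by []. Qed.

Lemma dout_noloop T A : dout (noloop T) A = dout T A.
Proof.
rewrite /dout /noloop; elim: T => //= e T IH; case: eqP => [-> /=|_ /=]; rewrite IH //.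
by rewrite andbN.
Qed.
Lemma din_noloop T A : din (noloop T) A = din T A.
Proof.
rewrite /din /noloop; elim: T => //= e T IH; case: eqP => [-> /=|_ /=]; rewrite IH //.
by rewrite andNb.
Qed.
Lemma cut_noloop T A : cut (noloop T) A = cut T A.
Proof. by rewrite !cutE dout_noloop din_noloop. Qed.
Lemma net_noloop T v : net (noloop T) v = net T v.
Proof.
rewrite /noloop; elim: T => //= e T IH; case: eqP => [h|_] /=; rewrite !net_cons IH //.
by rewrite h subrr add0r.
Qed.
Lemma ori_noloop T s : ori (noloop T) s -> ori T s.
Proof.
rewrite /noloop; elim: T s => //= -[a b] T IH s /=; case: eqP => [<-|_] /=.
  by move/IH/(ori_cons a a); apply: ori_ext => v; lia.
case=> -[//|e' F'] /= /andP[he hF] hs.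
have [F2 h2 e2] : ori T (fun v => net F' v) by apply: IH; exists F'.
by exists (e' :: F2) => [|v]; rewrite /= ?he // hs !net_cons e2.
Qed.
Lemma within_noloop U T : within U T -> inside U (noloop T).
Proof.
move=> h; apply/allP=> e; rewrite mem_filter => /andP[-> /(allP h)/andP[-> ->]].
by [].
Qed.

Lemma dout_perm T1 T2 A : perm_eq T1 T2 -> dout T1 A = dout T2 A.
Proof. by move/permP=> h; apply: h. Qed.
Lemma din_perm T1 T2 A : perm_eq T1 T2 -> din T1 A = din T2 A.
Proof. by move/permP=> h; apply: h. Qed.

Lemma dout_lift u x w T A : dout ((u, x) :: (x, w) :: T) A =
  (dout ((u, w) :: T) A + (if x \in A then (u \notin A) && (w \notin A)
                           else (u \in A) && (w \in A)))%N.
Proof.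
rewrite !dout_cons.
by case: (u \in A); case: (x \in A); case: (w \in A) => /=; rewrite ?addn0 ?addn1.
Qed.

(** Submodularity as an identity: the arcs between the two differences are kept because one such arc
    makes an uncrossing strict. *)
Lemma dout_submod T A B : (dout T (A :|: B) + dout T (A :&: B) +
  count (fun e : V * V => ((e.1 \in A :\: B) && (e.2 \in B :\: A)) ||
                  ((e.1 \in B :\: A) && (e.2 \in A :\: B))) T = dout T A + dout T B)%N.
Proof.
elim: T => // -[a b] T; rewrite !dout_cons /= !inE.
move: (count _ T) (dout T _) (dout T _) (dout T _) (dout T _) => n1 n2 n3 n4 n5.
by case: (a \in A); case: (a \in B); case: (b \in A); case: (b \in B) => /=; clear; lia.
Qed.

Lemma dout_add1 T x A : x \notin A ->
  (dout T (x |: A) + count (fun e : V * V => (e.1 \in A) && (e.2 == x)) T =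
   dout T A + count (fun e : V * V => (e.1 == x) && (e.2 \notin x |: A)) T)%N.
Proof.
move=> xA; elim: T => // -[a b] T; rewrite !dout_cons /= !inE.
move: (count _ T) (count _ T) (dout T _) (dout T _) => n1 n2 n3 n4.
have h v : (v == x) && (v \in A) = false by case: eqP => // ->; rewrite (negbTE xA).
by have := h a; have := h b; case: (a == x); case: (b == x); case: (a \in A); case: (b \in A) => //=; clear; lia.
Qed.

Lemma net_dout T x : net T x = (dout T [set x])%:Z - (din T [set x])%:Z.
Proof. by rewrite -sum_net big_set1. Qed.

Lemma tight_union l U z T P Q : rooted l U z T -> P \subset U :\ z -> Q \subset U :\ z ->
  P :&: Q != set0 -> (dout T P <= l)%N -> (dout T Q <= l)%N -> (dout T (P :|: Q) <= l)%N.
Proof.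
move=> hT hP hQ h0 h1 h2; have := dout_submod T P Q.
have : (l <= dout T (P :&: Q))%N by apply: hT => //; apply: subset_trans hP; apply: subsetIl.
by move: h1 h2; clear; lia.
Qed.

(** Tight sets through [u] meet in [u], so they are closed under union and lie in a largest one. *)
Lemma max_tight l U z T u : rooted l U z T ->
  (forall P, P \subset U :\ z -> u \in P -> (l < dout T P)%N) \/
  exists P0, [/\ P0 \subset U :\ z, u \in P0, (dout T P0 <= l)%N &
    forall P, P \subset U :\ z -> u \in P -> (dout T P <= l)%N -> P \subset P0].
Proof.
move=> hT; pose p := fun P : {set V} => [&& P \subset U :\ z, u \in P & (dout T P <= l)%N].
have [P0 hP0|h] := pickP p; last first.
  by left=> P hP uP; rewrite ltnNge; apply/negP=> hd; have := h P; rewrite /p hP uP hd.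
right; case: (arg_maxnP (fun P : {set V} => #|P|) hP0) => P1 /and3P[h1 h2 h3] hm.
exists P1; split=> // P a1 a2 a3.
have := hm (P1 :|: P); rewrite /p subUset h1 a1 inE h2 /=.
rewrite (tight_union hT) //; last by apply/set0Pn; exists u; rewrite inE h2.
move=> /(_ isT) hc; have /eqP -> : P1 == P1 :|: P by rewrite eqEcard subsetUl.
exact: subsetUr.
Qed.

Section Eliminate.
Variables (l : nat) (U : {set V}) (z x : V).
Hypotheses (xU : x \in U) (xz : x != z).

(** The obstructions to lifting [(u, x), (x, w)] are tight sets that contain [u]
    and [w] but not [x], or [x] but neither [u] nor [w]; uncrossing a maximal set of
    the first kind, or a minimal one of the second, leaves some [w] free. *)
Lemma good_lift T u :
  rooted l (U :\ x) z T ->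
  (forall A, A \subset U :\ z -> x \in A -> A != [set x] -> (l <= dout T A)%N) ->
  within U T ->
  all (fun e : V * V => e.1 != e.2) T -> (u, x) \in T -> (din T [set x] <= dout T [set x])%N ->
  exists w, [/\ (x, w) \in T,
    forall A, A \subset U :\ x :\ z -> u \in A -> w \in A -> (l < dout T A)%N &
    forall A, A \subset U :\ z -> x \in A -> A != [set x] -> u \notin A -> w \notin A ->
      (l < dout T A)%N].
Proof.
move=> ha hb hU nl uxT dd.
have ux : u != x by apply: (allP nl) uxT.
have in1 : (0 < din T [set x])%N.
  by rewrite -has_count; apply/hasP; exists (u, x) => //=; rewrite !inE eqxx andbT.
pose q := fun Q : {set V} => [&& Q \subset U :\ z, x \in Q, Q != [set x], u \notin Q & (dout T Q <= l)%N].
have xS (A : {set V}) : A \subset U :\ x :\ z -> x \notin A.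
  by move=> h; apply/negP=> /(subsetP h); rewrite !inE eqxx andbF.
have UU (A : {set V}) : A \subset U :\ x :\ z -> A \subset U :\ z.
  by move=> h; apply: subset_trans h _; apply: setSD; apply: subsetDl.
have addU (A : {set V}) : A \subset U :\ x :\ z -> x |: A \subset U :\ z.
  by move=> h; rewrite subUset sub1set !inE xz xU UU.
have delU (A : {set V}) : A \subset U :\ z -> A :\ x \subset U :\ x :\ z.
  by move=> /subsetP h; apply/subsetP=> v; rewrite !inE => /andP[-> /h]; rewrite !inE => /andP[-> ->].
have del0 (A : {set V}) : x \in A -> A != [set x] -> A :\ x != set0.
  move=> xA; apply: contra => /eqP e; rewrite -(setD1K xA) e; apply/eqP/setP=> v.
  by rewrite !inE orbF.
have outE (D : {set V}) : x \notin D -> (forall w, (x, w) \in T -> w \notin D) ->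
    count (fun e : V * V => (e.1 == x) && (e.2 \notin x |: D)) T = dout T [set x].
  move=> xD h; apply: eq_in_count => -[a d] adT /=; rewrite !inE.
  have [e|//] := eqVneq a x; rewrite e in adT; rewrite /= negb_or (h d) ?andbT //.
(* Without obstructions of the second kind, [w] only has to avoid the largest tight set through
   [u]. *)
have [Q0 qQ0|noq] := pickP q; last first.
  have [h|[P0 [P0U uP0 tP0 mP0]]] := max_tight u ha.
    have [|[a w] awT] := @hasP _ (fun e : V * V => (e.1 \in [set x]) && (e.2 \notin [set x])) T _.
      by rewrite has_count; apply: leq_trans in1 dd.
    rewrite /= inE => /andP[/eqP ea _]; rewrite ea in awT; exists w; split=> //.
      by move=> A AU uA _; apply: h.
    move=> A AU xA Ax uA _; rewrite ltnNge; apply/negP=> t.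
    by have := noq A; rewrite /q AU xA Ax uA t.
  have xP0 := xS _ P0U.
  have [w xwT wP0] : exists2 w, (x, w) \in T & w \notin P0.
    have [|[a w] awT] := @count_ex (fun e : V * V => (e.1 == x) && (e.2 \notin x |: P0)) T.
      have := dout_add1 T xP0.
      have : (0 < count (fun e : V * V => (e.1 \in P0) && (e.2 == x)) T)%N.
        by rewrite -has_count; apply/hasP; exists (u, x) => //=; rewrite uP0 eqxx.
      have : (l <= dout T (x |: P0))%N.
        apply: hb; [exact: addU | exact: setU11 | apply/eqP=> /setP/(_ u)].
        by rewrite !inE uP0 orbT (negbTE ux).
      by move: tP0; clear; lia_count.
    rewrite /= !inE negb_or => /and3P[/eqP ea _ wP0]; rewrite ea in awT.
    by exists w.
  exists w; split=> //.
    move=> A AU uA wA; rewrite ltnNge; apply/negP=> t.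
    by case/negP: wP0; apply: (subsetP (mP0 A AU uA t)).
  move=> A AU xA Ax uA _; rewrite ltnNge; apply/negP=> t.
  by have := noq A; rewrite /q AU xA Ax uA t.
case: (arg_minnP (fun P : {set V} => #|P|) qQ0) => {qQ0}Q0 /and5P[Q0U xQ0 Q0x uQ0 tQ0] mQ0.
have inE' (D : {set V}) : u \notin D ->
    (count (fun e : V * V => (e.1 \in D) && (e.2 == x)) T < din T [set x])%N.
  move=> uD; rewrite -add1n.
  have -> : din T [set x] = (count (fun e : V * V => (e.1 \notin D) && (e.2 == x)) T +
     count (fun e : V * V => (e.1 \in D) && (e.2 == x)) T)%N.
    rewrite /din -count_predUI [X in (_ + X)%N](_ : _ = 0%N) ?addn0; last first.
      by rewrite -[RHS](count_pred0 T); apply: eq_count => e /=; case: (_ \in D); rewrite /= ?andbF.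
    apply: eq_in_count => e eT /=; rewrite !inE.
    have := allP nl e eT; have [->|_] := eqVneq e.2 x; last by rewrite !andbF.
    by move=> ->; case: (_ \in D).
  by rewrite leq_add2r -has_count; apply/hasP; exists (u, x) => //=; rewrite uD eqxx.
(* If every arc from [x] left [Q0], then [Q0 :\ x] would have fewer than [l] leaving arcs, as the
   arc from [u] is among those entering [x] from outside. *)
have [w xwT wQ0] : exists2 w, (x, w) \in T & w \in Q0 :\ x.
  case: (boolP (has (fun e : V * V => (e.1 == x) && (e.2 \in Q0 :\ x)) T)).
    by case/hasP=> -[a w] awT /andP[/eqP/= ea wQ]; rewrite ea in awT; exists w.
  move/hasPn=> hn; exfalso.
  have := dout_add1 T (x := x) (A := Q0 :\ x); rewrite !inE eqxx /= setD1K // => /(_ isT).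
  have := outE (Q0 :\ x); rewrite setD1K // => -> //; first last.
  - by move=> w xwT; have := hn _ xwT; rewrite /= eqxx.
  - by rewrite !inE eqxx.
  have := inE' (Q0 :\ x); rewrite !inE negb_and uQ0 orbT => /(_ isT).
  have : (l <= dout T (Q0 :\ x))%N by apply: ha; [apply: delU | apply: del0].
  by move: tQ0 dd; clear; lia_count.
move: (wQ0); rewrite in_setD1 => /andP[wx wQ].
exists w; split=> //.
  (* A tight [P] uncrosses with [Q0], and the arc [(u, x)] between the differences gives the
     contradiction. *)
  move=> P PU uP wP; rewrite ltnNge; apply/negP=> t.
  have := dout_submod T P Q0.
  have : (l <= dout T (P :&: Q0))%N.
    apply: ha; last by apply/set0Pn; exists w; rewrite inE wP wQ.
    by apply: subset_trans PU; apply: subsetIl.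
  have : (l <= dout T (P :|: Q0))%N.
    apply: hb; [by rewrite subUset Q0U UU | by rewrite inE xQ0 orbT |].
    by apply/eqP=> /setP/(_ u); rewrite !inE uP (negbTE ux).
  set n := count _ T.
  have : (0 < n)%N.
    by rewrite -has_count; apply/hasP; exists (u, x) => //=; rewrite !inE uP uQ0 xQ0 (negbTE (xS _ PU)).
  by move: t tQ0; clear; lia_count.
move=> Q QU xQ Qx uQ wQn; rewrite ltnNge; apply/negP=> t.
(* A larger intersection would be a smaller obstruction than [Q0]. If the sets meet only in [x],
   each arc from [x] leaves one of them, while those into [x] from within them number less than its
   in-degree; deleting [x] from both contradicts [ha]. *)
have [e|ne] := eqVneq (Q :&: Q0) [set x]; last first.
  have := mQ0 (Q :&: Q0); rewrite /q.
  have -> : Q :&: Q0 \subset U :\ z by apply: subset_trans QU; apply: subsetIl.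
  rewrite !inE xQ xQ0 ne (negbTE uQ) /=.
  have -> : (dout T (Q :&: Q0) <= l)%N.
    have := dout_submod T Q Q0.
    have : (l <= dout T (Q :|: Q0))%N.
      apply: hb; [by rewrite subUset QU Q0U | by rewrite inE xQ |].
      by apply/eqP=> /setP/(_ w); rewrite !inE wQ orbT (negbTE wx).
    by move: t tQ0; clear; lia_count.
  move=> /(_ isT); rewrite leqNgt => /negP; apply; apply: proper_card.
  by apply/properP; split; [apply: subsetIr | exists w; rewrite // inE (negbTE wQn)].
have xn (D : {set V}) : x \notin D :\ x by rewrite !inE eqxx.
have := dout_add1 T (xn Q0); have := dout_add1 T (xn Q); rewrite !setD1K //.
have : (l <= dout T (Q :\ x))%N by apply: ha; [apply: delU | apply: del0].
have : (l <= dout T (Q0 :\ x))%N by apply: ha; [apply: delU | apply: del0].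
have : (count (fun e : V * V => (e.1 \in Q :\ x) && (e.2 == x)) T +
  count (fun e : V * V => (e.1 \in Q0 :\ x) && (e.2 == x)) T < din T [set x])%N.
  have := inE' ((Q :|: Q0) :\ x); rewrite !inE negb_and negb_or uQ uQ0 orbT => /(_ isT).
  apply: leq_ltn_trans; rewrite -count_predUI [X in (_ + X)%N](_ : _ = 0%N) ?addn0; last first.
    rewrite -[RHS](count_pred0 T); apply: eq_count => d /=; rewrite !inE.
    have := congr1 (fun D : {set V} => d.1 \in D) e; rewrite !inE.
    by case: (d.1 == x); case: (d.1 \in Q); case: (d.1 \in Q0); rewrite ?andbF.
  apply: sub_count => d /=; rewrite !inE.
  by case: (d.1 == x); case: (d.2 == x); case: (d.1 \in Q); case: (d.1 \in Q0).
have : (dout T [set x] <= count (fun e : V * V => (e.1 == x) && (e.2 \notin Q)) T +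
   count (fun e : V * V => (e.1 == x) && (e.2 \notin Q0)) T)%N.
  rewrite -count_predUI; apply: leq_trans (leq_addr _ _); apply: sub_count => d /=; rewrite !inE.
  have := congr1 (fun D : {set V} => d.2 \in D) e; rewrite !inE.
  by case: (d.1 == x); case: (d.2 == x); case: (d.2 \in Q); case: (d.2 \in Q0).
by move: t tQ0 dd; clear; lia_count.
Qed.

End Eliminate.
End Rooted.

(** * Lifting away all arcs through a vertex *)

Section Splitting.
Variable V : finType.
Implicit Types (F T O : seq (V * V)) (A B P Q U : {set V}) (s : V -> int).

(** [T] splits into [T'] and a star [O] of arcs leaving [x], up to lifting pairs
    of consecutive arcs through [x]. *)
Definition splits U x T T' O :=
  [/\ inside U T', all (fun e : V * V => [&& e.1 == x, e.2 != x & e.2 \in U]) O,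
      forall s, ori (T' ++ O) s -> ori T s &
      forall v, net T v = net T' v + net O v].

Definition unlooped T := all (fun e : V * V => e.1 != e.2) T.

Lemma unlooped_noloop T : unlooped (noloop T).
Proof. by apply/allP=> e; rewrite mem_filter => /andP[]. Qed.

Lemma size_star T x : unlooped T -> size [seq e <- T | e.1 == x] = dout T [set x].
Proof.
move=> nl; rewrite size_filter; apply: eq_in_count => e /(allP nl).
by rewrite !inE; case: (e.1 =P x) => [->|//]; rewrite eq_sym.
Qed.

Lemma splits_star U x T : within U T -> unlooped T ->
  splits U x T [seq e <- T | e.1 != x] [seq e <- T | e.1 == x].
Proof.
move=> hU nl.
have hp : perm_eq ([seq e <- T | e.1 != x] ++ [seq e <- T | e.1 == x]) T.
  by rewrite perm_catC; apply/permPl/perm_filterC.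
split.
- apply/allP=> e; rewrite mem_filter => /andP[_ eT].
  by rewrite (allP nl e eT); have /andP[-> ->] := allP hU e eT.
- apply/allP=> e; rewrite mem_filter => /andP[/eqP ex eT].
  rewrite -ex eqxx eq_sym (allP nl e eT); by have /andP[_ ->] := allP hU e eT.
- by move=> s; apply: ori_perm.
- by move=> v; rewrite -net_cat; apply/esym/net_perm.
Qed.

Lemma dout_star T x A : x \notin A -> dout [seq e <- T | e.1 != x] A = dout T A.
Proof.
move=> xA; rewrite /dout count_filter; apply: eq_count => e /=.
by case: (e.1 =P x) => [->|_]; rewrite ?(negbTE xA) ?andbT.
Qed.

Lemma lift_perm u x w T : u != x -> (u, x) \in T -> (x, w) \in T ->
  exists T0, perm_eq T ((u, x) :: (x, w) :: T0).
Proof.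
move=> ux h1 h2; exists (rem (x, w) (rem (u, x) T)).
have h3 : (x, w) \in rem (u, x) T.
  move: h2; rewrite (perm_mem (perm_to_rem h1)) inE xpair_eqE eq_sym (negbTE ux).
  by [].
apply: perm_trans (perm_to_rem h1) _; rewrite perm_cons; exact: perm_to_rem.
Qed.

Lemma splits_lift U x u w T T0 T' O : perm_eq T ((u, x) :: (x, w) :: T0) ->
  splits U x (noloop ((u, w) :: T0)) T' O -> splits U x T T' O.
Proof.
move=> hp [h1 h2 h3 h4]; split=> //.
- move=> s /h3/ori_noloop/(ori_lift x); apply: ori_perm.
  by rewrite perm_sym.
- move=> v; rewrite -h4 net_noloop (net_perm v hp) !net_cons /=; ring.
Qed.

Lemma within_lift U x u w T T0 : perm_eq T ((u, x) :: (x, w) :: T0) -> within U T ->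
  within U (noloop ((u, w) :: T0)).
Proof.
move=> hp; rewrite /within (perm_all _ hp) => h.
apply/allP=> e; rewrite mem_filter inE => /andP[_ he].
move: h => /= /and3P[/andP[uU _] /andP[_ wU] h].
by case/orP: he => [/eqP->|/(allP h)//]; rewrite /= uU.
Qed.

Lemma dout_lift_perm x u w T T0 A : perm_eq T ((u, x) :: (x, w) :: T0) ->
  (dout T A = dout (noloop ((u, w) :: T0)) A + (if x \in A then (u \notin A) && (w \notin A)
                           else (u \in A) && (w \in A)))%N.
Proof. by move=> hp; rewrite dout_noloop -dout_lift; apply: dout_perm. Qed.

Lemma deg_lift_perm x u w T T0 : perm_eq T ((u, x) :: (x, w) :: T0) -> u != x -> w != x ->
  dout T [set x] = (dout (noloop ((u, w) :: T0)) [set x]).+1 /\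
  din T [set x] = (din (noloop ((u, w) :: T0)) [set x]).+1.
Proof.
move=> hp ux wx; rewrite dout_noloop din_noloop (dout_perm _ hp) (din_perm _ hp).
by rewrite !dout_cons !din_cons !inE eqxx ux wx (negbTE ux) (negbTE wx).
Qed.

(** Every arc into [x] is lifted with an arc out of [x]; the surplus of [net T x] outgoing arcs is
    the star. Lifting lowers the out-degree of [x], so the induction asks nothing of [[set x]]. *)
Lemma eliminate l U z x T : x \in U -> x != z -> within U T ->
  (din T [set x] <= dout T [set x])%N -> rooted l U z T ->
  exists T' O, [/\ splits U x T T' O, inside (U :\ x) T', (size O)%:Z = net T x &
    rooted l (U :\ x) z T'].
Proof.
move=> xU xz hU dd hT.
suff : exists T' O, [/\ splits U x (noloop T) T' O, inside (U :\ x) T',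
    (size O)%:Z = net (noloop T) x & rooted l (U :\ x) z T'].
  case=> T' [O [[h1 h2 h3 h4] h5 h6 h7]]; exists T', O; rewrite net_noloop in h6.
  by split=> //; split=> // [s /h3/ori_noloop|v]; rewrite // -h4 net_noloop.
have {}hU : within U (noloop T).
  by apply/allP=> e; rewrite mem_filter => /andP[_ /(allP hU)].
have ha : rooted l (U :\ x) z (noloop T).
  by move=> A AU A0; rewrite dout_noloop; apply: hT => //; apply: subset_trans AU _; apply: setSD; apply: subsetDl.
have hb A : A \subset U :\ z -> x \in A -> A != [set x] -> (l <= dout (noloop T) A)%N.
  by move=> AU xA _; rewrite dout_noloop; apply: hT => //; apply/set0Pn; exists x.
have nl := unlooped_noloop T.
rewrite -din_noloop -(dout_noloop T [set x]) in dd.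
move: (noloop T) nl hU dd ha hb => {hT}T.
move: {2}(din T [set x]) (erefl (din T [set x])) => n.
elim: n T => [|n IH] T dn nl hU dd ha hb.
  have no e : e \in T -> e.2 != x.
    move=> eT; apply/eqP=> ex; suff : has (fun e : V * V => (e.1 \notin [set x]) && (e.2 \in [set x])) T.
      by rewrite has_count -/(din T [set x]) dn.
    by apply/hasP; exists e => //; rewrite !inE ex eqxx andbT -ex; apply: (allP nl).
  exists [seq e <- T | e.1 != x], [seq e <- T | e.1 == x]; split.
  - exact: splits_star.
  - apply/allP=> e; rewrite mem_filter => /andP[ex eT].
    by rewrite !inE ex (no e eT) (allP nl e eT) andbT; exact: (allP hU).
  - by rewrite size_star // net_dout dn subr0.
  - move=> A AU A0; rewrite dout_star; first exact: ha.
    by apply/negP=> /(subsetP AU); rewrite !inE eqxx andbF.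
have [|[u y] uyT] := @hasP _ (fun e : V * V => (e.1 \notin [set x]) && (e.2 \in [set x])) T _.
  by rewrite has_count -/(din T [set x]) dn.
rewrite !inE /= => /andP[ux /eqP ey]; rewrite {}ey in uyT.
have [w [xwT wa wb]] := good_lift xU xz ha hb hU nl uyT dd.
have wx : w != x by rewrite eq_sym; apply: (allP nl) xwT.
have [T0 hp] := lift_perm ux uyT xwT.
have [eo ei] := deg_lift_perm hp ux wx.
have [||||||T' [O [h1 h2 h3 h4]]] := IH (noloop ((u, w) :: T0)).
- by move: ei; rewrite dn => -[].
- exact: unlooped_noloop.
- exact: within_lift hp hU.
- by move: dd; rewrite eo ei ltnS.
- move=> A AU A0; have := ha A AU A0; have := wa A AU; rewrite (dout_lift_perm A hp).
  have -> : (x \in A) = false by apply/negP=> /(subsetP AU); rewrite !inE eqxx andbF.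
  by case: (u \in A); case: (w \in A); rewrite ?addn0 ?addn1 // => /(_ isT isT).
- move=> A AU xA Ax; have := hb A AU xA Ax; have := wb A AU xA Ax; rewrite (dout_lift_perm A hp) xA.
  by case: (u \in A); case: (w \in A); rewrite ?addn0 ?addn1 // => /(_ isT isT).
exists T', O; split=> //; first exact: splits_lift hp h1.
by rewrite h3 net_noloop (net_perm x hp) !net_cons /=; ring.
Qed.

(** Sets through [z] carry no condition, so only tight sets containing both outer ends block a lift.
    If the largest tight set through [w] held the tails of all arcs into [z], more than [l] arcs
    would leave it. *)
Lemma lift_root l U z T n : within U T -> rooted l U z T ->
  din T [set z] = (l + n)%N -> (n <= dout T [set z])%N ->
  exists T' O, [/\ splits U z T T' O, (size O + n)%N = dout T [set z],
    rooted l U z T' & cut T' [set z] = l].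
Proof.
move=> hU hT di dn.
suff : exists T' O, [/\ splits U z (noloop T) T' O, (size O + n)%N = dout (noloop T) [set z],
    rooted l U z T' & cut T' [set z] = l].
  case=> T' [O [[h1 h2 h3 h4] h5 h6 h7]]; exists T', O; rewrite dout_noloop in h5.
  by split=> //; split=> // [s /h3/ori_noloop|v]; rewrite // -h4 net_noloop.
have {}hU : within U (noloop T).
  by apply/allP=> e; rewrite mem_filter => /andP[_ /(allP hU)].
have {}hT : rooted l U z (noloop T) by move=> A AU A0; rewrite dout_noloop; apply: hT.
have nl := unlooped_noloop T.
rewrite -din_noloop in di; rewrite -dout_noloop in dn.
move: (noloop T) nl hU hT di dn => {}T.
elim: n T => [|n IH] T nl hU hT di dn.
  exists [seq e <- T | e.1 != z], [seq e <- T | e.1 == z]; split.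
  - exact: splits_star.
  - by rewrite addn0 size_star.
  - move=> A AU A0; rewrite dout_star; first exact: hT.
    by apply/negP=> /(subsetP AU); rewrite !inE eqxx.
  - rewrite addn0 in di; rewrite -di /cut /din count_filter; apply: eq_count => e /=.
    by rewrite !inE; case: (e.1 == z); case: (e.2 == z).
have [|[y w] ywT] := @hasP _ (fun e : V * V => (e.1 \in [set z]) && (e.2 \notin [set z])) T _.
  by rewrite has_count; apply: leq_ltn_trans dn.
rewrite !inE /= => /andP[/eqP ey wz]; rewrite {}ey in ywT.
have [u [uzT uz hu]] : exists u, [/\ (u, z) \in T, u != z &
    forall A, A \subset U :\ z -> u \in A -> w \in A -> (l < dout T A)%N].
  have [h|[P0 [P0U wP0 tP0 mP0]]] := max_tight w hT.
    have [|[u y'] uyT] := @hasP _ (fun e : V * V => (e.1 \notin [set z]) && (e.2 \in [set z])) T _.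
      by rewrite has_count -/(din T [set z]) di addnS.
    rewrite !inE /= => /andP[uz /eqP ey]; rewrite {}ey in uyT.
    by exists u; split=> // A AU _ wA; apply: h.
  have zP0 : z \notin P0 by apply/negP=> /(subsetP P0U); rewrite !inE eqxx.
  case: (boolP (has (fun e : V * V => [&& e.1 != z, e.2 == z & e.1 \notin P0]) T)).
    case/hasP=> -[u y'] uyT /and3P[/= uz /eqP ey uP0]; rewrite {}ey in uyT.
    exists u; split=> // A AU uA wA; rewrite ltnNge; apply/negP=> t.
    by case/negP: uP0; apply: (subsetP (mP0 A AU wA t)).
  move/hasPn=> hn; exfalso.
  have : (din T [set z] <= dout T P0)%N; last by rewrite di; move: tP0; clear; lia.
  rewrite /din /dout -!size_filter.
  suff -> : [seq e <- T | (e.1 \notin [set z]) && (e.2 \in [set z])] =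
      [seq e <- [seq e <- T | (e.1 \in P0) && (e.2 \notin P0)] | e.2 == z].
    by rewrite [leqRHS]size_filter [leqLHS]size_filter count_filter; apply: sub_count => e /andP[].
  rewrite -filter_predI; apply: eq_in_filter => e eT; rewrite /= !inE.
  have := hn e eT; have [->|_] := eqVneq e.2 z; last by rewrite andbF.
  by case: (e.1 =P z) => [->|_]; rewrite ?zP0 ?(negbTE zP0) /= ?andbT ?negbK //= => ->.
have [T0 hp] := lift_perm uz uzT ywT.
have [eo ei] := deg_lift_perm hp uz wz.
have [|||||T' [O [h1 h2 h3 h4]]] := IH (noloop ((u, w) :: T0)).
- exact: unlooped_noloop.
- exact: within_lift hp hU.
- move=> A AU A0; have := hT A AU A0; have := hu A AU; rewrite (dout_lift_perm A hp).
  have -> : (z \in A) = false by apply/negP=> /(subsetP AU); rewrite !inE eqxx.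
  by case: (u \in A); case: (w \in A); rewrite ?addn0 ?addn1 // => /(_ isT isT).
- by move: ei; rewrite di addnS => -[].
- by move: dn; rewrite eo.
exists T', O; split=> //; first exact: splits_lift hp h1.
by rewrite eo -h2 addnS.
Qed.

End Splitting.

(** * Rooted orientations modulo [2k] *)

Section RootedOrientation.
Variables (V : finType) (k : nat).
Hypothesis hk : (2 <= k)%N.
Local Notation c := ((2 * k)%:Z).
Local Notation N := (dist2k k).
Implicit Types (F T O : seq (V * V)) (A B P Q U : {set V}) (s r b : V -> int).

(** Once its incoming arcs are lifted, a vertex keeps [nu] arcs, and under this
    condition they can be oriented with net out-degree congruent to [r]. *)
Definition eliminable (nu r : int) := (0 <= nu) && ((k%:Z - 1 <= nu) || (N r <= nu)).

(** The numbers [p, p + 2, ..., p + 2k - 2] meet every class modulo [2k] of their parity. *)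
Lemma residue_in_interval (p q r : int) : c - 2 <= q - p -> (2 %| r - p)%Z ->
  exists t, [/\ (c %| t - r)%Z, p <= t & t <= q].
Proof.
move=> hpq par.
have [d [m [e m0 mc]]] : exists d m, [/\ r - p = d * c + m, 0 <= m & m < c].
  exists ((r - p) %/ c)%Z, ((r - p) %% c)%Z; split; first exact: divz_eq.
    by apply: modz_ge0; move: hk; clear; lia.
  by apply: ltz_pmod; move: hk; clear; lia.
have m2 : (2 %| m)%Z.
  have h : (2 %| d * c)%Z by apply: dvdz_mull; apply/dvdzP; exists k%:Z; clear; lia.
  by apply: dvd_eq (rpredB par h) _; rewrite e; ring.
exists (p + m); split.
- by apply/dvdzP; exists (- d); rewrite mulNr; move: e; clear; lia.
- by move: m0; clear; lia.
- by move: mc m2 hpq; clear; lia.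
Qed.

(** For [nu >= k - 1] the two intervals allowed for [t] meet in one of length at least [2k - 2];
    this is where [1 - k <= B] enters. Otherwise the representative of [r] nearest to 0 satisfies
    both bounds. *)
Lemma elim_value (nu B b r : int) : eliminable nu r -> `|b| <= nu + B -> (2 %| b - nu - B)%Z ->
  1 - k%:Z <= B -> (2 %| r - nu)%Z ->
  exists t, [/\ (c %| t - r)%Z, `|t| <= nu, `|t + b| <= c - 2 + B & (2 %| t - nu)%Z].
Proof.
move=> /andP[nu0 ok] hb pb hB pr.
have par t : (c %| t - r)%Z -> (2 %| t - nu)%Z.
  case/dvdzP=> q e; apply/dvdzP; case/dvdzP: pr => j ej; exists (q * k%:Z + j).
  by rewrite mulrDl -ej -(subrK r t) e; clear; lia.
have [h|h] := leP (k%:Z - 1) nu.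
  have [||t [h1 h2 h3]] := @residue_in_interval (Num.max (- nu) (- b - c + 2 - B))
    (Num.min nu (- b + c - 2 + B)) r.
  - by move: h hb hB nu0; clear; lia.
  - by move: pr pb; clear; lia.
  - exists t; split=> //; try exact: par; move: h2 h3; clear; lia.
have ok' : N r <= nu by move: ok h; clear; lia.
have [p [m [e m1 m2 em]]] := dist2kP hk r.
have h1 : (c %| m - r)%Z by apply/dvdzP; exists (- p); rewrite e; ring.
exists m; split=> //; [by rewrite -em | | exact: par].
by move: h ok' hb hk; rewrite em; clear; lia.
Qed.

(** For negative [nu] the bound below [2k] suffices. Otherwise parity gives [N r >= nu + 2], and
    [|s|], being [N r] or [2k - N r], is at most [2k - 2 - nu]. *)
Lemma net_window (nu B b r s : int) : ~~ eliminable nu r -> `|b| <= nu + B -> (2 %| r - nu)%Z ->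
  (c %| s - r)%Z -> `|s| < c -> `|s + b| <= c - 2 + B.
Proof.
rewrite /eliminable => h hb pr cs sc.
have e : N r = N s by apply/esym/dist2k_congr.
have := dist2k_par hk r; have := dist2k_near hk sc; have := dist2k_le hk r; rewrite -e.
by move: h hb pr sc; clear; lia.
Qed.

Lemma orient_tight_set A T s2 r : A != set0 -> ori (outer A T) s2 ->
  (forall v, v \in A -> (2 %| r v - net T v)%Z) ->
  (forall B, B \subset A -> B != A -> B != set0 -> c - 2 + N (sm r B) <= (cut T B)%:Z) ->
  (cut T A)%:Z <= c - 2 + N (sm r A) -> (c %| sm r A - sm s2 A)%Z ->
  exists2 s1, ori (inner A T) s1 &
    forall v, v \in A -> (c %| s1 v + s2 v - r v)%Z /\ `|s1 v + s2 v| < c.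
Proof.
move=> A0 os2 hr hcut htop hsum.
pose z1 := fun x => (cut (outer A T) [set x])%:Z.
have ce (D : {set V}) : D \subset A -> (cut (noloop (inner A T)) D)%:Z + sm z1 D = (cut T D)%:Z.
  by move=> DA; rewrite cut_noloop cut_outer // (cut_inner_outer A T D) PoszD.
suff [s1 [os1 hs1]] : extendable k A (noloop (inner A T)) s2 r.
  by exists s1; [apply: ori_noloop | move=> v; apply: hs1].
apply: (@orientation_mod_extension V k hk A set0 _ z1); split.
- apply: within_noloop; apply/allP=> e; rewrite mem_filter => /andP[]; by case/andP=> -> ->.
- by move=> x _; case: (ori_cut1 x os2).
- by move=> x _; have [_ [j e]] := ori_cut1 x os2; rewrite e /z1; clear; lia.
- move=> x xA; have := hr x xA; have := ce [set x]; rewrite sub1set sm1 => /(_ xA).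
  by rewrite net_dout [cut T _]cutE PoszD; clear; lia.
- by rewrite properEneq sub0set eq_sym A0.
- by move=> x; rewrite inE.
- by move=> D DA Dn; rewrite subset0 => D0; rewrite ce //; apply: hcut.
- rewrite (_ : sm z1 A = (cut T A)%:Z) // -ce // cut_noloop cut_inner_top; clear; lia.
- exact: hsum.
Qed.

Lemma net_quot (W : {set V}) A a0 T v : a0 \in A -> A \subset W -> within W T -> v \in quot_set W A a0 ->
  net (quot A a0 T) v = quot_fun A a0 (net T) v.
Proof.
move=> a0A AW TW vW; have vs : [set v] \subset quot_set W A a0 by rewrite sub1set.
rewrite net_dout -[RHS]sm1 (sm_quot a0A AW) // /sm sum_net.
have := cut_quot AW vs TW; have := dout_quot AW vs TW; rewrite !cutE.
by move=> -> /addnI ->.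
Qed.

(** [b v] collects the contribution already fixed at [v], and [B v] is the allowance for it.
    Eliminating a vertex raises [net] at [v] by the number of star arcs entering [v], which is the
    most that [b v] can change, so the bound on [b v] survives. *)
Lemma rooted_orientation U z T b (B : V -> int) r :
  z \in U -> within U T -> rooted (2 * k - 2) U z T ->
  (forall v, v \in U -> v != z -> [/\ `|b v| <= net T v + B v,
     (2 %| b v - net T v - B v)%Z & 1 - k%:Z <= B v]) ->
  (forall v, v \in U -> (2 %| r v - net T v)%Z) -> (c %| sm r U)%Z ->
  exists s, [/\ ori T s, forall v, v \in U -> (c %| s v - r v)%Z &
    forall v, v \in U -> v != z -> `|s v + b v| <= c - 2 + B v].
Proof.
move: {2}#|U| (erefl #|U|) => n; elim/ltn_ind: n U T b B r => n IH U T b B r en zU TU hT hb hr hs.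
have [he|[x xU]] := all_or_ex (U :\ z) (fun x => ~~ eliminable (net T x) (r x)); last first.
  rewrite negbK => ok; move: xU; rewrite !inE => /andP[xz xU].
  have [hb1 hb2 hb3] := hb x xU xz.
  have [t [t1 t2 t3 t4]] := elim_value ok hb1 hb2 hb3 (hr x xU).
  have dd : (din T [set x] <= dout T [set x])%N.
    by case/andP: ok; rewrite net_dout; clear; lia.
  have [T' [O [[_ hO oT nT] T'x sO hT']]] := eliminate xU xz TU dd hT.
  have [||| so oso esx] := @ori_star _ x O t.
  - by apply: sub_all hO => e /and3P[-> -> _].
  - by rewrite sO.
  - by rewrite sO; case/dvdzP: t4 => j ej; exists j; rewrite -ej; clear; lia.
  have Owithin : within U O.
    by apply: sub_all hO => e /and3P[/eqP-> _ ->]; rewrite xU.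
  have nO v : v != x -> net O v = - (cut O [set v])%:Z.
    move=> vx; rewrite net_dout cutE PoszD.
    suff -> : dout O [set v] = 0%N by clear; lia.
    rewrite /dout -[RHS](count_pred0 O); apply: eq_in_count => e /(allP hO)/and3P[/eqP-> _ _].
    by rewrite !inE eq_sym (negbTE vx).
  have xU' v : v \in U :\ x -> v \in U /\ v != x by rewrite !inE => /andP[].
  have [||||||||s' [os' cs' ws']] := IH #|U :\ x| _ (U :\ x) T' (fun v => b v + so v) B (fun v => r v - so v).
  - by rewrite -en (cardsD1 x U) xU.
  - by [].
  - by rewrite !inE eq_sym xz.
  - exact: inside_in T'x.
  - exact: hT'.
  - move=> v /xU'[vU vx] vz; have [h1 h2 h3] := hb v vU vz.
    have [o1 [j o2]] := ori_cut1 v oso; have := nT v; rewrite nO // => e; split=> //.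
      by move: h1 o1 e; clear; lia.
    by move: h2 o2 e; clear; lia.
  - move=> v /xU'[vU vx]; have := hr v vU.
    have [_ [j o2]] := ori_cut1 v oso; have := nT v; rewrite nO //.
    by move: o2; clear; lia.
  - have := ori_sum oso Owithin; rewrite -/(sm so U) (smD1 so xU) esx => e1.
    rewrite (sm_add r (fun v => - so v)) sm_opp.
    apply: dvd_eq (rpredD hs t1) _; rewrite (smD1 r xU); move: e1; clear; lia.
  have s'x : s' x = 0.
    apply: (ori_zero os').
    rewrite /cut -[RHS](count_pred0 T'); apply: eq_in_count => e /(allP T'x).
    by rewrite !inE => /and3P[/andP[/negbTE-> _] /andP[/negbTE-> _] _].
  exists (fun v => s' v + so v); split.
  - exact: oT (ori_cat os' oso).
  - move=> v vU; have [->|vx] := eqVneq v x.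
      by rewrite s'x add0r esx.
    have := cs' v; rewrite !inE vx vU => /(_ isT) h; apply: dvd_eq h _; ring.
  - move=> v vU vz; have [->|vx] := eqVneq v x.
      by rewrite s'x add0r esx.
    have := ws' v; rewrite !inE vx vU => /(_ isT vz); congr (`|_| <= _); ring.
(* The degree is twice the out-degree minus [net]; out-degree at least [2k - 2] and failure of
   [eliminable] make it large enough. *)
have c1 v : v \in U -> v != z -> c - 2 + N (r v) <= (cut T [set v])%:Z.
  move=> vU vz; have := he v; rewrite !inE vz vU /eliminable net_dout => /(_ isT).
  have := hT [set v]; rewrite sub1set !inE vz vU => /(_ isT).
  have -> : [set v] != set0 by apply/set0Pn; exists v; rewrite inE.
  move=> /(_ isT); have := dist2k_le hk (r v); rewrite cutE PoszD; move: hk; clear; lia.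
have win v s : v \in U -> v != z -> (c %| s v - r v)%Z -> `|s v| < c -> `|s v + b v| <= c - 2 + B v.
  move=> vU vz h1 h2; have [hb1 hb2 hb3] := hb v vU vz.
  by apply: net_window (hb1) (hr v vU) h1 h2; apply: he; rewrite !inE vz.
pose fam := fun A : {set V} => [&& A \subset U :\ z, (1 < #|A|)%N & (cut T A)%:Z <= c - 2 + N (sm r A)].
have big A : A \subset U :\ z -> A != set0 -> ~~ fam A -> c - 2 + N (sm r A) <= (cut T A)%:Z.
  move=> AU A0; rewrite /fam AU /=.
  have [A1|A1] := ltnP 1 #|A|; first by rewrite -ltNge => /ltW.
  have [v vA] : exists v, A = [set v] by apply/cards1P; rewrite eqn_leq A1 card_gt0.
  move: AU; rewrite vA sub1set !inE sm1 => /andP[vz vU] _; exact: c1.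
have [A0 hA0|nofam] := pickP fam; last first.
  have zer : ori (outer U T) (fun => 0).
    suff -> : outer U T = [::] by apply: ori_nil.
    rewrite /outer -(filter_pred0 T); apply: eq_in_filter => e /(allP TU)/andP[-> ->].
    by [].
  have cU : cut T U = 0%N.
    rewrite /cut -[RHS](count_pred0 T); apply: eq_in_count => e /(allP TU)/andP[-> ->].
    by [].
  have [||||||s1 os1 hs1] := @orient_tight_set U T (fun => 0) r.
  - by apply/set0Pn; exists z.
  - exact: zer.
  - exact: hr.
  (* A set through [z] is exchanged for its complement, which has the same cut and, as residues sum
     to 0 over [U], the same distance. *)
  - move=> D DU Dn D0; have [zD|zD] := boolP (z \in D); last first.
      apply: big; rewrite ?nofam // subsetD1 DU; exact: zD.
    have -> : cut T D = cut T (U :\: D) by rewrite (cutC _ TU).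
    have -> : N (sm r D) = N (sm r (U :\: D)).
      rewrite -[RHS]dist2kN //; apply: dist2k_congr => //.
      by apply: dvd_eq hs _; rewrite (smC r DU); ring.
    apply: big; rewrite ?nofam //; first by apply/subsetP=> v; rewrite !inE => /andP[vD ->]; rewrite andbT; apply/eqP=> e; rewrite e zD in vD.
    by rewrite setD_eq0; apply: contra Dn => h; rewrite eqEsubset DU.
  - by rewrite cU; have := dist2k_ge0 hk (sm r U); move: hk; clear; lia.
  - by rewrite /sm [X in _ - X]big1 // subr0.
  have hs1' v : v \in U -> (c %| s1 v - r v)%Z /\ `|s1 v| < c.
    by move/hs1; rewrite addr0.
  exists s1; split.
  - by apply: ori_ext (ori_inner_outer os1 zer) => v; rewrite addr0.
  - by move=> v /hs1'[].
  - by move=> v vU vz; have [h1 h2] := hs1' v vU; apply: win.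
(* Minimality gives the proper subsets of [A] the cut condition required inside [A]. *)
case: (arg_minnP (fun A : {set V} => #|A|) hA0) => {hA0 A0}A /and3P[AUz A1 tA] mA.
have AU : A \subset U by apply: subset_trans AUz (subsetDl _ _).
have zA : z \notin A by apply/negP=> /(subsetP AUz); rewrite !inE eqxx.
have A0 : A != set0 by rewrite -card_gt0; apply: ltnW.
have [a0 a0A] := set0Pn _ A0.
have a0z : a0 != z by apply: contra zA => /eqP<-.
pose U' := quot_set U A a0; pose T' := quot A a0 T.
have nA := fun v => @net_quot U A a0 T v a0A AU TU.
have U'P v : v \in U' -> v != a0 -> v \in U /\ v \notin A.
  by rewrite !inE => /orP[->//|/andP[-> ->]].
(* At the contracted vertex any [b] and [B] meeting the hypotheses will do: inside [A] the window
   comes from [win]. *)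
have [||||||||s' [os' cs' ws']] := IH #|U'| _ U' T' (fun v => if v == a0 then 0 else b v)
   (fun v => if v == a0 then `|net T' a0| else B v) (quot_fun A a0 r).
- by have := card_quot a0A AU; rewrite -/U' -en; move: A1; clear; lia.
- by [].
- by rewrite !inE zA zU orbT.
- exact: quot_in.
- move=> D DU D0; have [DU' zD] := subsetD1P DU.
  rewrite (dout_quot AU) //; apply: hT.
    by rewrite subsetD1 pre_sub (in_pre a0A).
  have [v vD] := set0Pn _ D0; apply/set0Pn.
  have [e|vx] := eqVneq v a0; first by exists a0; rewrite in_preA // -e.
  have [_ vA] := U'P v (subsetP DU' v vD) vx.
  by exists v; rewrite (in_pre a0A).
- move=> v vU vz; case: eqP => [->|/eqP va]; first by rewrite normr0; split; move: hk; clear; lia.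
  have [vU' vA] := U'P v vU va; rewrite nA // /quot_fun (negbTE va); exact: hb.
- move=> v vU; rewrite nA // /quot_fun; case: eqP => [_|/eqP va].
    by rewrite /sm -sumrB; apply: dvdz_sum => w wA; apply: hr; apply: (subsetP AU).
  by have [vU' vA] := U'P v vU va; apply: hr.
- rewrite (sm_quot a0A AU) //; suff -> : pre U A a0 U' = U by [].
  apply/eqP; rewrite eqEsubset pre_sub /=; apply/subsetP=> v vU; rewrite inE vU.
  exact: proj_quot.
have [s2 os2 [sA s2n]] := ori_quot a0A os'.
have [||||||s1 os1 hs1] := @orient_tight_set A T s2 r => //.
- by move=> v vA; apply: hr; apply: (subsetP AU).
- move=> D DA Dn D0; apply: big => //; first exact: subset_trans DA AUz.
  apply/negP=> /mA; rewrite leqNgt proper_card // properEneq Dn; exact: DA.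
- have a0U' : a0 \in U' by rewrite !inE eqxx.
  have := cs' _ a0U'; rewrite /quot_fun eqxx sA => h.
  by apply: dvd_eqN h _; ring.
have s10 v : v \notin A -> s1 v = 0.
  move=> vA; apply: (ori_zero os1).
  rewrite /cut -[RHS](count_pred0 (inner A T)); apply: eq_in_count => e.
  rewrite mem_filter !inE => /andP[/andP[e1 e2] _].
  have h y : y \in A -> (y == v) = false by move=> yA; apply/eqP=> e0; rewrite -e0 yA in vA.
  by rewrite !h.
have out v : v \in U -> v \notin A -> [/\ v \in U', v == a0 = false & s1 v + s2 v = s' v].
  move=> vU vA; have va : v == a0 = false by apply/eqP=> e; rewrite e a0A in vA.
  by split; rewrite ?s10 ?add0r ?s2n // !inE va vA.
exists (fun v => s1 v + s2 v); split; first exact: ori_inner_outer os1 os2.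
- move=> v vU; have [vA|vA] := boolP (v \in A); first by case: (hs1 v vA).
  by have [vU' va ->] := out v vU vA; have := cs' v vU'; rewrite /quot_fun va.
- move=> v vU vz; have [vA|vA] := boolP (v \in A).
    by have [h1 h2] := hs1 v vA; apply: (win v (fun v => s1 v + s2 v)).
  by have [vU' va ->] := out v vU vA; have := ws' v vU' vz; rewrite va.
Qed.

End RootedOrientation.

(** * Nearly balanced orientations *)

Section Balanced.
Local Open Scope nat_scope.
Variable V : finType.
Implicit Types (F T : seq (V * V)) (A B P : {set V}) (q Q : V -> nat).

Definition ein F A := count (fun e : V * V => (e.1 \in A) && (e.2 \in A)) F.
Definition odeg F v := count (fun e : V * V => e.1 == v) F.
Definition ideg F v := count (fun e : V * V => e.2 == v) F.
Definition smn q A := \sum_(v in A) q v.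

Lemma smn_modular q A B : smn q (A :|: B) + smn q (A :&: B) = smn q A + smn q B.
Proof.
have E D : smn q D = \sum_v (v \in D) * q v.
  by rewrite /smn big_mkcond; apply: eq_bigr => v _; case: (v \in D); rewrite ?mul1n.
rewrite !E -!big_split; apply: eq_bigr => v _ /=.
by rewrite !inE; case: (v \in A); case: (v \in B); rewrite /= ?mul0n ?addn0 ?add0n.
Qed.

Lemma smn_ind x A : smn (fun v => x == v) A = (x \in A).
Proof.
rewrite /smn; have [xA|xA] := boolP (x \in A).
  rewrite (bigD1 x) //= eqxx big1 ?addn0 // => v /andP[_ vx].
  by rewrite eq_sym (negbTE vx).
by rewrite big1 // => v vA; case: eqP => // e; rewrite e vA in xA.
Qed.

Lemma smn_add q1 q2 A : smn (fun v => q1 v + q2 v) A = smn q1 A + smn q2 A.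
Proof. exact: big_split. Qed.

Lemma eq_smn q1 q2 A : (forall v, q1 v = q2 v) -> smn q1 A = smn q2 A.
Proof. by move=> h; apply: eq_bigr => v _. Qed.

Lemma smn1 q v : smn q [set v] = q v. Proof. exact: big_set1. Qed.

Lemma ein_cons x y F A : ein ((x, y) :: F) A = (x \in A) && (y \in A) + ein F A.
Proof. by []. Qed.

Lemma ein_supermod F A B : ein F A + ein F B <= ein F (A :|: B) + ein F (A :&: B).
Proof.
elim: F => // -[a b] F; rewrite !ein_cons !inE.
move: (ein F _) (ein F _) (ein F _) (ein F _) => n1 n2 n3 n4.
by case: (a \in A); case: (a \in B); case: (b \in A); case: (b \in B) => /=; clear; lia.
Qed.

Lemma smn_odeg F A : smn (odeg F) A = ein F A + dout F A.
Proof.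
elim: F => [|[a b] F IH]; first by rewrite /smn big1.
rewrite ein_cons dout_cons; transitivity (smn (fun v => (a == v) + odeg F v) A) => //.
rewrite smn_add smn_ind IH.
by case: (a \in A); case: (b \in A) => /=; clear; lia.
Qed.

Lemma smn_deg F A : smn (fun v => odeg F v + ideg F v) A = 2 * ein F A + cut F A.
Proof.
elim: F => [|[a b] F IH]; first by rewrite /smn big1.
rewrite ein_cons cut_cons.
transitivity (smn (fun v => ((a == v) + (b == v)) + (odeg F v + ideg F v)) A).
  by apply: eq_smn => v; rewrite /odeg /ideg /=; clear; lia.
rewrite !(smn_add _ _ A) in IH *; rewrite !smn_ind.
by case: (a \in A); case: (b \in A) => /=; move: IH; clear; lia.
Qed.

(** Hakimi's theorem, by induction on the edges. If neither end of [xy] could be its tail, tight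
    sets through [x] and [y] would uncross to a violation at their union, which also contains the
    edge [xy]. *)
Lemma orientation_outdeg F q : smn q setT = size F -> (forall A, ein F A <= smn q A) ->
  exists2 F', reor F F' & forall v, odeg F' v = q v.
Proof.
elim: F q => [|[x y] F IH] q sq hq.
  exists [::] => // v; apply/esym/eqP; rewrite -leqn0 -[leqRHS]sq -(smn1 q v) /smn.
  by rewrite [leqRHS](big_setID [set v]) /= setTI leq_addr.
have main a b : (a, b) = (x, y) \/ (a, b) = (y, x) ->
    (forall A, a \in A -> ein F A < smn q A) -> exists2 F', reor ((x, y) :: F) F' & forall v, odeg F' v = q v.
  move=> hab ha.
  have qa : 0 < q a by have := ha [set a]; rewrite inE eqxx smn1 => /(_ isT); apply: leq_ltn_trans.
  pose q' := fun v => q v - (a == v).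
  have eq' v : q v = (a == v) + q' v.
    by rewrite /q'; case: (a =P v) => [<-|_] /=; move: qa; clear; lia.
  have sq' A : smn q A = (a \in A) + smn q' A.
    by rewrite (eq_smn _ eq') smn_add smn_ind.
  have [||F' rF oF] := IH q'.
  - by have := sq' setT; rewrite inE sq /=; clear; lia.
  - move=> A; have := ha A; have := hq A; rewrite ein_cons sq'.
    by case: (a \in A) => /=; clear; lia.
  exists ((a, b) :: F').
    by case: hab => ->; rewrite /= rF eqxx ?orbT.
  by move=> v; rewrite eq' -oF.
have [hx|] := boolP [forall A : {set V}, (x \in A) ==> (ein F A < smn q A)].
  by apply: (main x y) => [|A xA]; [left | apply: (implyP (forallP hx A))].
rewrite negb_forall => /existsP[A]; rewrite negb_imply -leqNgt => /andP[xA tA].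
have [hy|] := boolP [forall A : {set V}, (y \in A) ==> (ein F A < smn q A)].
  by apply: (main y x) => [|B yB]; [right | apply: (implyP (forallP hy B))].
rewrite negb_forall => /existsP[B]; rewrite negb_imply -leqNgt => /andP[yB tB].
have := smn_modular q A B; have := ein_supermod F A B.
have := hq (A :|: B); have := hq (A :&: B); rewrite !ein_cons !inE xA yB orbT /=.
by move: tA tB; clear; lia.
Qed.

Section Rounding.
Local Open Scope nat_scope.
Variables (F : seq (V * V)) (z : V) (L : nat).
Let d v := odeg F v + ideg F v.
Let h A := ein F A + (if (z \in A) || (A == set0) then 0 else L).

(** [Q] is twice the out-degree aimed at.  Each step makes two odd values even; the
    value at [z] is only ever raised. *)
Lemma rounding n Q : #|[set v | odd (Q v)]| <= n ->
  (forall v, odd (Q v) -> Q v = d v) -> (forall v, Q v <= (d v).+1) ->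
  (forall v, d v <= (Q v).+1) -> (forall v, ~~ odd (d v) -> Q v = d v) -> d z <= Q z ->
  smn Q setT = 2 * size F -> (forall A, 2 * h A <= smn Q A) ->
  exists q, [/\ forall v, q v = (d v)./2 \/ q v = uphalf (d v), q z = uphalf (d z),
    smn q setT = size F & forall A, h A <= smn q A].
Proof.
elim/ltn_ind: n Q => n IH Q cn ho hu hl he hz hs hA.
have [allE|] := boolP [forall v, ~~ odd (Q v)].
  have ev v : Q v = 2 * (Q v)./2 by have := forallP allE v; lia.
  have sE A : smn Q A = 2 * smn (fun v => (Q v)./2) A.
    by rewrite (eq_smn _ ev) /smn big_distrr.
  exists (fun v => (Q v)./2); split.
  - move=> v; have := hu v; have := hl v; have := he v; have := ev v.
    by move: (d v) (Q v); clear; lia.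
  - have := hu z; have := he z; have := ev z; move: hz; move: (d z) (Q z); clear; lia.
  - by have := sE setT; rewrite hs; clear; lia.
  - by move=> A; have := hA A; rewrite sE; clear; lia.
rewrite negb_forall => /existsP[v0]; rewrite negbK => ov0.
have oddS A : odd (smn Q A) = odd #|[set v in A | odd (Q v)]|.
  have -> : odd (smn Q A) = odd (\sum_(v in A) odd (Q v)).
    by apply: (big_ind2 (fun x y => odd x = odd y)) => // [x1 x2 y1 y2 h1 h2|i _]; rewrite ?oddD ?h1 ?h2 // oddb.
  rewrite -sum1_card [X in _ = odd X](eq_bigl (fun v => (v \in A) && odd (Q v))); last by move=> v; rewrite inE.
  by rewrite [X in _ = odd X]big_mkcondr; congr odd; apply: eq_bigr => v _; case: (odd _).
(* The total is even, so [z] is never the only odd vertex and the value to be lowered can be taken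
   elsewhere. *)
have [v ov vz] : exists2 v, odd (Q v) & v != z.
  have [e|ne] := eqVneq v0 z; last by exists v0.
  have : ~~ odd #|[set v in setT | odd (Q v)]| by rewrite -oddS hs; clear; lia.
  rewrite (cardsD1 v0) !inE ov0 /= negbK => h1.
  have : 0 < #|[set v in setT | odd (Q v)] :\ v0| by move: h1; case: #|_|.
  by case/card_gt0P=> v; rewrite !inE -e => /andP[? ?]; exists v.
pose t := fun P : {set V} => (v \in P) && (smn Q P <= 2 * h P).
have hT : t setT.
  rewrite /t !inE hs /h !inE addn0 leq_mul2l /=.
  by rewrite /ein (eq_count (a2 := predT)) ?count_predT // => e; rewrite !inE.
case: (arg_minnP (fun P : {set V} => #|P|) hT) => P /andP[vP tP] mP.
(* A tight sum is even, so the minimal tight set through [v] contains another odd vertex; the unit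
   is moved from [v] to it. *)
have [u uP [uv ou]] : exists2 u, u \in P & u != v /\ odd (Q u).
  have : ~~ odd #|[set v in P | odd (Q v)]|.
    by rewrite -oddS; have := hA P; move: tP; clear; lia.
  rewrite (cardsD1 v) !inE vP ov /= negbK => h1.
  have : 0 < #|[set v in P | odd (Q v)] :\ v| by move: h1; case: #|_|.
  by case/card_gt0P=> w; rewrite !inE => /and3P[? ? ?]; exists w.
pose Q' := fun w => Q w + (u == w) - (v == w).
have Q1 : 0 < Q v by move: ov; case: (Q v).
have uv' : (u == v) = false by apply: negbTE.
have vu' : (v == u) = false by rewrite eq_sym.
have eQ w : (v == w) + Q' w = (u == w) + Q w.
  by rewrite /Q'; case: (v =P w) => [<-|_]; rewrite ?uv' /=; move: Q1; clear; lia.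
have sQ A : (v \in A) + smn Q' A = (u \in A) + smn Q A.
  by rewrite -!smn_ind -!smn_add; apply: eq_smn.
have Qv : Q' v = (Q v).-1 by rewrite /Q' uv' eqxx addn0 subn1.
have Qu : Q' u = (Q u).+1 by rewrite /Q' vu' eqxx subn0 addn1.
have Qw w : w != u -> w != v -> Q' w = Q w.
  by move=> wu wv; rewrite /Q' ![_ == w]eq_sym (negbTE wu) (negbTE wv) addn0 subn0.
have [dv du] := (ho v ov, ho u ou).
have all3 (R : V -> Prop) : R u -> R v -> (forall w, w != u -> w != v -> R w) -> forall w, R w.
  by move=> h1 h2 h3 w; have [->//|wu] := eqVneq w u; have [->//|wv] := eqVneq w v; apply: h3.
apply: (IH #|[set v | odd (Q' v)]| _ Q') => //.
- apply: leq_trans cn; apply: proper_card; apply/properP; split.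
    apply/subsetP=> w; rewrite !inE.
    apply: (all3 (fun w => odd (Q' w) -> odd (Q w))) => // w' h1 h2; by rewrite Qw.
  by exists v; rewrite !inE // Qv; move: ov Q1; clear; lia.
- apply: (all3 (fun w => odd (Q' w) -> Q' w = d w)).
  + by rewrite Qu /= ou.
  + by rewrite Qv; move: ov Q1; clear; lia.
  + by move=> w h1 h2; rewrite Qw //; apply: ho.
- apply: (all3 (fun w => Q' w <= (d w).+1)).
  + by rewrite Qu du.
  + by rewrite Qv dv; clear; lia.
  + by move=> w h1 h2; rewrite Qw.
- apply: (all3 (fun w => d w <= (Q' w).+1)).
  + by rewrite Qu du; clear; lia.
  + by rewrite Qv dv; clear; lia.
  + by move=> w h1 h2; rewrite Qw.
- apply: (all3 (fun w => ~~ odd (d w) -> Q' w = d w)).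
  + by rewrite -du ou.
  + by rewrite -dv ov.
  + by move=> w h1 h2; rewrite Qw //; apply: he.
- have [->|zu] := eqVneq z u; first by rewrite Qu du.
  by rewrite Qw // eq_sym.
- by have := sQ setT; rewrite !inE hs; clear; lia.
move=> A; have := sQ A; have := hA A.
have [vA|vA] := boolP (v \in A); last by move=> h1 /=; move: h1; clear; case: (u \in A); lia.
have [uA|uA] := boolP (u \in A); first by clear; lia.
(* A tight set through [v] but not [u] would meet [P] in a smaller tight set through [v]: [h] is
   supermodular on intersecting sets. *)
suff : 2 * h A < smn Q A by clear; lia.
rewrite ltnNge; apply/negP=> tA.
have : t (A :&: P).
  rewrite /t inE vA vP /=; have := smn_modular Q A P; have := ein_supermod F A P.
  have := hA (A :|: P); move: tA tP; rewrite /h !inE.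
  have -> : A == set0 = false by apply/negP=> /eqP e; rewrite e inE in vA.
  have -> : P == set0 = false by apply/negP=> /eqP e; rewrite e inE in vP.
  have -> : A :|: P == set0 = false by apply/negP=> /eqP/setP/(_ v); rewrite !inE vA.
  have -> : A :&: P == set0 = false by apply/negP=> /eqP/setP/(_ v); rewrite !inE vA vP.
  by rewrite !orbF; case: (z \in A); case: (z \in P) => /=; clear; lia.
move/mP; rewrite leqNgt proper_card //; apply/properP; split; first exact: subsetIr.
by exists u; rewrite // inE (negbTE uA).
Qed.

End Rounding.

(** Half the degrees are a fractional solution: with [Q] the degree, the condition at a set avoiding
    [z] reduces to [2 * L <= cut F A]. [rounding] makes it integral. *)
Lemma balanced_orientation F z L :
  (forall A, A != set0 -> A != setT -> 2 * L <= cut F A) ->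
  exists F', [/\ reor F F',
    forall v, odeg F' v = (odeg F v + ideg F v)./2 \/ odeg F' v = uphalf (odeg F v + ideg F v),
    odeg F' z = uphalf (odeg F z + ideg F z) &
    forall A, A != set0 -> z \notin A -> L <= dout F' A].
Proof.
move=> hL.
have [||||||||q [q1 q2 q3 q4]] := @rounding F z L #|V| (fun v => odeg F v + ideg F v) => //.
- exact: max_card.
- rewrite smn_deg /ein (eq_count (a2 := predT)) => [|e]; last by rewrite !inE.
  rewrite count_predT (_ : cut F setT = 0) ?addn0 //.
  by rewrite /cut -[RHS](count_pred0 F); apply: eq_count => e; rewrite !inE.
- move=> A; rewrite smn_deg; case: ifP => [_|/norP[zA A0]]; first by clear; lia.
  have := hL A A0; suff -> : A != setT by move=> /(_ isT); clear; lia.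
  by apply/eqP=> e; rewrite e inE in zA.
have [|F' rF oF] := orientation_outdeg q3.
  by move=> A; apply: leq_trans (q4 A); apply: leq_addr.
exists F'; split=> //; first by move=> v; rewrite oF.
  by rewrite oF.
move=> A A0 zA; have := smn_odeg F' A; rewrite (eq_smn A oF).
have := q4 A; rewrite (negbTE zA) (negbTE A0) /=.
have -> : ein F' A = ein F A.
  rewrite /ein; elim: (F) (F') rF {oF hL q1 q2 q3 q4} => [|e F1 IH] [|e' F1'] //= /andP[he /IH->].
  by case/orP: he => /eqP->; rewrite //= andbC.
by clear; lia.
Qed.

End Balanced.

(** * Edge-disjoint branchings *)

Section Branchings.
Local Open Scope nat_scope.
Variables (V E : finType) (p : E -> V * V) (z : V).
Implicit Types (A R : {set V}) (S B : {set E}).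

Definition arcs S := [seq p e | e <- enum S].

Lemma arcs_D1 S e : e \in S -> perm_eq (arcs S) (p e :: arcs (S :\ e)).
Proof.
move=> eS; apply: (perm_map p (t := e :: enum (S :\ e))).
apply: uniq_perm; rewrite /= ?enum_uniq ?mem_enum ?inE ?eqxx // => x.
by rewrite inE !mem_enum !inE; case: eqP => // ->.
Qed.

Lemma arcs_U1 S e : e \notin S -> perm_eq (arcs (e |: S)) (p e :: arcs S).
Proof. by move=> eS; have := arcs_D1 (setU11 e S); rewrite setU1K. Qed.

Lemma arcs_D S B : B \subset S -> perm_eq (arcs S) (arcs B ++ arcs (S :\: B)).
Proof.
move=> BS; rewrite -map_cat; apply: perm_map.
apply: uniq_perm; rewrite ?cat_uniq ?enum_uniq //=.
  by rewrite andbT; apply/hasPn=> x; rewrite !mem_enum !inE => /andP[].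
move=> x; rewrite mem_cat !mem_enum !inE; have := subsetP BS x.
by case: (x \in B) => //= ->.
Qed.

Lemma count_arcs (a : pred (V * V)) S : 0 < count a (arcs S) -> exists2 e, e \in S & a (p e).
Proof.
by case/count_ex=> x /mapP[e]; rewrite mem_enum => eS -> h; exists e.
Qed.

Lemma count_arcs_gt0 (a : pred (V * V)) S e : e \in S -> a (p e) -> 0 < count a (arcs S).
Proof.
by move=> eS h; rewrite -has_count; apply/hasP; exists (p e) => //; apply: map_f; rewrite mem_enum.
Qed.

Definition reaches n S := forall A, A != set0 -> z \notin A -> n <= dout (arcs S) A.

Definition branching B := exists2 rank : V -> nat,
  forall e, e \in B -> rank (p e).2 < rank (p e).1 &
  forall v, odeg (arcs B) v = (v != z).

(** Lovasz's argument: leave the partial branching through a minimal tight set not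
    contained in [R]. *)
Lemma extend_branching n S B R : reaches n.+1 S -> B \subset S -> reaches n (S :\: B) ->
  z \in R -> R != setT -> (forall e, e \in B -> (p e).1 \in R) ->
  exists e, [/\ e \in S :\: B, (p e).1 \notin R, (p e).2 \in R & reaches n (S :\: B :\ e)].
Proof.
move=> hS BS hB zR RT BR.
(* Arcs of [B] start in [R], so a set disjoint from [R] still has all its [n + 1] leaving arcs. *)
have out A : [disjoint A & R] -> dout (arcs S) A = dout (arcs (S :\: B)) A.
  move=> AR; rewrite (dout_perm A (arcs_D BS)) /dout count_cat.
  suff -> : count (fun e : V * V => (e.1 \in A) && (e.2 \notin A)) (arcs B) = 0 by [].
  apply/eqP; rewrite -leqn0 leqNgt; apply/negP=> /count_arcs[e /BR eR /andP[eA _]].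
  by have := disjointFr AR eA; rewrite eR.
have rem e A : e \in S :\: B -> dout (arcs (S :\: B)) A =
    ((p e).1 \in A) && ((p e).2 \notin A) + dout (arcs (S :\: B :\ e)) A.
  by move=> eS; rewrite (dout_perm A (arcs_D1 eS)).
pose t := fun A : {set V} => [&& z \notin A, ~~ (A \subset R) & dout (arcs (S :\: B)) A <= n].
have [A0 hA0|noA] := pickP t; last first.
  have [|e eS /andP[e1 e2]] := @count_arcs (fun e : V * V => (e.1 \in ~: R) && (e.2 \notin ~: R)) (S :\: B).
    rewrite -/(dout _ _) -out; last by rewrite disjoints_subset.
    apply: leq_trans (hS (~: R) _ _); rewrite ?inE ?zR //.
    by apply: contra RT => /eqP e; rewrite -(setCK R) e setC0.
  rewrite !inE negbK in e1 e2; exists e; split=> // A A0 zA.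
  have := hB A A0 zA; rewrite (rem e A eS).
  have [/andP[eA eA']|//] := boolP (((p e).1 \in A) && ((p e).2 \notin A)).
  rewrite add1n => _; have := noA A; rewrite /t zA (rem e A eS) eA eA' /= add1n.
  have -> : ~~ (A \subset R) by apply/subsetPn; exists (p e).1.
  by move/negbT; rewrite -ltnNge.
case: (arg_minnP (fun A : {set V} => #|A|) hA0) => {hA0 A0}A0 /and3P[zA0 A0R tA0] mA0.
(* [A0 :\: R] has [n + 1] leaving arcs but [A0] at most [n], so some arc runs from [A0 :\: R] to a
   vertex of [A0] in [R]. *)
have [e eS /and3P[e1 e2 e3]] : exists2 e, e \in S :\: B &
    [&& (p e).1 \in A0 :\: R, (p e).2 \in A0 & (p e).2 \in R].
  have := @count_arcs (fun e : V * V => [&& e.1 \in A0 :\: R, e.2 \in A0 & e.2 \in R]) (S :\: B).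
  apply; rewrite -(ltn_add2l (dout (arcs (S :\: B)) A0)) addn0.
  apply: (@leq_trans n.+1); first by rewrite ltnS.
  apply: leq_trans (hS (A0 :\: R) _ _) _; rewrite ?inE ?zR ?setD_eq0 //.
  rewrite out; last by rewrite disjoints_subset; apply/subsetP=> v; rewrite !inE => /andP[].
  elim: (arcs _) => // -[a b] l IH; rewrite !dout_cons /= !inE.
  move: (dout l _) (dout l _) (count _ l) IH => n1 n2 n3.
  by case: (a \in A0); case: (b \in A0); case: (a \in R); case: (b \in R) => /=; clear; lia.
rewrite inE in e1; case/andP: e1 => e1R e1A.
exists e; split=> // A A1 zA.
have := hB A A1 zA; rewrite (rem e A eS).
have [/andP[eA eA']|//] := boolP (((p e).1 \in A) && ((p e).2 \notin A)).
rewrite add1n => _; rewrite -ltnS -add1n.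
suff : n < dout (arcs (S :\: B)) A by rewrite (rem e A eS) eA eA'.
rewrite ltnNge; apply/negP=> tA.
have : t (A :&: A0).
  rewrite /t inE negb_and zA /=; apply/andP; split.
    by apply/subsetPn; exists (p e).1; rewrite // inE eA.
  have := dout_submod (arcs (S :\: B)) A A0.
  have : n <= dout (arcs (S :\: B)) (A :|: A0).
    by apply: hB; [apply/set0Pn; exists (p e).1; rewrite inE eA | rewrite inE negb_or zA].
  by move: tA tA0; clear; lia_count.
move/mA0; rewrite leqNgt proper_card //; apply/properP; split; first exact: subsetIr.
by exists (p e).2; rewrite // inE (negbTE eA').
Qed.

Lemma branching_exists n S : reaches n.+1 S ->
  exists B, [/\ B \subset S, branching B & reaches n (S :\: B)].
Proof.
move=> hS.
suff main j B R : #|~: R| = j -> B \subset S -> reaches n (S :\: B) -> z \in R ->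
    (forall e, e \in B -> (p e).1 \in R /\ (p e).2 \in R) ->
    (exists2 rank : V -> nat, forall e, e \in B -> rank (p e).2 < rank (p e).1 &
       forall v, odeg (arcs B) v = (v \in R :\ z)) ->
    exists B, [/\ B \subset S, branching B & reaches n (S :\: B)].
  apply: (main _ set0 [set z] (erefl _)); rewrite ?sub0set ?inE ?eqxx //.
  - by rewrite setD0 => A A0 zA; apply: leq_trans (hS A A0 zA).
  - by move=> e; rewrite in_set0.
  - exists (fun => 0) => [e|v]; first by rewrite in_set0.
    by rewrite setDv in_set0 /arcs enum_set0.
elim: j B R => [|j IH] B R ej BS hB zR BR [rank hr od].
  exists B; split=> //; exists rank => // v; rewrite od !inE.
  by move/eqP: ej; rewrite cards_eq0 => /eqP/setP/(_ v); rewrite !inE => /negbFE->; rewrite andbT.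
have RT : R != setT by apply/eqP=> e; rewrite e setCT cards0 in ej.
have [e [eS e1 e2 he]] := extend_branching hS BS hB zR RT (fun f fB => proj1 (BR f fB)).
have [eSS eB] : e \in S /\ e \notin B by move: eS; rewrite !inE => /andP[].
apply: (IH (e |: B) ((p e).1 |: R)).
- have := cardsC R; have := cardsC ((p e).1 |: R); rewrite cardsU1 e1 ej; clear; lia.
- by rewrite subUset sub1set eSS.
- by rewrite setUC -setDDl.
- by rewrite !inE zR orbT.
- by move=> f; rewrite !inE => /orP[/eqP->|/BR[-> ->]]; rewrite ?eqxx ?e2 ?orbT.
exists (fun v => if v == (p e).1 then (rank (p e).2).+1 else rank v).
  move=> f; rewrite !inE => /orP[/eqP->|fB].
    by rewrite eqxx; case: eqP => // h; rewrite -h e2 in e1.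
  have -> : (p f).1 == (p e).1 = false by apply/eqP=> h; rewrite -h (proj1 (BR f fB)) in e1.
  case: eqP => [h|_]; last exact: hr.
  by rewrite -h (proj2 (BR f fB)) in e1.
move=> v; rewrite /odeg ((permP (arcs_U1 eB)) _) /= -/(odeg _ _) od !inE.
have [<-|_] := eqVneq (p e).1 v; last by rewrite eq_sym; case: eqP.
rewrite (negbTE e1) andbF addn0; case: eqP => // h; rewrite h zR in e1.
by [].
Qed.

End Branchings.

(** * Packing branchings *)

Section Packing.
Local Open Scope nat_scope.
Variables (V E : finType) (p : E -> V * V) (z : V).
Implicit Types (A R : {set V}) (S B : {set E}).
Hypothesis V1 : 1 < #|V|.

(** The vertex of least rank other than the root sends its arc to the root. The packings thus enter
    [z] often enough to pay for the terms [m] and [m0] in the degree range there. *)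
Lemma branching_root B : branching p z B -> 0 < ideg (arcs p B) z.
Proof.
case=> rank hr od.
have [v0 v0z] : exists v, v != z.
  have : 0 < #|[set~ z]| by rewrite cardsC1; move: V1; clear; lia.
  by case/card_gt0P=> v; rewrite !inE; exists v.
case: (@arg_minnP _ v0 (fun v => v != z) rank v0z) => v vz mv.
have : 0 < odeg (arcs p B) v by rewrite od vz.
case/count_arcs=> e eB /eqP ev; apply: (count_arcs_gt0 eB); have := hr e eB.
by case: eqP => // /eqP h; have := mv _ h; rewrite ev leqNgt => /negbTE->.
Qed.

Lemma branching_packing n l S : reaches p z (n + l) S ->
  exists (M : {set E}) (Bs : nat -> {set E}), [/\ M \subset S, reaches p z l (S :\: M),
    (forall v, odeg (arcs p M) v = n * (v != z)), n <= ideg (arcs p M) z &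
    (forall i, i < n -> Bs i \subset M /\ branching p z (Bs i)) /\
    (forall i j, i < n -> j < n -> i != j -> [disjoint Bs i & Bs j])].
Proof.
elim: n S => [|n IH] S hS.
  exists set0, (fun => set0); split; rewrite ?sub0set ?setD0 //.
  by move=> v; rewrite /arcs enum_set0.
have [B [BS Bb hB]] := branching_exists hS.
have [M [Bs [MS hM oM iM [h1 h2]]]] := IH _ hB.
have BM : [disjoint B & M].
  rewrite disjoint_sym disjoints_subset; apply: subset_trans MS _.
  by rewrite setDE subsetIr.
have pM : perm_eq (arcs p (B :|: M)) (arcs p B ++ arcs p M).
  have := arcs_D p (subsetUl B M); suff -> : (B :|: M) :\: B = M by [].
  by rewrite setDUl setDv set0U; apply/setDidPl; rewrite disjoint_sym.
exists (B :|: M), (fun i => if i == n then B else Bs i); split.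
- by rewrite subUset BS (subset_trans MS) // subsetDl.
- by rewrite -setDDl.
- by move=> v; rewrite /odeg (permP pM) count_cat -!/(odeg _ _) oM; case: Bb => rk _ ->; rewrite mulSn.
- rewrite /ideg (permP pM) count_cat -!/(ideg _ _).
  by have := branching_root Bb; move: iM; clear; lia.
- split=> [i|i j]; rewrite ltnS leq_eqVlt.
    have [_ _|_ /= /h1[h3 h4]] := eqVneq i n; first by split; rewrite ?subsetUl.
    by split=> //; apply: subset_trans h3 (subsetUr _ _).
  rewrite ltnS [j <= n]leq_eqVlt.
  have dB i' : i' < n -> [disjoint B & Bs i'].
    by move=> /h1[h3 _]; apply: disjointWr BM.
  have [->|_] := eqVneq i n; have [->|_] := eqVneq j n => //=; rewrite ?eqxx //.
  + by move=> _ jn _; apply: dB.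
  + by move=> ni _ _; rewrite disjoint_sym; apply: dB.
  + exact: h2.
Qed.

End Packing.

(** * Branchings as spanning trees *)

Section SpanningTrees.
Local Open Scope nat_scope.
Variables (G : mgraph) (p : edge G -> vert G * vert G) (z : vert G).
Hypothesis hp : forall e, p e = (src e, tgt e) \/ p e = (tgt e, src e).

Lemma joins_arc e : joins e (p e).1 (p e).2.
Proof. by case: (hp e) => ->; rewrite /joins !eqxx ?orbT. Qed.

Lemma joins_sym e (u v : vert G) : joins e u v = joins e v u.
Proof. by rewrite /joins orbC. Qed.

Lemma joins_tail e (u v : vert G) (rank : vert G -> nat) :
  joins e u v -> rank (p e).2 < rank (p e).1 -> rank v <= rank u -> (p e).1 = u.
Proof.
case/orP=> /andP[/eqP<- /eqP<-]; case: (hp e) => -> //= h1 h2.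
  by move: h1; rewrite ltnNge h2.
by move: h1; rewrite ltnNge h2.
Qed.

Lemma odeg_uniq (B : {set edge G}) e f v : odeg (arcs p B) v <= 1 -> e \in B -> f \in B ->
  (p e).1 = v -> (p f).1 = v -> e = f.
Proof.
move=> h eB fB ev fv; apply/eqP; apply/negP=> /negP ne.
have fB' : f \in B :\ e by rewrite !inE eq_sym ne.
move: h; rewrite /odeg (permP (arcs_D1 p eB)) /= ev eqxx (permP (arcs_D1 p fB')) /= fv eqxx.
by [].
Qed.

Lemma branching_spanning_tree B : branching p z B -> spanning_tree B.
Proof.
case=> rank hr od; split.
  have sym : connect_sym (adj B).
    apply: sym_connect_sym => u v; rewrite /adj /=.
    by apply: eq_existsb => e; rewrite joins_sym.
  have toz v : connect (adj B) v z.
    move: {2}(rank v) (leqnn (rank v)) => n; elim: n v => [|n IH] v hn.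
      have [->|vz] := eqVneq v z; first exact: connect0.
      have : 0 < odeg (arcs p B) v by rewrite od vz.
      case/count_arcs=> e /hr eB /eqP ev; rewrite ev in eB.
      by move: (leq_trans eB hn).
    have [->|vz] := eqVneq v z; first exact: connect0.
    have : 0 < odeg (arcs p B) v by rewrite od vz.
    case/count_arcs=> e eB /eqP ev.
    apply: (connect_trans (y := (p e).2)); last first.
      by apply: IH; rewrite -ltnS (leq_trans _ hn) // -ev; apply: hr.
    by apply: connect1; apply/existsP; exists e; rewrite eB -ev joins_arc.
  by move=> u v; apply: (connect_trans (toz u)); rewrite sym.
case=> n [c [e [ci ei h]]].
(* At a vertex of largest rank on the cycle both cycle edges are leaving arcs, hence equal; the
   cycle is then a loop, along which the rank cannot fall. *)
have [i0 _ mi] := @arg_maxnP _ ord0 predT (fun i => rank (c i)) isT.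
have mi' j : rank (c j) <= rank (c i0) by apply: mi.
have [e1B j1] := h i0; have [e2B j2] := h (ord_pred i0).
rewrite ord_predK in j2; rewrite joins_sym in j2.
have t1 := joins_tail j1 (hr _ e1B) (mi' _).
have t2 := joins_tail j2 (hr _ e2B) (mi' _).
have : e i0 = e (ord_pred i0).
  by apply: (odeg_uniq _ e1B e2B t1 t2); rewrite od leq_b1.
move/ei => ii; have sS : ordS i0 = i0 by rewrite {1}ii ord_predK.
have := hr _ e1B; rewrite sS in j1; move: j1; rewrite /joins orbb => /andP[/eqP es /eqP et].
by case: (hp (e i0)) => ->; rewrite /= es et ltnn.
Qed.

Lemma packing_tree_connected n (F : {set edge G}) (Bs : nat -> {set edge G}) :
  (forall i, i < n -> Bs i \subset F /\ branching p z (Bs i)) ->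
  (forall i j, i < n -> j < n -> i != j -> [disjoint Bs i & Bs j]) ->
  tree_connected n F.
Proof.
move=> h1 h2; exists (fun i => Bs i); split=> [i|i|i j ij].
- by case: (h1 i (ltn_ord i)).
- by apply: branching_spanning_tree; case: (h1 i (ltn_ord i)).
- exact: h2.
Qed.

End SpanningTrees.

(** * From arc lists back to the edges of the graph *)

Lemma reor_fun (I V : finType) (f : I -> V * V) (es : seq I) F' : uniq es ->
  reor [seq f e | e <- es] F' ->
  exists2 p : I -> V * V, F' = [seq p e | e <- es] &
    forall e, p e = f e \/ p e = ((f e).2, (f e).1).
Proof.
elim: es F' => [|e es IH] [|e' F'] //=; first by exists f => // e; left.
case/andP=> ene ues /andP[he /(IH _ ues)[p -> hp]].
exists (fun x => if x == e then e' else p x).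
  rewrite eqxx; congr (_ :: _); apply/eq_in_map=> x xes.
  by case: eqP => // xe; rewrite -xe xes in ene.
by move=> x; case: eqP => // ->; case/orP: he => /eqP->; [left | right].
Qed.

Lemma edge_connected_cut (G : mgraph) l (A : {set vert G}) : edge_connected G l ->
  A != set0 -> A != setT ->
  (l <= cut [seq (src e, tgt e) | e <- enum [set: edge G]] A)%N.
Proof.
case=> _ hc A0 AT; rewrite leqNgt; apply/negP=> hlt.
pose S := [set e : edge G | (src e \in A) != (tgt e \in A)].
have cS : #|S| = cut [seq (src e, tgt e) | e <- enum [set: edge G]] A.
  rewrite /cut count_map cardE -size_filter; apply/perm_size/uniq_perm.
  - exact: enum_uniq.
  - by rewrite filter_uniq ?enum_uniq.
  - by move=> e; rewrite [LHS]mem_enum mem_filter mem_enum !inE andbT.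
rewrite -cS in hlt.
have [u uA] := set0Pn _ A0.
have [v vA] : exists v, v \notin A.
  by apply/existsP; rewrite -negb_forall; apply: contra AT => /forallP h; apply/eqP/setP=> v; rewrite inE h.
have cl : closed (adj (~: S)) (mem A).
  move=> a b /existsP[e /andP[]]; rewrite !inE negbK => /eqP h.
  by case/orP=> /andP[/eqP <- /eqP <-]; rewrite /= ?h.
by have := closed_connect cl (hc S hlt u v); rewrite /= uA (negbTE vA).
Qed.

Lemma count_arcsE (V E : finType) (p : E -> V * V) (a : pred (V * V)) (S : {set E}) :
  count a (arcs p S) = (\sum_(e in S) a (p e))%N.
Proof.
rewrite -big_enum /arcs /=; elim: (enum S) => [|e l IH] /=; first by rewrite big_nil.
by rewrite big_cons IH.
Qed.

Lemma net_odeg (V : finType) (F : seq (V * V)) v : net F v = (odeg F v)%:Z - (ideg F v)%:Z.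
Proof.
elim: F => [|[a b] F IH]; first by rewrite net_nil.
by rewrite net_cons IH /odeg /ideg /= !PoszD; ring.
Qed.

Lemma dout_odeg (V : finType) (F : seq (V * V)) v : unlooped F -> dout F [set v] = odeg F v.
Proof.
move=> nl; apply: eq_in_count => e /(allP nl); rewrite !inE.
by case: (e.1 =P v) => [->|//]; rewrite eq_sym.
Qed.

Lemma din_ideg (V : finType) (F : seq (V * V)) v : unlooped F -> din F [set v] = ideg F v.
Proof.
move=> nl; apply: eq_in_count => e /(allP nl); rewrite !inE.
by case: (e.2 =P v) => [->|_]; rewrite ?andbT ?andbF.
Qed.

(** * Degrees in bipartite graphs *)

Section Bipartite.
Variables (G : mgraph) (X : {set vert G}).
Hypothesis hX : forall e : edge G, (src e \in X) != (tgt e \in X).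
Implicit Types (S : {set edge G}) (v : vert G).

Definition inc (e : edge G) v : int := (src e == v)%:Z + (tgt e == v)%:Z.
Definition side v : int := if v \in X then 1 else -1.

Lemma card_setIP S (P : pred (edge G)) : #|[set e in S | P e]| = (\sum_(e in S) P e)%N.
Proof.
rewrite -sum1_card (eq_bigl (fun e => (e \in S) && P e)); last by move=> e; rewrite inE.
by rewrite big_mkcondr; apply: eq_bigr => e _; case: (P e).
Qed.

Lemma deg_sum S v : (deg S v)%:Z = \sum_(e in S) inc e v.
Proof.
rewrite /deg !card_setIP -big_split /= (big_morph Posz PoszD (erefl _)).
by apply: eq_bigr => e _; rewrite /inc PoszD.
Qed.

Lemma side_deg S : \sum_v side v * (deg S v)%:Z = 0.
Proof.
under eq_bigr do rewrite deg_sum mulr_sumr.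
rewrite exchange_big big1 //= => e _.
have h u : \sum_v side v * (u == v)%:Z = side u.
  rewrite (bigD1 u) //= eqxx mulr1 big1 ?addr0 // => v vu.
  by rewrite eq_sym (negbTE vu) mulr0.
under eq_bigr do rewrite mulrDr; rewrite big_split /= !h /side; have := hX e.
by case: (src e \in X); case: (tgt e \in X).
Qed.

Section Oriented.
Variable p : edge G -> vert G * vert G.
Hypothesis hp : forall e, p e = (src e, tgt e) \/ p e = (tgt e, src e).

Lemma deg_arcs S v : deg S v = (odeg (arcs p S) v + ideg (arcs p S) v)%N.
Proof.
rewrite /odeg /ideg !count_arcsE /deg !card_setIP -!big_split; apply: eq_bigr => e _ /=.
by case: (hp e) => -> //=; rewrite addnC.
Qed.

Lemma unlooped_arcs S : unlooped (arcs p S).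
Proof.
apply/allP=> x /mapP[e _ ->]; have := hX e.
by case: (hp e) => -> /=; apply: contraNneq => ->.
Qed.

(** Among the edges at a vertex of [X], those with tail in [X] are the leaving ones; at any other
    vertex they are the entering ones. *)
Lemma net_side S v : net (arcs p S) v =
  side v * (2 * (deg [set e in S | (p e).1 \in X] v)%:Z - (deg S v)%:Z).
Proof.
rewrite /net /arcs big_map big_enum /= !deg_sum.
have -> : \sum_(e in [set e in S | (p e).1 \in X]) inc e v =
    \sum_(e in S) if (p e).1 \in X then inc e v else 0.
  by rewrite -big_mkcondr; apply: eq_bigl => e; rewrite inE.
rewrite mulr_sumr -sumrB mulr_sumr; apply: eq_bigr => e _.
have := hX e; rewrite /inc /side; case: (hp e) => -> /=;
  (case: (src e =P v) => [<-|_]; last by case: (tgt e =P v) => [<-|_];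
     [case: (src e \in X); case: (tgt e \in X) | case: (src e \in X); case: (v \in X); case: (tgt e \in X)]);
  (case: (tgt e =P src e) => [->|_]; first by rewrite eqxx);
  by case: (src e \in X); case: (tgt e \in X).
Qed.

End Oriented.
End Bipartite.

(** * Assembling the factor *)

Lemma factor_with_degrees_mod (m m0 k : nat) (G : mgraph) (X : {set vert G})
    (g : vert G -> int) (z : vert G) : (2 <= k)%N ->
  (forall e : edge G, (src e \in X) != (tgt e \in X)) ->
  edge_connected G (2 * m + 2 * m0 + 4 * k - 4)%N ->
  (k%:Z %| \sum_v side X v * g v)%Z -> in_degree_range m m0 k z (g z) ->
  exists H : {set edge G},
    [/\ tree_connected m H, tree_connected m0 (~: H),
        forall v, (k%:Z %| (deg H v)%:Z - g v)%Z,
        forall v, in_degree_range m m0 k v (deg H v)%:Z & (deg H z)%:Z = g z].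
Proof.
move=> hk hX hconn hsum hz.
have V1 : (1 < #|vert G|)%N by case: hconn.
pose l := (2 * k - 2)%N.
pose F0 := [seq (src e, tgt e) | e <- enum [set: edge G]].
have hcut A : A != set0 -> A != setT -> (2 * (m + (m0 + l)) <= cut F0 A)%N.
  move=> A0 AT; have := edge_connected_cut hconn A0 AT; apply: leq_trans.
  by rewrite /l; move: hk; clear; lia.
have [F' [rF dF zF oF]] := balanced_orientation z hcut.
have [p eF hp] := reor_fun (enum_uniq _) rF.
have {}hp e : p e = (src e, tgt e) \/ p e = (tgt e, src e) by exact: hp.
have {eF} eF : F' = arcs p setT := eF.
have degF0 v : (odeg F0 v + ideg F0 v)%N = deg [set: edge G] v.
  by rewrite (@deg_arcs G (fun e => (src e, tgt e))) // => e; left.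
have hL : reaches p z (m + (m0 + l)) setT by move=> A A0 zA; rewrite -eF; apply: oF.
have [M1 [Bs1 [M1S hM1 o1 i1 [b1 d1]]]] := branching_packing V1 hL.
have [M2 [Bs2 [M2S hM2 o2 i2 [b2 d2]]]] := branching_packing V1 hM1.
set R := setT :\: M1 :\: M2 in hM2; pose T := arcs p R.
have cnt a : count a (arcs p setT) = (count a (arcs p M1) + count a (arcs p M2) + count a T)%N.
  by rewrite (permP (arcs_D p M1S)) count_cat (permP (arcs_D p M2S)) count_cat addnA.
have oE v : odeg F' v = (m * (v != z) + m0 * (v != z) + odeg T v)%N.
  by rewrite eF /odeg cnt -!/(odeg _ _) o1 o2.
have iE v : ideg F' v = (ideg (arcs p M1) v + ideg (arcs p M2) v + ideg T v)%N.
  by rewrite eF /ideg cnt.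
have dE v : deg [set: edge G] v = (odeg F' v + ideg F' v)%N by rewrite (deg_arcs hp) eF.
have dM1 v : deg M1 v = (m * (v != z) + ideg (arcs p M1) v)%N by rewrite (deg_arcs hp) o1.
have dM2 v : deg M2 v = (m0 * (v != z) + ideg (arcs p M2) v)%N by rewrite (deg_arcs hp) o2.
have dT v : deg R v = (odeg T v + ideg T v)%N by rewrite (deg_arcs hp).
have {}dF v : odeg F' v = (deg [set: edge G] v)./2 \/ odeg F' v = uphalf (deg [set: edge G] v).
  by have := dF v; rewrite degF0.
rewrite degF0 in zF.
have nl : unlooped T by apply: unlooped_arcs.
have TU : within setT T by apply/allP=> e; rewrite !inE.
have rT : rooted l setT z T.
  by move=> A AU A0; apply: hM2 => //; apply/negP=> /(subsetP AU); rewrite !inE eqxx.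
have dinz : (l <= ideg T z)%N.
  rewrite -(din_ideg z nl).
  have := hM2 (~: [set z]); rewrite !inE eqxx negbK => h.
  apply: leq_trans (h _ isT) _; last by apply: eq_leq; apply: eq_count => e; rewrite !inE negbK.
  by rewrite -card_gt0 cardsC1; move: V1; clear; lia.
(* There are enough arcs out of [z] to lift with: its out-degree was rounded up and no branching
   uses an arc leaving [z]. *)
have [||T' [O [spl sO rT' cT']]] := @lift_root _ l setT z T (ideg T z - l) TU rT.
- by rewrite din_ideg // subnKC.
- have := dE z; have := oE z; have := iE z; rewrite dout_odeg // eqxx zF.
  by move: (uphalf_half (deg [set: edge G] z)) => ->; clear; lia.
rewrite dout_odeg // in sO.
have [_ hO oT nT] := spl.
pose sg := side X; have sg2 v : sg v = 1 \/ sg v = -1 by rewrite /sg /side; case: ifP; [left | right].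
pose d v := (deg [set: edge G] v)%:Z.
(* [cM] is what the packings contribute, with [M1] inside the factor and [M2] outside; [r] is what
   remains to be realised by [T]. *)
pose cM v := sg v * ((deg M1 v)%:Z - (deg M2 v)%:Z).
pose r v := sg v * (2 * g v - d v) - cM v.
have rz : r z = sg z * (2 * g z - d z - (ideg (arcs p M1) z)%:Z + (ideg (arcs p M2) z)%:Z).
  by rewrite /r /cM dM1 dM2 eqxx !muln0 !add0n; ring.
(* The star alone takes the whole value prescribed at [z]. It is large enough because at least [m]
   arcs of [M1] and [m0] arcs of [M2] enter [z]. *)
have [so oso esz] : exists2 so, ori O so & so z = r z.
  have szO : (size O)%:Z = (uphalf (deg [set: edge G] z))%:Z - ((deg [set: edge G] z)./2)%:Z
      + (ideg (arcs p M1) z)%:Z + (ideg (arcs p M2) z)%:Z + l%:Z.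
    have := dE z; have := oE z; have := iE z; rewrite eqxx !muln0 !add0n zF => a1 a2 a3.
    have := uphalf_half (deg [set: edge G] z); have := odd_double_half (deg [set: edge G] z).
    by move: sO dinz a1 a2 a3; clear; lia.
  case: hz; rewrite /d => z1 z2.
  apply: (@ori_star _ z O (r z)).
  - by apply: sub_all hO => e /and3P[-> -> _].
  - rewrite szO rz /d /l; have := odd_double_half (deg [set: edge G] z).
    have := uphalf_half (deg [set: edge G] z).
    case: (sg2 z) => ->; rewrite ?mul1r ?mulN1r; move: z1 z2 i1 i2 hk; clear; lia.
  - suff : (2 %| r z - (size O)%:Z)%Z by case/dvdzP=> j ej; exists j; rewrite -ej; clear; lia.
    rewrite szO rz /d /l; have := odd_double_half (deg [set: edge G] z).
    have := uphalf_half (deg [set: edge G] z).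
    case: (sg2 z) => ->; rewrite ?mul1r ?mulN1r; move: hk; clear; lia.
pose b v := sg v * ((ideg (arcs p M1) v)%:Z - (ideg (arcs p M2) v)%:Z).
(* Away from [z], this makes [net T v + B v] the number of packing arcs entering [v], which bounds
   [b v]; balance gives [B v >= -1], hence [B v >= 1 - k]. *)
pose B v := (m + m0)%:Z + (ideg F' v)%:Z - (odeg F' v)%:Z.
have nTE v : net T v = (odeg T v)%:Z - (ideg T v)%:Z by apply: net_odeg.
have pso v : (2 %| so v - net O v)%Z.
  by have [_ [j ->]] := ori_cut1 v oso; rewrite net_dout cutE PoszD; clear; lia.
have nO v : v != z -> `|so v| <= - net O v.
  move=> vz; have [h _] := ori_cut1 v oso; move: h; rewrite net_dout cutE PoszD.
  suff -> : dout O [set v] = 0%N by clear; lia.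
  rewrite /dout -[RHS](count_pred0 O); apply: eq_in_count => e /(allP hO)/and3P[/eqP-> _ _].
  by rewrite !inE eq_sym (negbTE vz).
have prT v : (2 %| r v - net T v)%Z.
  rewrite /r /cM nTE; have := dT v; have := dE v; have := oE v; have := iE v; have := dM1 v; have := dM2 v.
  rewrite /d; case: (sg2 v) => ->; rewrite ?mul1r ?mulN1r.
    by clear; lia.
  by clear; lia.
have [||||||s' [os' cs' ws']] := @rooted_orientation _ k hk setT z T' (fun v => b v + so v) B (fun v => r v - so v).
- by rewrite inE.
- by apply/allP=> e; rewrite !inE.
- exact: rT'.
- move=> v _ vz; have := nT v; have := pso v; have := nO v vz; rewrite nTE /B.
  have := dE v; have := oE v; have := iE v; rewrite vz !muln1 /b.
  have := odd_double_half (deg [set: edge G] v); have := uphalf_half (deg [set: edge G] v).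
  have := dF v; case: (sg2 v) => ->; rewrite ?mul1r ?mulN1r => a1 a2 a3 a4 a5 a6 a7 a8 a9; split.
  + by move: a4 a5 a6 a7 a8 a9; clear; lia.
  + by move: a4 a5 a6 a7 a8 a9; clear; lia.
  + by move: a1 a2 a3 a6 hk; clear; lia.
  + by move: a4 a5 a6 a7 a8 a9; clear; lia.
  + by move: a4 a5 a6 a7 a8 a9; clear; lia.
  + by move: a1 a2 a3 a6 hk; clear; lia.
- by move=> v _; have := prT v; have := pso v; rewrite nT; clear; lia.
- rewrite (sm_add r (fun v => - so v)) sm_opp {2}/sm (ori_sum oso) ?subr0; last by apply/allP=> e; rewrite !inE.
  (* Signed degree sums vanish in a bipartite graph, so only [g] survives; the factor 2 turns
     divisibility by [k] into divisibility by [2k]. *)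
  have -> : sm r setT = 2 * \sum_v side X v * g v.
    have := side_deg hX setT; have := side_deg hX M1; have := side_deg hX M2 => e2 e1 e0.
    rewrite /sm (eq_bigl xpredT); last by move=> v; rewrite inE.
    rewrite (eq_bigr (fun v => 2 * (side X v * g v) + - (side X v * (deg [set: edge G] v)%:Z)
       + - (side X v * (deg M1 v)%:Z) + side X v * (deg M2 v)%:Z)).
      by rewrite !big_split /= !sumrN e0 e1 e2 mulr_sumr; ring.
    by move=> v _; rewrite /r /cM /d /sg; ring.
  case/dvdzP: hsum => j ->; apply/dvdzP; exists j; rewrite PoszM; ring.
pose s v := s' v + so v.
have [F2 rF2 sF2] : ori T s by apply: oT; apply: ori_cat.
have [q eF2 hq] := reor_fun (enum_uniq _) rF2.
have {}hq e : q e = (src e, tgt e) \/ q e = (tgt e, src e).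
  by case: (hq e) => ->; case: (hp e) => -> /=; [left | right | right | left].
have {}sF2 v : s v = net (arcs q R) v by rewrite sF2 eF2.
pose HR := [set e in R | (q e).1 \in X]; pose H := M1 :|: HR.
have degU (S1 S2 : {set edge G}) v : [disjoint S1 & S2] -> deg (S1 :|: S2) v = (deg S1 v + deg S2 v)%N.
  move=> dis; apply/eqP; rewrite -eqz_nat PoszD !deg_sum.
  by rewrite -bigU //; apply/eqP/eq_bigl => e; rewrite !inE.
have dH v : deg H v = (deg M1 v + deg HR v)%N.
  apply: degU; rewrite disjoint_sym disjoints_subset; apply/subsetP=> e.
  by rewrite !inE => /andP[/and3P[]].
have sE v : s v = sg v * (2 * (deg H v)%:Z - d v) - cM v.
  rewrite sF2 (net_side hX hq) -/HR dH /cM /d -/sg.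
  have := dT v; have := dE v; have := oE v; have := iE v; have := dM1 v; have := dM2 v.
  case: (sg2 v) => ->; rewrite ?mul1r ?mulN1r.
    by clear; lia.
  by clear; lia.
have mod v : (k%:Z %| (deg H v)%:Z - g v)%Z.
  have := cs' v; rewrite inE => /(_ isT).
  have -> : s' v - (r v - so v) = 2 * (sg v * ((deg H v)%:Z - g v)).
    by transitivity (s v - r v); [rewrite /s | rewrite sE /r]; ring.
  rewrite PoszM dvdz_mul2l //; case: (sg2 v) => ->; rewrite ?mul1r ?mulN1r ?rpredN //.
have Hz : (deg H z)%:Z = g z.
  (* Only [2k - 2] arcs of [T'] meet [z], too few for a nonzero multiple of [2k]. *)
  have s0 : s' z = 0.
    have := cs' z; rewrite inE esz subrr subr0 => /(_ isT) h.
    have [h2 _] := ori_cut1 z os'; rewrite cT' /l in h2.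
    have h3 : `|s' z| < 2 * (2 * k)%:Z by move: h2 hk; clear; lia.
    by case: (dvdz_lt2 h h3) => // e; move: h2 hk; rewrite e; clear; lia.
  have : s z = r z by rewrite /s s0 esz add0r.
  by rewrite sE /r; case: (sg2 z) => ->; rewrite ?mul1r ?mulN1r; clear; lia.
exists H; split=> //.
- apply: (packing_tree_connected hp (z := z)) d1 => i /b1[h1 h2]; split=> //.
  by apply: subset_trans h1 (subsetUl _ _).
- apply: (packing_tree_connected hp (z := z)) d2 => i /b2[h1 h2]; split=> //.
  apply: subset_trans h1 _; apply/subsetP=> e eM2; have := subsetP M2S e eM2.
  by rewrite !inE eM2 => /andP[/negbTE-> _].
- move=> v; have [->|vz] := eqVneq v z; first by rewrite Hz.
  have := ws' v; rewrite inE => /(_ isT vz).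
  (* The window is centred with a shift of [m - m0]; the [m + m0] in [B] turns this into [2m] above
     and [2m0] below, and halving gives the degree range. *)
  have -> : s' v + (b v + so v) = sg v * (2 * (deg H v)%:Z - d v - m%:Z + m0%:Z).
    transitivity (s v + b v); first by rewrite /s; ring.
    by rewrite sE /cM /b dM1 dM2 vz !muln1 !PoszD; ring.
  rewrite /B /in_degree_range /d; have := dE v.
  have := odd_double_half (deg [set: edge G] v); have := uphalf_half (deg [set: edge G] v).
  have := dF v; case: (sg2 v) => ->; rewrite ?mul1r ?mulN1r; move: hk; clear; lia.
Qed.

Lemma intr_Zp_eq0 (k : nat) (a : int) : (1 < k)%N -> (a%:~R == 0 :> 'Z_k) = (k%:Z %| a)%Z.
Proof.
move=> hk; have kk : k%:R = 0 :> 'Z_k by apply: pchar_Zp.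
have [q [n [e nk]]] : exists q (n : nat), a = q * k%:Z + n%:Z /\ (n < k)%N.
  exists (a %/ k%:Z)%Z, `|(a %% k%:Z)%Z|%N.
  have h1 : 0 <= (a %% k%:Z)%Z by apply: modz_ge0; move: hk; clear; lia.
  have h2 : (a %% k%:Z)%Z < k%:Z by apply: ltz_pmod; move: hk; clear; lia.
  by rewrite gez0_abs // -divz_eq; split=> //; move: h1 h2; clear; lia.
have -> : a%:~R = n%:R :> 'Z_k.
  by rewrite e intrD intrM -!pmulrn kk mulr0 add0r.
have -> : (k%:Z %| a)%Z = (n == 0%N).
  apply/idP/eqP=> [h|n0]; last by rewrite e n0 addr0 dvdz_mull.
  have : (k%:Z %| n%:Z)%Z by apply: dvd_eq (rpredB h (dvdz_mull q (dvdzz k%:Z))) _; rewrite e; ring.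
  by rewrite dvdzE /= /dvdn modn_small // => /eqP.
apply/eqP/eqP=> [/(congr1 val)|->//].
by rewrite /= val_Zp_nat // modn_small.
Qed.

Theorem theorem6p4 (m m0 k : nat) (G : mgraph) (f : vert G -> 'Z_k)
    (hk : (2 <= k)%N) (hbip : bipartite G) (hf : compatible f)
    (hconn : edge_connected G (2 * m + 2 * m0 + 4 * k - 4)%N) :
  (exists H : {set edge G}, modulo_factor m m0 f H) /\
  (forall (z : vert G) (t : int),
     t%:~R = f z -> in_degree_range m m0 k z t ->
     exists H : {set edge G}, modulo_factor m m0 f H /\ (deg H z)%:Z = t).
Proof.
have [X hX] := hbip.
(* Neither side of the bipartition spans an edge, so compatibility with it leaves no correction
   term. *)
have fX : \sum_(v in X) f v = \sum_(v in ~: X) f v.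
  have e0 (Y : {set vert G}) : Y = X \/ Y = ~: X -> edges_in Y = 0%N.
    move=> hY; apply/eqP; rewrite cards_eq0; apply/eqP/setP=> e; rewrite !inE.
    by case: hY => ->; rewrite ?inE; have := hX e; case: (src e \in X); case: (tgt e \in X).
  by case: (hf X) => -[x]; rewrite e0; auto; rewrite leqn0 => /eqP->; rewrite muln0 subr0.
have second (z : vert G) (t : int) : t%:~R = f z -> in_degree_range m m0 k z t ->
     exists H : {set edge G}, modulo_factor m m0 f H /\ (deg H z)%:Z = t.
  move=> tz rz; pose g v : int := if v == z then t else (f v : nat)%:Z.
  have gf v : (g v)%:~R = f v.
    by rewrite /g; case: eqP => [->//|_]; rewrite -pmulrn natr_Zp.
  have [|| H [h1 h2 h3 h4 h5]] := @factor_with_degrees_mod m m0 k G X g z hk hX hconn.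
  - rewrite -intr_Zp_eq0 // (big_morph _ (@intrD _) (erefl _)).
    rewrite (bigID (mem X)) /= addr_eq0; apply/eqP; rewrite -sumrN.
    rewrite (eq_bigr f) => [|v vX]; last by rewrite /side vX mul1r.
    rewrite fX (eq_bigl (fun v => v \notin X)); last by move=> v; rewrite inE.
    by apply: eq_bigr => v /negbTE vX; rewrite /side vX mulN1r intrN opprK gf.
  - by rewrite /g eqxx.
  exists H; split; last by rewrite h5 /g eqxx.
  split=> // v; rewrite -(gf v) pmulrn; apply/eqP; rewrite -subr_eq0 -intrB intr_Zp_eq0 //.
split=> //.
have [z _] : exists z : vert G, z \in predT by apply/card_gt0P; case: hconn => /ltnW.
pose lo := ((deg [set: edge G] z)./2)%:Z - (k%:Z - 1) - m0%:Z.
(* The least degree from [lo] upwards in the class of [f z]; the admissible interval contains at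
   least [k] consecutive integers. *)
pose t := lo + (((f z : nat)%:Z - lo) %% k%:Z)%Z.
have [||H [hH _]] := second z t; last by exists H.
- rewrite -[RHS]natr_Zp pmulrn; apply/eqP; rewrite -subr_eq0 -intrB intr_Zp_eq0 //.
  apply/dvdzP; exists (- (((f z : nat)%:Z - lo) %/ k%:Z)%Z).
  have := divz_eq ((f z : nat)%:Z - lo) k%:Z; rewrite mulNr /t.
  by move: (_ * k%:Z) => y; clear; lia.
- have h1 : 0 <= (((f z : nat)%:Z - lo) %% k%:Z)%Z by apply: modz_ge0; move: hk; clear; lia.
  have h2 : (((f z : nat)%:Z - lo) %% k%:Z)%Z < k%:Z by apply: ltz_pmod; move: hk; clear; lia.
  move: h1 h2; rewrite /in_degree_range /t; move: (modz _ _) => y h1 h2.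
  rewrite /lo; have := uphalf_half (deg [set: edge G] z).
  by split; move: h1 h2 hk; clear; lia.
Qed.
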